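(* Let $\Omega$ be a row-finite, source-free quasi-product with quasi-factors $\Lambda$ (a row-finite, source-free $k_1$-graph) and $C_{n,k_2}$. If $\Lambda^0$ is finite, then $$C^*(\Omega)\cong\Big(\bigoplus_{i=0}^{n-1}C^*(\Omega_1^{w_i})\Big)\rtimes_\rho\mathbb Z^{k_2}\cong\Big(\bigoplus_{i=1}^{n}C^*(\Lambda)\Big)\rtimes_\rho\mathbb Z^{k_2},$$ where $\rho_x=\rho_1^{x_1}\cdots\rho_{k_2}^{x_{k_2}}$ for $x=(x_1,\dots,x_{k_2})\in\mathbb Z^{k_2}$, and in the last algebra $\rho$ is the action transported along isomorphisms $C^*(\Omega_1^{w_i})\cong C^*(\Lambda)$ coming from $k_1$-graph isomorphisms $\Omega_1^{w_i}\cong\Lambda$.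
   Context: Conventions: $\mathbb N=\{0,1,2,\dots\}$ and $e_1,\dots,e_k$ is the standard basis of $\mathbb N^k$. A $k$-graph is a countable category $\Lambda$ (objects identified with identity morphisms) with a functor $d:\Lambda\to\mathbb N^k$ such that whenever $d(\lambda)=m+n$ there are unique $\mu,\nu\in\Lambda$ with $\lambda=\mu\nu$, $d(\mu)=m$, $d(\nu)=n$. Write $\Lambda^0=d^{-1}(0)$, and $r(\lambda),s(\lambda)$ for range and source; $\mu\nu$ is defined when $s(\mu)=r(\nu)$. Put $v\Lambda^n=\{\lambda:r(\lambda)=v,\ d(\lambda)=n\}$. $\Lambda$ is row-finite if every $v\Lambda^n$ is finite and source-free if every $v\Lambda^n$ is nonempty. Isomorphisms of $k$-graphs are bijective degree-preserving functors. The one-skeleton $G(\Lambda)$ is the edge-colored directed graph with vertex set $\Lambda^0$, edge set $\{\lambda: d(\lambda)\in\{e_1,\dots,e_k\}\}$, source and range inherited from $\Lambda$, and $d(e)$ as the color of $e$. Isomorphisms of edge-colored directed graphs preserve source, range and color. For a directed graph $G$, $G^*$ is its category of finite paths $p_1\cdots p_n$ with $s(p_i)=r(p_{i+1})$ (vertices are paths of length $0$). The color order of $p_1\cdots p_n$ is $(d(p_1),\dots,d(p_n))$. Two paths in $G(\Lambda)^*$ are equivalent if they have the same composite in $\Lambda$; $[p]$ denotes the class (composite) of $p$. By the factorization property, for each path $p$ and each permutation of its color order there is exactly one path equivalent to $p$ with that color order. If $\Lambda$ is a $k_1$-graph and $\Gamma$ a $k_2$-graph, $\Lambda\times\Gamma$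 is the product $(k_1+k_2)$-graph with degree $(d_\Lambda,d_\Gamma)$. Its one-skeleton has vertices $\Lambda^0\times\Gamma^0$ and edges $(e,v)$ ($e$ an edge of $G(\Lambda)$, $v\in\Gamma^0$; colored as $e$) and $(x,f)$ ($x\in\Lambda^0$, $f$ an edge of $G(\Gamma)$; colored $e_{k_1+j}$ if $f$ has color $e_j$), with source and range computed coordinatewise. A $(k_1+k_2)$-graph $\Omega$ is a quasi-product with quasi-factors $\Lambda$ (a $k_1$-graph) and $\Gamma$ (a $k_2$-graph) if: (i) $G(\Omega)\cong G(\Lambda\times\Gamma)$; (ii) there are injective functors $\psi_1:\Lambda\to\Omega$ and $\psi_2:\Gamma\to\Omega$; (iii) $d_\Lambda=\pi_1 d_\Omega\psi_1$ and $d_\Gamma=\pi_2d_\Omega\psi_2$, where $\pi_i:\mathbb N^{k_1}\times\mathbb N^{k_2}\to\mathbb N^{k_i}$ are the projections. One fixes the identification $G(\Omega)=G(\Lambda\times\Gamma)$ and labels edges and paths of $G(\Omega)$ accordingly. Put $\Omega_1=d^{-1}(\mathbb N^{k_1}\times\{0\})$, $\Omega_2=d^{-1}(\{0\}\times\mathbb N^{k_2})$. Then $\Omega_1=\bigsqcup_{w\in\Gamma^0}\Omega_1^w\times\{w\}$ and $\Omega_2=\bigsqcup_{x\in\Lambda^0}\{x\}\times\Omega_2^x$, where $\Omega_1^w\times\{w\}$ (resp. $\{x\}\times\Omega_2^x$) is the $k_1$-graph (resp. $k_2$-graph) of all elements of $\Omega$ represented by paths in $G(\Lambda)\times\{w\}$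 (resp. $\{x\}\times G(\Gamma)$). For $p\in G(\Lambda)^*$, $([p],w)$ denotes the element of $\Omega_1^w\times\{w\}$ represented by the path $(p,w)$, and $[p]_w\in\Omega_1^w$ the corresponding element; similarly $(x,[q])$ for $q\in G(\Gamma)^*$. Conditions (ii)-(iii) in the definition of quasi-product are understood to guarantee that there are $w_0'\in\Gamma^0$ and $x_0\in\Lambda^0$ with $\Omega_1^{w_0'}\cong\Lambda$ and $\Omega_2^{x_0}\cong\Gamma$ as $k_1$- and $k_2$-graphs, respectively. Given $p\in G(\Lambda)^*$ and $q\in G(\Gamma)^*$, the element $([p],r(q))(s(p),[q])\in\Omega$ factors uniquely as $\beta\alpha$ with $\beta\in\Omega_2$, $\alpha\in\Omega_1$; here $\alpha\in\Omega_1^{s(q)}\times\{s(q)\}$ has the same degree as $([p],r(q))$. Define $q_\vartriangleleft(p)\in G(\Lambda)^*$ to be the unique path with the same color order as $p$ such that $([q_\vartriangleleft(p)],s(q))=\alpha$, and $\widehat q_\vartriangleleft:\Omega_1^{r(q)}\to\Omega_1^{s(q)}$ by $\widehat q_\vartriangleleft([p]_{r(q)})=[q_\vartriangleleft(p)]_{s(q)}$. $C_{n,k_2}$ ($n,k_2\ge1$) is the unique $k_2$-graph whose one-skeleton consists of $k_2$ parallel $n$-cycles, one of each color: vertices $w_0,\dots,w_{n-1}$ and, for $1\le j\le k_2$, edges $f_{0,j},\dots,f_{n-1,j}$ of color $e_j$ with $s(f_{i,j})=w_i$, $r(f_{i,j})=w_{i+1}$ (indices mod $n$). When $\Gamma=C_{n,k_2}$,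 each $(\widehat f_{i,j})_\vartriangleleft:\Omega_1^{w_{i+1}}\to\Omega_1^{w_i}$ is an isomorphism of $k_1$-graphs, and $\rho_{i,j}:C^*(\Omega_1^{w_{i+1}})\to C^*(\Omega_1^{w_i})$ denotes the induced $*$-isomorphism. For $1\le j\le k_2$, $\rho_j$ is the automorphism of $\bigoplus_{i=0}^{n-1}C^*(\Omega_1^{w_i})$ given by $\rho_j(a_0,\dots,a_{n-1})=(\rho_{0,j}(a_1),\rho_{1,j}(a_2),\dots,\rho_{n-1,j}(a_0))$. For a row-finite source-free $k$-graph $\Lambda$, $C^*(\Lambda)$ is the universal $C^*$-algebra generated by partial isometries $\{S_v:v\in\Lambda^0\}\cup\{S_e:e\text{ an edge of }G(\Lambda)\}$ such that: (CK1) the $S_v$ are mutually orthogonal projections; (CK2) $S_eS_f=S_{f'}S_{e'}$ whenever $e,e',f,f'$ are edges with $ef=f'e'$ in $\Lambda$; (CK3) $S_e^*S_e=S_{s(e)}$; (CK4) $S_v=\sum_{e\in v\Lambda^{e_i}}S_eS_e^*$ for all $v\in\Lambda^0$, $1\le i\le k$. An isomorphism of $k$-graphs induces the $*$-isomorphism mapping generators to the corresponding generators. *)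

(* Defs.v *)
From HB Require Import structures.
From mathcomp Require Import all_boot all_order all_algebra complex.
From mathcomp Require Import all_classical all_reals all_analysis.

Set Implicit Arguments.
Unset Strict Implicit.
Unset Printing Implicit Defensive.

Import Order.TTheory GRing.Theory Num.Theory.
Import numFieldNormedType.Exports.

Local Open Scope classical_set_scope.
Local Open Scope ring_scope.
Local Open Scope complex_scope.

(* A possibly non-unital complex C*-algebra.  As for every normed module over
   [R[i]], the norm takes its (nonnegative real) values in [R[i]]. *)
Record cstar_algebra (R : realType) := CStarAlgebra {
  cstar_space :> completeNormedModType R[i];
  amul : cstar_space -> cstar_space -> cstar_space;
  astar : cstar_space -> cstar_space;
  amulA : forall a b c, amul a (amul b c) = amul (amul a b) c;
  amulDl : forall a b c, amul (a + b) c = amul a c + amul b c;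
  amulDr : forall a b c, amul a (b + c) = amul a b + amul a c;
  amulZl : forall (z : R[i]) a b, amul (z *: a) b = z *: amul a b;
  amulZr : forall (z : R[i]) a b, amul a (z *: b) = z *: amul a b;
  astarK : forall a, astar (astar a) = a;
  astarD : forall a b, astar (a + b) = astar a + astar b;
  astarZ : forall (z : R[i]) a, astar (z *: a) = z^*%C *: astar a;
  astarM : forall a b, astar (amul a b) = amul (astar b) (astar a);
  norm_amul : forall a b, `|amul a b| <= `|a| * `|b|;
  norm_cstar : forall a, `|amul (astar a) a| = `|a| ^+ 2
}.

(* The l-infinity direct sum of a finite family of C*-algebras.  Since [R[i]] is
   not totally ordered, the maximum of the norms is taken in [R]. *)
Section DirectSum.
Variables (R : realType) (I : finType) (A : I -> cstar_algebra R).

Definition dsum_type := forall i, A i.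

HB.instance Definition _ := gen_eqMixin dsum_type.
HB.instance Definition _ := gen_choiceMixin dsum_type.

Let addf (a b : dsum_type) : dsum_type := fun i => a i + b i.
Let oppf (a : dsum_type) : dsum_type := fun i => - a i.
Let zerof : dsum_type := fun i => 0.

Let addfA : associative addf.
Proof. by move=> a b c; apply: functional_extensionality_dep => i; rewrite /addf addrA. Qed.
Let addfC : commutative addf.
Proof. by move=> a b; apply: functional_extensionality_dep => i; rewrite /addf addrC. Qed.
Let add0f : left_id zerof addf.
Proof. by move=> a; apply: functional_extensionality_dep => i; rewrite /addf add0r. Qed.
Let addNf : left_inverse zerof oppf addf.
Proof. by move=> a; apply: functional_extensionality_dep => i; rewrite /addf addNr. Qed.

HB.instance Definition _ :=
  GRing.isZmodule.Build dsum_type addfA addfC add0f addNf.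

Let scalef (z : R[i]) (a : dsum_type) : dsum_type := fun i => z *: a i.
Let scalefA z1 z2 a : scalef z1 (scalef z2 a) = scalef (z1 * z2) a.
Proof. by apply: functional_extensionality_dep => i; rewrite /scalef scalerA. Qed.
Let scale1f : left_id 1 scalef.
Proof. by move=> a; apply: functional_extensionality_dep => i; rewrite /scalef scale1r. Qed.
Let scalefDr : right_distributive scalef +%R.
Proof. by move=> z a b; apply: functional_extensionality_dep => i; rewrite /scalef scalerDr. Qed.
Let scalefDl a : {morph scalef^~ a : z1 z2 / z1 + z2}.
Proof. by move=> z1 z2; apply: functional_extensionality_dep => i; rewrite /scalef scalerDl. Qed.

HB.instance Definition _ := GRing.Zmodule_isLmodule.Build R[i] dsum_type
  scalefA scale1f scalefDr scalefDl.

Let nrm i (x : A i) : R := complex.Re `|x|.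
Let nrmE i (x : A i) : `|x| = (nrm x)%:C.
Proof. by have := ger0_Im (normr_ge0 x); rewrite /nrm; case: `|x| => a b /= ->. Qed.
Let nrm_ge0 i (x : A i) : 0 <= nrm x.
Proof. by have := normr_ge0 x; rewrite nrmE lecR. Qed.

Definition dsum_rnorm (a : dsum_type) : R :=
  \big[Num.max/0]_i complex.Re `|a i|.
Definition dsum_norm (a : dsum_type) : R[i] := (dsum_rnorm a)%:C.

Let rnorm_leP a (M : R) : 0 <= M ->
  dsum_rnorm a <= M <-> forall i, `|a i| <= M%:C.
Proof.
move=> M0; split=> [aM i|H].
  rewrite nrmE lecR; apply: le_trans aM.
  by rewrite /dsum_rnorm (le_bigmax_cond _ (fun i => nrm (a i))).
by apply: bigmax_le => // i _; have := H i; rewrite nrmE lecR.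
Qed.

Let rnorm_ge0 a : 0 <= dsum_rnorm a.
Proof. by rewrite /dsum_rnorm; apply: bigmax_ge_id. Qed.

Lemma dsum_norm_ge0 a : 0 <= dsum_norm a.
Proof. by rewrite /dsum_norm lecR. Qed.

Lemma dsum_norm_ge a i : `|a i| <= dsum_norm a.
Proof. by have [/(_ (lexx _))] := rnorm_leP a (rnorm_ge0 a). Qed.

Lemma dsum_norm_le a (M : R[i]) :
  0 <= M -> (forall i, `|a i| <= M) -> dsum_norm a <= M.
Proof.
move=> M0 H; have ME : M = (complex.Re M)%:C.
  by have := ger0_Im M0; case: M {M0 H} => x y /= ->.
rewrite ME lecR; apply/rnorm_leP; first by move: M0; rewrite ME lecR.
by rewrite -ME.
Qed.

Let ler_normDf a b : dsum_norm (a + b) <= dsum_norm a + dsum_norm b.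
Proof.
apply: dsum_norm_le => [|i]; first by rewrite addr_ge0 ?dsum_norm_ge0.
by rewrite (le_trans (ler_normD _ _))// lerD ?dsum_norm_ge.
Qed.

Let norm0f_eq0 a : dsum_norm a = 0 -> a = 0.
Proof.
move=> a0; apply: functional_extensionality_dep => i; apply/normr0_eq0.
by apply/le_anti/andP; rewrite -{1}a0 dsum_norm_ge normr_ge0.
Qed.

Let normfZ (z : R[i]) a : dsum_norm (z *: a) = `|z| * dsum_norm a.
Proof.
have le_Z (w : R[i]) b : dsum_norm (w *: b) <= `|w| * dsum_norm b.
  apply: dsum_norm_le => [|i]; first by rewrite mulr_ge0 ?dsum_norm_ge0.
  by rewrite normrZ ler_wpM2l ?dsum_norm_ge.
have [->|z0] := eqVneq z 0.
  apply/le_anti; rewrite le_Z normr0 mul0r /=; exact: dsum_norm_ge0.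
apply/le_anti; rewrite le_Z /= -ler_pdivlMl ?normr_gt0 //.
by rewrite -{1}[a]scale1r -(mulVf z0) -scalerA (le_trans (le_Z _ _)) // normfV.
Qed.

HB.instance Definition _ := Lmodule_isNormed.Build R[i] dsum_type
  ler_normDf normfZ norm0f_eq0.

Lemma dsum_normE (a : dsum_type) : `|a| = dsum_norm a.
Proof. by []. Qed.

Let dsum_complete (F : set_system dsum_type) : ProperFilter F -> cauchy F -> cvg F.
Proof.
move=> FF /cauchyP Fc.
pose l : dsum_type := fun i => lim ((fun a : dsum_type => a i) @ F).
have Fi i : cvg ((fun a : dsum_type => a i) @ F).
  apply: cauchy_cvg; apply/cauchyP => e /Fc [a Fa]; exists (a i).
  rewrite /fmap /=; apply: filterS Fa => b; rewrite -!ball_normE /=.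
  exact/le_lt_trans/(dsum_norm_ge (a - b)).
apply: (cvgP l); apply/cvgrPdist_le => e e0.
have : \forall b \near F, forall i, `|l i - b i| <= e.
  apply: filter_forall => i.
  by have /cvgrPdist_le := Fi i; apply.
by apply: filterS => b H; apply: dsum_norm_le => //; exact: ltW.
Qed.

HB.instance Definition _ := Uniform_isComplete.Build dsum_type dsum_complete.

Let mulf (a b : dsum_type) : dsum_type := fun i => amul (a i) (b i).
Let starf (a : dsum_type) : dsum_type := fun i => astar (a i).
Let norm_mulf a b : `|mulf a b| <= `|a| * `|b|.
Proof.
apply: dsum_norm_le => [|i]; first by rewrite mulr_ge0.
by rewrite (le_trans (norm_amul _ _))// ler_pM// dsum_norm_ge.
Qed.

Definition dsum : cstar_algebra R.
Proof.
refine (@CStarAlgebra R dsum_type mulf starf _ _ _ _ _ _ _ _ _ norm_mulf _).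
- by move=> a b c; apply: functional_extensionality_dep => i; exact: amulA.
- by move=> a b c; apply: functional_extensionality_dep => i; exact: amulDl.
- by move=> a b c; apply: functional_extensionality_dep => i; exact: amulDr.
- by move=> z a b; apply: functional_extensionality_dep => i; exact: amulZl.
- by move=> z a b; apply: functional_extensionality_dep => i; exact: amulZr.
- by move=> a; apply: functional_extensionality_dep => i; exact: astarK.
- by move=> a b; apply: functional_extensionality_dep => i; exact: astarD.
- by move=> z a; apply: functional_extensionality_dep => i; exact: astarZ.
- by move=> a b; apply: functional_extensionality_dep => i; exact: astarM.
move=> a; apply/le_anti/andP; split.
  apply: dsum_norm_le => [|i]; first by rewrite exprn_ge0.
  by rewrite norm_cstar lerXn2r ?nnegrE ?dsum_norm_ge.
have sq0 : 0 <= dsum_norm (mulf (starf a) a) := dsum_norm_ge0 _.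
rewrite -[leRHS]sqrtCK ler_pXn2r ?nnegrE ?sqrtC_ge0 ?normr_ge0 //.
apply: dsum_norm_le => [|i]; first by rewrite sqrtC_ge0.
rewrite -(@ler_pXn2r _ 2%N) ?nnegrE ?sqrtC_ge0 ?normr_ge0 // sqrtCK -norm_cstar.
exact: (dsum_norm_ge (mulf (starf a) a)).
Defined.

End DirectSum.

(* Objects are identified with identity morphisms, so a k-graph has a single
   sort; [kcomp x y] is only meaningful when [ksrc x = krng y].  Countability is
   carried by [countType], and N^k is ['rV[nat]_k], with standard basis vectors
   [delta_mx 0 i] (displayed ['e_i]). *)
Record kgraph (k : nat) := KGraph {
  kmor :> countType;
  ksrc : kmor -> kmor;
  krng : kmor -> kmor;
  kcomp : kmor -> kmor -> kmor;
  kdeg : kmor -> 'rV[nat]_k;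
  ksrc_src : forall x, ksrc (ksrc x) = ksrc x;
  krng_src : forall x, krng (ksrc x) = ksrc x;
  ksrc_rng : forall x, ksrc (krng x) = krng x;
  krng_rng : forall x, krng (krng x) = krng x;
  ksrc_comp : forall x y, ksrc x = krng y -> ksrc (kcomp x y) = ksrc y;
  krng_comp : forall x y, ksrc x = krng y -> krng (kcomp x y) = krng x;
  kcomp_idl : forall x, kcomp (krng x) x = x;
  kcomp_idr : forall x, kcomp x (ksrc x) = x;
  kcompA : forall x y z, ksrc x = krng y -> ksrc y = krng z ->
    kcomp x (kcomp y z) = kcomp (kcomp x y) z;
  kdeg_comp : forall x y, ksrc x = krng y -> kdeg (kcomp x y) = kdeg x + kdeg y;
  kfactor : forall x m n, kdeg x = m + n ->
    exists! p : kmor * kmor, [/\ ksrc p.1 = krng p.2, kcomp p.1 p.2 = x,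
                                 kdeg p.1 = m & kdeg p.2 = n]
}.

Section KGraphBasics.
Variables (k : nat) (L : kgraph k).

Definition is_vertex : pred L := fun x => kdeg x == 0.
Definition is_edge : pred L := fun x => [exists i, kdeg x == delta_mx 0 i].

Definition vertex := {x : L | is_vertex x}.
Definition edge := {x : L | is_edge x}.

Definition out_set (v : L) (m : 'rV[nat]_k) : set L :=
  [set x | krng x = v /\ kdeg x = m].

Definition row_finite := forall v m, is_vertex v -> finite_set (out_set v m).
Definition source_free := forall v m, is_vertex v -> out_set v m !=set0.

Lemma rowN_cancel (m n : 'rV[nat]_k) : m = m + n -> n = 0.
Proof.
move=> /matrixP H; apply/matrixP => i j; have := H i j; rewrite !mxE.
by rewrite -[LHS]addn0 => /addnI <-.
Qed.

Lemma rowN_eq0 (m n : 'rV[nat]_k) : m + n = 0 -> n = 0.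
Proof.
move=> /matrixP H; apply/matrixP => i j; have := H i j; rewrite !mxE.
by move/eqP; rewrite addn_eq0 => /andP[_ /eqP].
Qed.

Lemma kdeg_src (x : L) : kdeg (ksrc x) = 0.
Proof.
by apply: (@rowN_cancel (kdeg x)); rewrite -kdeg_comp ?krng_src// kcomp_idr.
Qed.

Lemma kdeg_rng (x : L) : kdeg (krng x) = 0.
Proof. by rewrite -ksrc_rng kdeg_src. Qed.

Lemma is_vertex_src x : is_vertex (ksrc x).
Proof. by rewrite /is_vertex kdeg_src. Qed.

Lemma is_vertex_rng x : is_vertex (krng x).
Proof. by rewrite /is_vertex kdeg_rng. Qed.

Lemma deg0_id (x : L) : kdeg x = 0 -> krng x = x /\ ksrc x = x.
Proof.
move=> x0; have [|p [_ pu]] := @kfactor _ L x 0 0; first by rewrite addr0.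
have [] : (krng x, x) = (x, ksrc x); last by move=> xE <-.
transitivity p; [symmetry|]; apply: pu => /=.
  by split; rewrite ?ksrc_rng ?kcomp_idl ?kdeg_rng.
by split; rewrite ?krng_src ?kcomp_idr ?kdeg_src.
Qed.

Lemma vertex_src (v : vertex) : ksrc (val v) = val v.
Proof. by case: v => v /= /eqP /deg0_id[]. Qed.

Lemma vertex_rng (v : vertex) : krng (val v) = val v.
Proof. by case: v => v /= /eqP /deg0_id[]. Qed.

End KGraphBasics.
Arguments row_finite {k} L.
Arguments source_free {k} L.
Arguments vertex {k} L.
Arguments edge {k} L.
Arguments is_vertex {k L}.
Arguments is_edge {k L}.

Section Morphisms.
Variables (k l : nat) (L : kgraph k) (M : kgraph l).

Definition is_functor (f : L -> M) : Prop :=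
  [/\ forall x, f (ksrc x) = ksrc (f x),
      forall x, f (krng x) = krng (f x) &
      forall x y, ksrc x = krng y -> f (kcomp x y) = kcomp (f x) (f y)].

End Morphisms.

Definition is_kgraph_iso (k : nat) (L M : kgraph k) (f : L -> M) : Prop :=
  [/\ is_functor f, bijective f & forall x, kdeg (f x) = kdeg x].

(* Directed graphs whose edges are colored by vectors of N^k. *)
Record cdigraph (k : nat) := CDigraph {
  gvert : Type;
  gedge : Type;
  gsrc : gedge -> gvert;
  grng : gedge -> gvert;
  gcol : gedge -> 'rV[nat]_k
}.

Record cdigraph_iso (k : nat) (G H : cdigraph k) := CDigraphIso {
  isoV : gvert G -> gvert H;
  isoE : gedge G -> gedge H;
  isoV_bij : bijective isoV;
  isoE_bij : bijective isoE;
  iso_src : forall e, gsrc (isoE e) = isoV (gsrc e);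
  iso_rng : forall e, grng (isoE e) = isoV (grng e);
  iso_col : forall e, gcol (isoE e) = gcol e
}.

(* [p = p_1 ... p_n] is a path with range [v] and source [u]:
   [r(p_1) = v], [s(p_i) = r(p_{i+1})] and [s(p_n) = u]. *)
Fixpoint is_path k (G : cdigraph k) (v : gvert G) (p : seq (gedge G))
    (u : gvert G) : Prop :=
  if p is e :: p' then grng e = v /\ is_path (gsrc e) p' u else v = u.

Definition skeleton (k : nat) (L : kgraph k) : cdigraph k :=
  @CDigraph k (vertex L) (edge L)
    (fun e => exist _ (ksrc (val e)) (is_vertex_src (val e)))
    (fun e => exist _ (krng (val e)) (is_vertex_rng (val e)))
    (fun e => kdeg (val e)).

(* The composite in [L] of a path with source [u]. *)
Definition composite k (L : kgraph k) (p : seq (edge L)) (u : vertex L) : L :=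
  foldr (fun e x => kcomp (val e) x) (val u) p.

(* Let [(jV, jE)] embed the colored graph [G] in the one-skeleton of an l-graph
   [O], the colors being embedded by [inj] (a partial inverse of which is [proj]).
   If every edge of [O] with a color of [G] that starts or ends in the image of
   [G] is itself in the image ([jE_lift]), then the elements of [O] represented
   by the paths of [G] form a k-graph, [path_kgraph]. *)
Section PathSubgraph.
Variables (k l : nat) (O : kgraph l) (G : cdigraph k).
Variables (jV : gvert G -> vertex O) (jE : gedge G -> edge O).

Definition represented (x : O) : Prop :=
  exists v p u, is_path v p u /\ x = composite (map jE p) (jV u).

Variables (inj : 'rV[nat]_k -> 'rV[nat]_l) (proj : 'rV[nat]_l -> 'rV[nat]_k).
Variable iota : 'I_k -> 'I_l.
Hypothesis jV_inj : injective jV.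
Hypothesis jE_src : forall e, ksrc (val (jE e)) = val (jV (gsrc e)).
Hypothesis jE_rng : forall e, krng (val (jE e)) = val (jV (grng e)).
Hypothesis jE_deg : forall e, kdeg (val (jE e)) = inj (gcol e).
Hypothesis injD : forall m n, inj (m + n) = inj m + inj n.
Hypothesis inj0 : inj 0 = 0.
Hypothesis inj_delta : forall i, inj (delta_mx 0 i) = delta_mx 0 (iota i).
Hypothesis injK : cancel inj proj.
Hypothesis projD : forall m n, proj (m + n) = proj m + proj n.
Hypothesis jE_lift : forall (x : edge O) i v,
  kdeg (val x) = inj (delta_mx 0 i) ->
  ksrc (val x) = val (jV v) \/ krng (val x) = val (jV v) ->
  exists e, x = jE e.

Lemma path_rng v p u : is_path v p u ->
  krng (composite (map jE p) (jV u)) = val (jV v).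
Proof.
elim: p v => [|e p IH] v /=; first by move=> ->; rewrite vertex_rng.
case=> <- /IH {}IH; rewrite krng_comp ?jE_rng// jE_src IH //.
Qed.

Lemma path_src v p u : is_path v p u ->
  ksrc (composite (map jE p) (jV u)) = val (jV u).
Proof.
elim: p v => [|e p IH] v /=; first by move=> _; rewrite vertex_src.
case=> _ pp; rewrite ksrc_comp ?(IH _ pp)// jE_src (path_rng pp) //.
Qed.

Lemma path_deg v p u : is_path v p u ->
  exists m, kdeg (composite (map jE p) (jV u)) = inj m.
Proof.
elim: p v => [|e p IH] v /=.
  by exists 0; rewrite inj0; case: (jV u) => x /= /eqP.
case=> _ pp; have [m mE] := IH _ pp; exists (gcol e + m).
by rewrite kdeg_comp ?jE_src ?(path_rng pp)// mE jE_deg injD.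
Qed.

Lemma represented_deg x : represented x -> kdeg x = inj (proj (kdeg x)).
Proof. by case=> v [p [u [pp ->]]]; have [m ->] := path_deg pp; rewrite injK. Qed.

Lemma represented_src x : represented x -> exists u, ksrc x = val (jV u).
Proof. by case=> v [p [u [pp ->]]]; exists u; rewrite (path_src pp). Qed.

Lemma represented_rng x : represented x -> exists u, krng x = val (jV u).
Proof. by case=> v [p [u [pp ->]]]; exists v; rewrite (path_rng pp). Qed.

Lemma represented_vertex u : represented (val (jV u)).
Proof. by exists u, [::], u. Qed.

Lemma rowN_split (m : 'rV[nat]_k) : m != 0 -> exists i m', m = delta_mx 0 i + m'.
Proof.
move=> m0; have [i mi] : exists i, m 0 i != 0%N.
  apply/existsP; apply: contraT; rewrite negb_exists => /forallP H.
  case/negP: m0; apply/eqP/matrixP => a i; rewrite !mxE ord1.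
  by apply/eqP; have := H i; rewrite negbK.
exists i, (\row_j (m 0%R j - (j == i))%N); apply/matrixP => a j; rewrite !mxE ord1.
rewrite eqxx /=; have [->|_] /= := eqVneq j i; last by rewrite subn0.
by rewrite [RHS]subnKC// lt0n.
Qed.

Definition rowN_size (m : 'rV[nat]_k) : nat := (\sum_i m 0%R i)%N.

Lemma rowN_sizeS i m : rowN_size (delta_mx 0 i + m) = (rowN_size m).+1.
Proof.
rewrite /rowN_size (bigD1 i)//= [in RHS](bigD1 i)//= !mxE !eqxx /=.
rewrite [(_ + m 0 i)%R](_ : _ = (m 0 i).+1)// addSn; congr (_ + _).+1.
by apply: eq_bigr => j /negPf ji; rewrite !mxE ji andbF.
Qed.

Lemma deg_edge x i : kdeg x = inj (delta_mx 0 i) -> is_edge (x : O).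
Proof. by move=> xi; apply/existsP; exists (iota i); rewrite xi inj_delta. Qed.


Lemma path_by_rng N x m v : rowN_size m = N ->
  kdeg x = inj m -> krng x = val (jV v) ->
  exists p u, is_path v p u /\ x = composite (map jE p) (jV u).
Proof.
elim: N x m v => [|N IH] x m v mN xm xv.
  have [m0|/rowN_split[i [m' mE]]] := eqVneq m 0; last by move: mN; rewrite mE rowN_sizeS.
  exists [::], v; split=> //=; rewrite -xv; have [-> //] : krng x = x /\ ksrc x = x.
  by apply: deg0_id; rewrite xm m0 inj0.
have [m0|/rowN_split[i [m' mE]]] := eqVneq m 0.
  by move: mN; rewrite m0 /rowN_size big1 // => j _; rewrite mxE.
have xD : kdeg x = inj (delta_mx 0 i) + inj m' by rewrite xm mE injD.
have [[e y] [/= [ey exE ed yd] _]] := kfactor xD.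
have [e' e'E] : exists e', Sub e (deg_edge ed) = jE e'.
  by apply: (jE_lift (x := Sub e (deg_edge ed)) (v := v) ed) => /=; right; rewrite -xv -exE krng_comp.
have eE : e = val (jE e') by rewrite -e'E.
have [||p [u [pp yE]]] := IH y m' (gsrc e') _ yd.
- by move: mN; rewrite mE rowN_sizeS => -[].
- by rewrite -ey eE jE_src.
exists (e' :: p), u; split=> /=; last by rewrite -yE -eE.
split=> //; apply: jV_inj; apply: val_inj.
by rewrite -jE_rng -eE -xv -exE krng_comp.
Qed.

Lemma represented_by_rng x m v :
  kdeg x = inj m -> krng x = val (jV v) -> represented x.
Proof. by move=> xm xv; have [p [u ?]] := path_by_rng erefl xm xv; exists v, p, u. Qed.

Lemma path_by_src N x m u : rowN_size m = N ->
  kdeg x = inj m -> ksrc x = val (jV u) ->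
  exists v p, is_path v p u /\ x = composite (map jE p) (jV u).
Proof.
elim: N x m => [|N IH] x m mN xm xu.
  have [m0|/rowN_split[i [m' mE]]] := eqVneq m 0; last by move: mN; rewrite mE rowN_sizeS.
  exists u, [::]; split=> //=; rewrite -xu; have [_ -> //] : krng x = x /\ ksrc x = x.
  by apply: deg0_id; rewrite xm m0 inj0.
have [m0|/rowN_split[i [m' mE]]] := eqVneq m 0.
  by move: mN; rewrite m0 /rowN_size big1 // => j _; rewrite mxE.
have xD : kdeg x = inj (delta_mx 0 i) + inj m' by rewrite xm mE injD.
have [[e y] [/= [ey exE ed yd] _]] := kfactor xD.
have [||v [p [pp yE]]] := IH y m' _ yd.
- by move: mN; rewrite mE rowN_sizeS => -[].
- by rewrite -xu -exE ksrc_comp.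
have yr : krng y = val (jV v) by rewrite yE (path_rng pp).
have [e' e'E] : exists e', Sub e (deg_edge ed) = jE e'.
  by apply: (jE_lift (x := Sub e (deg_edge ed)) (v := v) ed) => /=; left; rewrite ey.
have eE : e = val (jE e') by rewrite -e'E.
exists (grng e'), (e' :: p); split=> /=; last by rewrite -yE -eE.
split=> //; suff -> : gsrc e' = v by [].
by apply: jV_inj; apply: val_inj; rewrite -jE_src -eE -yr.
Qed.

Lemma represented_by_src x m u :
  kdeg x = inj m -> ksrc x = val (jV u) -> represented x.
Proof. by move=> xm xu; have [v [p ?]] := path_by_src erefl xm xu; exists v, p, u. Qed.

Definition path_sub := {x : O | `[< represented x >]}.

Let repP (x : path_sub) : represented (val x).
Proof. by case: x => x /= /asboolP. Qed.

Let sub_src_subproof (x : path_sub) : `[< represented (ksrc (val x)) >].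
Proof. by apply/asboolP; have [u ->] := represented_src (repP x); exact: represented_vertex. Qed.
Let sub_rng_subproof (x : path_sub) : `[< represented (krng (val x)) >].
Proof. by apply/asboolP; have [u ->] := represented_rng (repP x); exact: represented_vertex. Qed.

Let sub_src (x : path_sub) : path_sub :=
  exist _ (ksrc (val x)) (sub_src_subproof x).
Let sub_rng (x : path_sub) : path_sub :=
  exist _ (krng (val x)) (sub_rng_subproof x).
Let sub_comp (x y : path_sub) : path_sub := insubd x (kcomp (val x) (val y)).
Let sub_deg (x : path_sub) : 'rV[nat]_k := proj (kdeg (val x)).

Let sub_compE (x y : path_sub) :
  sub_src x = sub_rng y -> val (sub_comp x y) = kcomp (val x) (val y).
Proof.
move=> /(congr1 val) /= xy; rewrite /sub_comp val_insubd ifT //; apply/asboolP.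
have [u yu] := represented_src (repP y).
apply: (@represented_by_src _ (proj (kdeg (val x)) + proj (kdeg (val y))) u).
  by rewrite kdeg_comp // injD -!represented_deg//; exact: repP.
by rewrite ksrc_comp.
Qed.

Let sub_srcE x : val (sub_src x) = ksrc (val x). Proof. by []. Qed.
Let sub_rngE x : val (sub_rng x) = krng (val x). Proof. by []. Qed.

Definition path_kgraph : kgraph k.
Proof.
refine (@KGraph k path_sub sub_src sub_rng sub_comp sub_deg
          _ _ _ _ _ _ _ _ _ _ _).
- by move=> x; apply: val_inj; rewrite /= ksrc_src.
- by move=> x; apply: val_inj; rewrite /= krng_src.
- by move=> x; apply: val_inj; rewrite /= ksrc_rng.
- by move=> x; apply: val_inj; rewrite /= krng_rng.
- move=> x y xy; apply: val_inj; rewrite sub_srcE sub_compE // ksrc_comp //.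
  exact: (congr1 val xy).
- move=> x y xy; apply: val_inj; rewrite sub_rngE sub_compE // krng_comp //.
  exact: (congr1 val xy).
- move=> x; apply: val_inj; rewrite sub_compE /= ?kcomp_idl //.
  by apply: val_inj; rewrite /= ksrc_rng.
- move=> x; apply: val_inj; rewrite sub_compE /= ?kcomp_idr //.
  by apply: val_inj; rewrite /= krng_src.
- move=> x y z xy yz; have vxy := congr1 val xy; have vyz := congr1 val yz.
  have s1 : sub_src x = sub_rng (sub_comp y z).
    by apply: val_inj; rewrite sub_rngE sub_compE // krng_comp.
  have s2 : sub_src (sub_comp x y) = sub_rng z.
    by apply: val_inj; rewrite sub_srcE sub_compE // ksrc_comp.
  by apply: val_inj; rewrite !sub_compE // kcompA.
- move=> x y xy; rewrite /sub_deg sub_compE // kdeg_comp ?projD //.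
  exact: (congr1 val xy).
move=> x m n xmn.
have xD : kdeg (val x) = inj m + inj n.
  by rewrite (represented_deg (repP x)) -injD; congr inj.
have [[y z] [/= [yz yzx ym zn] yzU]] := kfactor xD.
have [u xu] := represented_src (repP x).
have [v xv] := represented_rng (repP x).
have ry : `[< represented y >].
  by apply/asboolP/(represented_by_rng (v := v) ym); rewrite -xv -[val x]yzx krng_comp.
have rz : `[< represented z >].
  by apply/asboolP/(represented_by_src (u := u) zn); rewrite -xu -[val x]yzx ksrc_comp.
have eyz : sub_src (exist _ y ry) = sub_rng (exist _ z rz) by apply: val_inj.
exists (exist _ y ry, exist _ z rz); split=> /=.
  split=> //; first by apply: val_inj; rewrite sub_compE.
  - by rewrite /sub_deg /= ym injK.
  - by rewrite /sub_deg /= zn injK.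
move=> [y' z'] /= [yz' yzx' ym' zn'].
have [yE zE] : (y, z) = (val y', val z').
  apply: yzU; split=> /=.
  - exact: (congr1 val yz').
  - by rewrite -sub_compE // yzx'.
  - by rewrite (represented_deg (repP y')) -ym'.
  - by rewrite (represented_deg (repP z')) -zn'.
by congr pair; apply: val_inj.
Defined.

End PathSubgraph.

Section Product.
Variables (k1 k2 : nat) (L : kgraph k1) (M : kgraph k2).

Let pdeg (x : L * M) : 'rV[nat]_(k1 + k2) := row_mx (kdeg x.1) (kdeg x.2).

Let row_mxD (k l : nat) (a c : 'rV[nat]_k) (b d : 'rV[nat]_l) :
  row_mx a b + row_mx c d = row_mx (a + c) (b + d).
Proof.
by apply/matrixP => i j; rewrite !mxE; case: splitP => j' _; rewrite !mxE.
Qed.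

Definition prod_kgraph : kgraph (k1 + k2).
Proof.
refine (@KGraph (k1 + k2) (L * M)%type
  (fun x => (ksrc x.1, ksrc x.2)) (fun x => (krng x.1, krng x.2))
  (fun x y => (kcomp x.1 y.1, kcomp x.2 y.2)) pdeg _ _ _ _ _ _ _ _ _ _ _).
- by move=> [x y]; rewrite /= !ksrc_src.
- by move=> [x y]; rewrite /= !krng_src.
- by move=> [x y]; rewrite /= !ksrc_rng.
- by move=> [x y]; rewrite /= !krng_rng.
- by move=> [x1 x2] [y1 y2] /= [? ?]; rewrite !ksrc_comp.
- by move=> [x1 x2] [y1 y2] /= [? ?]; rewrite !krng_comp.
- by move=> [x y]; rewrite /= !kcomp_idl.
- by move=> [x y]; rewrite /= !kcomp_idr.
- by move=> [x1 x2] [y1 y2] [z1 z2] /= [? ?] [? ?]; rewrite !kcompA.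
- by move=> [x1 x2] [y1 y2] /= [? ?]; rewrite /pdeg /= !kdeg_comp// row_mxD.
move=> [x1 x2] m n; rewrite /pdeg /= -[m]hsubmxK -[n]hsubmxK row_mxD.
move=> /eq_row_mx[d1 d2].
have [[y1 z1] [/= [s1 c1 m1 n1] u1]] := kfactor d1.
have [[y2 z2] [/= [s2 c2 m2 n2] u2]] := kfactor d2.
exists ((y1, y2), (z1, z2)); split=> /=.
  by rewrite s1 s2 c1 c2 m1 m2 n1 n2.
move=> [[y1' y2'] [z1' z2']] /= [[s1' s2'] [c1' c2']].
move=> /eq_row_mx[m1' m2'] /eq_row_mx[n1' n2'].
have [-> ->] : (y1, z1) = (y1', z1') by apply: u1.
by have [-> ->] : (y2, z2) = (y2', z2') by apply: u2.
Defined.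

Lemma prod_is_vertex (x : vertex L) (v : vertex M) :
  is_vertex ((val x, val v) : prod_kgraph).
Proof.
case: x v => [x /= /eqP x0] [v /= /eqP v0].
by rewrite /is_vertex /= /pdeg /= x0 v0 row_mx0.
Qed.

Lemma delta_lshift (i : 'I_k1) :
  row_mx (delta_mx 0 i) 0 = delta_mx 0 (lshift k2 i) :> 'rV[nat]_(k1 + k2).
Proof.
apply/matrixP => a j; rewrite !mxE ord1 /=; case: splitP => j' jj'; rewrite !mxE.
  by rewrite -!val_eqE /= jj'.
by rewrite -val_eqE /= jj' gtn_eqF// ltn_addr.
Qed.

Lemma delta_rshift (j : 'I_k2) :
  row_mx 0 (delta_mx 0 j) = delta_mx 0 (rshift k1 j) :> 'rV[nat]_(k1 + k2).
Proof.
apply/matrixP => a i; rewrite !mxE ord1 /=; case: splitP => i' ii'; rewrite !mxE.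
  by rewrite -val_eqE /= ii' ltn_eqF// ltn_addr.
by rewrite -!val_eqE /= ii' eqn_add2l.
Qed.

Lemma prod_is_edge1 (e : edge L) (v : vertex M) :
  is_edge ((val e, val v) : prod_kgraph).
Proof.
case: e v => [e /= /existsP[i /eqP ei]] [v /= /eqP v0].
by apply/existsP; exists (lshift k2 i); rewrite /= /pdeg /= ei v0 delta_lshift.
Qed.

Lemma prod_is_edge2 (x : vertex L) (f : edge M) :
  is_edge ((val x, val f) : prod_kgraph).
Proof.
case: f x => [f /= /existsP[j /eqP fj]] [x /= /eqP x0].
by apply/existsP; exists (rshift k1 j); rewrite /= /pdeg /= fj x0 delta_rshift.
Qed.

Definition pvert (x : vertex L) (v : vertex M) : vertex prod_kgraph :=
  exist _ (val x, val v) (prod_is_vertex x v).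
Definition pedge1 (e : edge L) (v : vertex M) : edge prod_kgraph :=
  exist _ (val e, val v) (prod_is_edge1 e v).
Definition pedge2 (x : vertex L) (f : edge M) : edge prod_kgraph :=
  exist _ (val x, val f) (prod_is_edge2 x f).

End Product.

Section QuasiProduct.
Variables (k1 k2 : nat) (L : kgraph k1) (M : kgraph k2) (O : kgraph (k1 + k2)).
Variable Phi : cdigraph_iso (skeleton (prod_kgraph L M)) (skeleton O).

Definition qvert (x : vertex L) (v : vertex M) : vertex O := isoV Phi (pvert x v).
Definition qedge1 (e : edge L) (v : vertex M) : edge O := isoE Phi (pedge1 e v).
Definition qedge2 (x : vertex L) (f : edge M) : edge O := isoE Phi (pedge2 x f).

Lemma qvert_inj x v x' v' : qvert x v = qvert x' v' -> x = x' /\ v = v'.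
Proof.
move=> /(bij_inj (isoV_bij Phi)) /(congr1 val) /= [? ?].
by split; apply: val_inj.
Qed.

Lemma qvertP (y : vertex O) : exists x v, y = qvert x v.
Proof.
have [g _ gK] := isoV_bij Phi.
case E : (g y) => [[x v] xv].
have /eq_row_mx[/eqP x0 /eqP v0] :
    row_mx (kdeg x) (kdeg v) = row_mx 0 0 by rewrite row_mx0; exact/eqP.
exists (exist _ x x0), (exist _ v v0); rewrite -[y]gK E.
by congr (isoV Phi _); apply: val_inj.
Qed.

Lemma isoE_src e : ksrc (val (isoE Phi e)) = val (isoV Phi (gsrc (c := skeleton _) e)).
Proof. by rewrite -iso_src. Qed.

Lemma isoE_rng e : krng (val (isoE Phi e)) = val (isoV Phi (grng (c := skeleton _) e)).
Proof. by rewrite -iso_rng. Qed.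

Lemma qedge1_src e v :
  ksrc (val (qedge1 e v)) = val (qvert (gsrc (c := skeleton L) e) v).
Proof.
rewrite isoE_src; congr (val (isoV Phi _)); apply: val_inj => /=.
by rewrite vertex_src.
Qed.

Lemma qedge1_rng e v :
  krng (val (qedge1 e v)) = val (qvert (grng (c := skeleton L) e) v).
Proof.
rewrite isoE_rng; congr (val (isoV Phi _)); apply: val_inj => /=.
by rewrite vertex_rng.
Qed.

Lemma qedge2_src x f :
  ksrc (val (qedge2 x f)) = val (qvert x (gsrc (c := skeleton M) f)).
Proof.
rewrite isoE_src; congr (val (isoV Phi _)); apply: val_inj => /=.
by rewrite vertex_src.
Qed.

Lemma qedge2_rng x f :
  krng (val (qedge2 x f)) = val (qvert x (grng (c := skeleton M) f)).
Proof.
rewrite isoE_rng; congr (val (isoV Phi _)); apply: val_inj => /=.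
by rewrite vertex_rng.
Qed.

Definition inj1 (m : 'rV[nat]_k1) : 'rV[nat]_(k1 + k2) := row_mx m 0.
Definition inj2 (m : 'rV[nat]_k2) : 'rV[nat]_(k1 + k2) := row_mx 0 m.

Lemma qedge1_deg e v : kdeg (val (qedge1 e v)) = inj1 (kdeg (val e)).
Proof.
have /= -> := iso_col Phi (pedge1 e v).
by rewrite /inj1; case: v => v /= /eqP ->.
Qed.

Lemma qedge2_deg x f : kdeg (val (qedge2 x f)) = inj2 (kdeg (val f)).
Proof.
have /= -> := iso_col Phi (pedge2 x f).
by rewrite /inj2; case: x => x /= /eqP ->.
Qed.

Lemma qedge1P (y : edge O) i : kdeg (val y) = inj1 (delta_mx 0 i) ->
  exists e v, y = qedge1 e v.
Proof.
have [g _ gK] := isoE_bij Phi.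
have := iso_col Phi (g y); rewrite gK /= => ->.
case E : (g y) => [[x v] xv] /= /eq_row_mx[xi v0].
have xe : is_edge x by apply/existsP; exists i; rewrite xi.
have ve : is_vertex v by apply/eqP.
exists (exist _ x xe), (exist _ v ve); rewrite -[y]gK E.
by congr (isoE Phi _); apply: val_inj.
Qed.

Lemma qedge2P (y : edge O) j : kdeg (val y) = inj2 (delta_mx 0 j) ->
  exists x f, y = qedge2 x f.
Proof.
have [g _ gK] := isoE_bij Phi.
have := iso_col Phi (g y); rewrite gK /= => ->.
case E : (g y) => [[x v] xv] /= /eq_row_mx[x0 vj].
have xe : is_vertex x by apply/eqP.
have ve : is_edge v by apply/existsP; exists j; rewrite vj.
exists (exist _ x xe), (exist _ v ve); rewrite -[y]gK E.
by congr (isoE Phi _); apply: val_inj.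
Qed.

Lemma qvert_inj1 v : injective (qvert^~ v).
Proof. by move=> x x' /qvert_inj[]. Qed.

Lemma qvert_inj2 x : injective (qvert x).
Proof. by move=> v v' /qvert_inj[]. Qed.

Lemma inj1D m n : inj1 (m + n) = inj1 m + inj1 n.
Proof. by apply/matrixP => i j; rewrite !mxE; case: splitP => j' _; rewrite !mxE. Qed.

Lemma inj2D m n : inj2 (m + n) = inj2 m + inj2 n.
Proof. by apply/matrixP => i j; rewrite !mxE; case: splitP => j' _; rewrite !mxE. Qed.

Lemma inj1_0 : inj1 0 = 0. Proof. exact: row_mx0. Qed.
Lemma inj2_0 : inj2 0 = 0. Proof. exact: row_mx0. Qed.

Lemma inj1K : cancel inj1 lsubmx. Proof. by move=> m; rewrite /inj1 row_mxKl. Qed.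
Lemma inj2K : cancel inj2 rsubmx. Proof. by move=> m; rewrite /inj2 row_mxKr. Qed.

Lemma lsubmxND (m n : 'rV[nat]_(k1 + k2)) :
  lsubmx (m + n) = lsubmx m + lsubmx n.
Proof. by apply/matrixP => i j; rewrite !mxE. Qed.

Lemma rsubmxND (m n : 'rV[nat]_(k1 + k2)) :
  rsubmx (m + n) = rsubmx m + rsubmx n.
Proof. by apply/matrixP => i j; rewrite !mxE. Qed.

Lemma qedge1_lift v (y : edge O) i x : kdeg (val y) = inj1 (delta_mx 0 i) ->
  ksrc (val y) = val (qvert x v) \/ krng (val y) = val (qvert x v) ->
  exists e, y = qedge1 e v.
Proof.
move=> /qedge1P[e [v' ->]]; rewrite qedge1_src qedge1_rng.
by case=> /val_inj/qvert_inj[_ <-]; exists e.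
Qed.

Lemma qedge2_lift x (y : edge O) j v : kdeg (val y) = inj2 (delta_mx 0 j) ->
  ksrc (val y) = val (qvert x v) \/ krng (val y) = val (qvert x v) ->
  exists f, y = qedge2 x f.
Proof.
move=> /qedge2P[x' [f ->]]; rewrite qedge2_src qedge2_rng.
by case=> /val_inj/qvert_inj[<- _]; exists f.
Qed.

(* [slice1 v] is Omega_1^v, identified with Omega_1^v x {v}: its elements are the
   elements of [O] represented by a path [(p, v)] with [p] in G(L)^*.  Likewise
   [slice2 x] is Omega_2^x. *)
Definition slice1 (v : vertex M) : kgraph k1 :=
  @path_kgraph k1 (k1 + k2) O (skeleton L) (qvert^~ v) (qedge1^~ v)
    inj1 lsubmx (lshift k2) (@qvert_inj1 v) (qedge1_src^~ v) (qedge1_rng^~ v)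
    (qedge1_deg^~ v) inj1D inj1_0 (@delta_lshift k1 k2) inj1K lsubmxND
    (@qedge1_lift v).

Definition slice2 (x : vertex L) : kgraph k2 :=
  @path_kgraph k2 (k1 + k2) O (skeleton M) (qvert x) (qedge2 x)
    inj2 rsubmx (@rshift k1 k2) (@qvert_inj2 x) (qedge2_src x) (qedge2_rng x)
    (qedge2_deg x) inj2D inj2_0 (@delta_rshift k1 k2) inj2K rsubmxND
    (@qedge2_lift x).

(* The first two clauses alone do not force a slice to be isomorphic to a
   quasi-factor: [psi1] is only controlled through the projection of degrees to
   N^k1.  The last two clauses make explicit what they are meant to guarantee. *)
Definition quasi_product : Prop :=
  [/\ (exists psi1 : L -> O, [/\ is_functor psi1, injective psi1 &
         forall x, kdeg x = lsubmx (kdeg (psi1 x))]),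
      (exists psi2 : M -> O, [/\ is_functor psi2, injective psi2 &
         forall y, kdeg y = rsubmx (kdeg (psi2 y))]),
      (exists v (theta : slice1 v -> L), is_kgraph_iso theta) &
      (exists x (theta : slice2 x -> M), is_kgraph_iso theta)].

(* The element (x, [q]) of [O], where [q] is a path with source [w]. *)
Definition path2 (x : vertex L) (q : seq (edge M)) (w : vertex M) : O :=
  composite (map (qedge2 x) q) (qvert x w).

(* ([p], r(q)) (s(p), [q]) = beta alpha with beta in Omega_2 and alpha in
   Omega_1^{s(q)} x {s(q)}, where [lambda] is ([p], r(q)), [v] is r(q), [w] is s(q)
   and [x] is s(p).  The path q_<|(p) is the representative of [alpha] with the
   color order of p, so that its class is [alpha] itself. *)
Definition hat_spec (v : vertex M) (q : seq (edge M)) (w : vertex M)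
    (lambda : slice1 v) (alpha : slice1 w) : Prop :=
  exists (x : vertex L) (beta : O),
    [/\ ksrc (val lambda) = val (qvert x v),
        exists m, kdeg beta = row_mx 0 m,
        ksrc beta = krng (val alpha) &
        kcomp (val lambda) (path2 x q w) = kcomp beta (val alpha)].

Lemma hat_exists v q w (qP : is_path (G := skeleton M) v q w)
  (lambda : slice1 v) : exists alpha, hat_spec q lambda (alpha : slice1 w).
Proof.
have rl : represented (G := skeleton L) (qvert^~ v) (qedge1^~ v) (val lambda).
  by case: lambda => l /= /asboolP.
have dl := represented_deg (G := skeleton L) (qedge1_src^~ v) (qedge1_rng^~ v)
  (qedge1_deg^~ v) inj1D inj1_0 inj1K rl.
have [x xE] := represented_src (G := skeleton L) (qedge1_src^~ v) (qedge1_rng^~ v) rl.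
have rq := path_rng (G := skeleton M) (qedge2_src x) (qedge2_rng x) qP.
have sq := path_src (G := skeleton M) (qedge2_src x) (qedge2_rng x) qP.
have [m dq] := path_deg (G := skeleton M) (qedge2_src x) (qedge2_rng x)
  (qedge2_deg x) inj2D inj2_0 qP.
have d : kdeg (kcomp (val lambda) (path2 x q w)) =
    inj2 m + inj1 (lsubmx (kdeg (val lambda))).
  by rewrite kdeg_comp ?rq// dq dl inj1K [RHS]addrC.
have [[beta alpha] [/= [s c db da] _]] := kfactor d.
have ra : represented (G := skeleton L) (qvert^~ w) (qedge1^~ w) alpha.
  apply: (represented_by_src (G := skeleton L) (@qvert_inj1 w) (qedge1_src^~ w) (qedge1_rng^~ w)
    inj1D inj1_0 (@delta_lshift k1 k2) (@qedge1_lift w) da (u := x)).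
  by rewrite -sq -/(path2 x q w) -(ksrc_comp s) c ksrc_comp ?rq.
exists (exist _ alpha (asboolT ra)), x, beta; split=> //.
by exists m.
Qed.

Definition hat v q w (qP : is_path (G := skeleton M) v q w) (lambda : slice1 v) :
    slice1 w :=
  projT1 (cid (hat_exists qP lambda)).

End QuasiProduct.
Arguments hat {k1 k2 L M O} Phi {v q w} qP lambda.

Definition cycle_cdigraph (n k : nat) : cdigraph k :=
  @CDigraph k 'I_n ('I_n * 'I_k)%type
    (fun e => e.1) (fun e => ordS e.1) (fun e => delta_mx 0 e.2).

(* A labelling [C] of the one-skeleton of [M] by [cycle_cdigraph n k] says that
   [M] is C_{n,k}, with vertices w_i = [cyc_vert i] and edges
   f_{i,j} = [cyc_edge i j] (source w_i, range w_{i+1}, color e_j). *)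
Section Cycle.
Variables (n k : nat) (M : kgraph k).
Variable C : cdigraph_iso (cycle_cdigraph n k) (skeleton M).

Definition cyc_vert (i : 'I_n) : vertex M := isoV C i.
Definition cyc_edge (i : 'I_n) (j : 'I_k) : edge M := isoE C (i, j).

Lemma cyc_path i j :
  is_path (G := skeleton M) (cyc_vert (ordS i)) [:: cyc_edge i j] (cyc_vert i).
Proof. split; last exact: (iso_src C (i, j)).
exact: (iso_rng C (i, j)). Qed.

End Cycle.

Section StarHom.
Variables (R : realType) (A B : cstar_algebra R).

Definition star_hom (f : A -> B) : Prop :=
  [/\ forall (z : R[i]) a b, f (z *: a + b) = z *: f a + f b,
      forall a b, f (amul a b) = amul (f a) (f b) &
      forall a, f (astar a) = astar (f a)].

Definition star_iso (f : A -> B) : Prop := star_hom f /\ bijective f.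

Definition star_isomorphic : Prop := exists f, star_iso f.

End StarHom.

Definition star_subalgebra (R : realType) (A : cstar_algebra R) (Y : set A) :=
  [/\ Y 0, forall (z : R[i]) a b, Y a -> Y b -> Y (z *: a + b),
      forall a b, Y a -> Y b -> Y (amul a b) &
      forall a, Y a -> Y (astar a)].

Definition generates (R : realType) (A : cstar_algebra R) (X : set A) : Prop :=
  forall Y : set A, star_subalgebra Y -> closed Y -> X `<=` Y -> Y = setT.

Section GraphAlgebra.
Variables (R : realType) (k : nat) (L : kgraph k).

Definition is_generator (x : L) : bool := is_vertex x || is_edge x.

(* The generators S_v, S_e are given by one function [S] on [L], of which only
   the values at vertices and edges are relevant. *)
Record ck_family (A : cstar_algebra R) (S : L -> A) : Prop := CKFamily {
  ck_pisometry : forall x, is_generator x ->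
    amul (amul (S x) (astar (S x))) (S x) = S x;
  ck1_proj : forall v, is_vertex v ->
    astar (S v) = S v /\ amul (S v) (S v) = S v;
  ck1_orth : forall v w, is_vertex v -> is_vertex w -> v <> w ->
    amul (S v) (S w) = 0;
  ck2 : forall e f f' e', is_edge e -> is_edge f -> is_edge f' -> is_edge e' ->
    ksrc e = krng f -> ksrc f' = krng e' -> kcomp e f = kcomp f' e' ->
    amul (S e) (S f) = amul (S f') (S e');
  ck3 : forall e, is_edge e -> amul (astar (S e)) (S e) = S (ksrc e);
  ck4 : forall v i, is_vertex v ->
    S v = \sum_(e \in out_set v (delta_mx 0 i)) amul (S e) (astar (S e))
}.

Definition is_graph_algebra (A : cstar_algebra R) (S : L -> A) : Prop :=
  [/\ ck_family S, generates (S @` [set x | is_generator x]) &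
      forall (B : cstar_algebra R) (T : L -> B), ck_family T ->
        exists! f : A -> B, star_hom f /\
          forall x, is_generator x -> f (S x) = T x].

End GraphAlgebra.

Definition induced_by_kgraph_iso (R : realType) (k : nat) (L M : kgraph k)
    (A B : cstar_algebra R) (S : L -> A) (T : M -> B)
    (theta : L -> M) (f : A -> B) : Prop :=
  [/\ is_kgraph_iso theta, star_iso f &
      forall x, is_generator x -> f (S x) = T (theta x)].

(* The (full) crossed product of [D] by the discrete group [G] is the enveloping
   C*-algebra of the convolution *-algebra C_c(G, D): [T g a] is the image of the
   finitely supported function a delta_g under a *-homomorphism C_c(G, D) -> B.
   Neither [D] nor [B] is assumed to be unital. *)
Section CrossedProduct.
Variables (R : realType) (G : zmodType) (D : cstar_algebra R).
Variable alpha : G -> D -> D.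

Definition is_action : Prop :=
  [/\ forall g, star_iso (alpha g), forall a, alpha 0 a = a &
      forall g h a, alpha (g + h) a = alpha g (alpha h a)].

Record convolution_family (B : cstar_algebra R) (T : G -> D -> B) : Prop :=
  ConvolutionFamily {
  conv_linear : forall g (z : R[i]) a b, T g (z *: a + b) = z *: T g a + T g b;
  conv_mul : forall g h a b, amul (T g a) (T h b) = T (g + h) (amul a (alpha g b));
  conv_star : forall g a, astar (T g a) = T (- g) (alpha (- g) (astar a))
}.

Definition is_crossed_product (P : cstar_algebra R) (iota : G -> D -> P) : Prop :=
  [/\ convolution_family iota,
      generates [set b | exists g a, b = iota g a] &
      forall (B : cstar_algebra R) (T : G -> D -> B), convolution_family T ->
        exists! f : P -> B, star_hom f /\ forall g a, f (iota g a) = T g a].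

End CrossedProduct.

(* The inverse of a bijective [f]. *)
Definition inv_fun (R : realType) (A B : cstar_algebra R) (f : A -> B) (b : B) : A :=
  xget 0 [set a | f a = b].

Definition iterz (R : realType) (D : cstar_algebra R) (f : D -> D) (m : int) :
    D -> D :=
  match m with
  | Posz p => iter p f
  | Negz p => iter p.+1 (inv_fun f)
  end.

Section Rho.
Variables (R : realType) (n k : nat) (A : 'I_n -> cstar_algebra R).
Variable rho : forall (i : 'I_n) (j : 'I_k), A (ordS i) -> A i.

Definition rho_gen (j : 'I_k) : dsum A -> dsum A :=
  fun a i => rho j (a (ordS i)).

(* rho_x = rho_1^{x_1} o ... o rho_k^{x_k}. *)
Definition rho_action (x : 'rV[int]_k) : dsum A -> dsum A :=
  \big[(fun f g => f \o g)/id]_(j < k) iterz (rho_gen j) (x 0 j).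

End Rho.

Definition dsum_map (R : realType) (n : nat) (A B : 'I_n -> cstar_algebra R)
    (f : forall i, A i -> B i) : dsum A -> dsum B :=
  fun a i => f i (a i).

(* The action [alpha] transported along a bijective [f]. *)
Definition transport (R : realType) (G : Type) (D E : cstar_algebra R)
    (f : D -> E) (alpha : G -> D -> D) : G -> E -> E :=
  fun g b => f (alpha g (inv_fun f b)).

(* Main.v *)
(* The crossed product and C*(Omega) are compared through their universal
   properties.  Write U_j for the sum of the S_f over all edges f of colour
   e_{k1+j}.  Every vertex of Omega receives and emits exactly one such edge, and
   there are finitely many vertices, so the U_j are commuting unitaries, and the
   commutation relations of Omega say that U_j^* implements rho_j on the direct
   sum of the C*(Omega_1^{w_i}); this is a covariant representation in C*(Omega).
   Conversely, S_f |-> iota(-e_j)(S_{r(f)}) together with the canonical copy of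
   the slices is a Cuntz-Krieger family in the crossed product.  The two induced
   maps are inverse to each other on generators. *)
Require Import Defs.
From HB Require Import structures.
From mathcomp Require Import all_boot all_order all_algebra complex.
From mathcomp Require Import all_classical all_reals all_analysis.
From mathcomp Require Import ring.
Require Import Defs.
Set Implicit Arguments.
Unset Strict Implicit.
Unset Printing Implicit Defensive.
Import Order.TTheory GRing.Theory Num.Theory.
Import numFieldNormedType.Exports.
Local Open Scope classical_set_scope.
Local Open Scope ring_scope.
Local Open Scope complex_scope.

(** * Projections in C*-algebras *)

(** The relation S_{r(e)} S_e = S_e is not among CK1-CK4. It has to be extracted from CK4, where it
    says that if a sum of projections is itself a projection, then every summand lies below the sum.
    Instead of positivity, a norm argument from the C*-identity is used, and it carries most of the
    analysis. Nearly all that follows is algebra: maps are compared on generators through the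
    uniqueness clauses of the universal properties. The signs come from the direction of [hat]: it
    carries the slice at r(f) to the slice at s(f), whereas S_f leads from the projection at s(f) to
    the one at r(f). Hence U_j^* phi(a) U_j = phi(rho_j(a)), so the unitary attached to e_j is
    U_j^*, and an edge f has to go to degree -e_j. Finitely many vertices give identities on both
    sides. These allow U_j to be an element of the graph algebra and the canonical unitaries to be
    elements of the crossed product. *)

Section CstarArithmetic.
Variables (R : realType) (A : cstar_algebra R).
Implicit Types (a b c : A) (z : R[i]).

Lemma amul0l a : amul 0 a = 0.
Proof. by rewrite -[0 in LHS](scale0r (0 : A)) amulZl scale0r. Qed.

Lemma amul0r a : amul a 0 = 0.
Proof. by rewrite -[0 in LHS](scale0r (0 : A)) amulZr scale0r. Qed.

Lemma amulNl a b : amul (- a) b = - amul a b.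
Proof. by rewrite -scaleN1r amulZl scaleN1r. Qed.

Lemma amulNr a b : amul a (- b) = - amul a b.
Proof. by rewrite -scaleN1r amulZr scaleN1r. Qed.

Lemma amulBl a b c : amul (a - b) c = amul a c - amul b c.
Proof. by rewrite amulDl amulNl. Qed.

Lemma amulBr a b c : amul a (b - c) = amul a b - amul a c.
Proof. by rewrite amulDr amulNr. Qed.

Lemma amul_suml (I : Type) (r : seq I) (P : pred I) (F : I -> A) b :
  amul (\sum_(i <- r | P i) F i) b = \sum_(i <- r | P i) amul (F i) b.
Proof. by elim/big_rec2: _ => [|i x y _ <-]; rewrite ?amul0l ?amulDl. Qed.

Lemma amul_sumr (I : Type) (r : seq I) (P : pred I) (F : I -> A) b :
  amul b (\sum_(i <- r | P i) F i) = \sum_(i <- r | P i) amul b (F i).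
Proof. by elim/big_rec2: _ => [|i x y _ <-]; rewrite ?amul0r ?amulDr. Qed.

Lemma astar0 : astar (0 : A) = 0.
Proof. by rewrite -[0 in LHS](scale0r (0 : A)) astarZ raddf0 scale0r. Qed.

Lemma astarN a : astar (- a) = - astar a.
Proof. by rewrite -scaleN1r astarZ rmorphN1 scaleN1r. Qed.

Lemma astarB a b : astar (a - b) = astar a - astar b.
Proof. by rewrite astarD astarN. Qed.

Lemma astar_sum (I : Type) (r : seq I) (P : pred I) (F : I -> A) :
  astar (\sum_(i <- r | P i) F i) = \sum_(i <- r | P i) astar (F i).
Proof. by elim/big_rec2: _ => [|i x y _ <-]; rewrite ?astar0 ?astarD. Qed.

Lemma cstar_eq0 a : amul (astar a) a = 0 -> a = 0.
Proof.
move=> /(congr1 Num.norm); rewrite norm_cstar normr0 => /eqP.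
by rewrite expf_eq0 /= normr_eq0 => /eqP.
Qed.

Definition is_proj a : Prop := astar a = a /\ amul a a = a.

(** In a unitization 1 - 2p is a self-adjoint unitary. The computation avoids the unit: b = a - 2pa
    satisfies b^*b = a^*a, and the C*-identity compares norms. *)
Lemma proj_reflection_norm p a : is_proj p -> `|a - 2 *: amul p a| = `|a|.
Proof.
move=> [ps pp]; apply/eqP; rewrite -(@eqrXn2 _ 2)// -!norm_cstar; apply/eqP; congr `|_|.
rewrite astarB astarZ astarM ps rmorph_nat amulBl !amulBr !amulZl !amulZr.
rewrite -!amulA [amul p (amul p a)]amulA pp scalerA opprB addrACA.
rewrite -[RHS]addr0; rewrite -addrA; congr (_ + _).
set t := amul _ _; rewrite addrCA !addrA.
rewrite -!scaleNr -!scalerDl (_ : _ + _ = 0) ?scale0r//; ring.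
Qed.

(** 1 - p is the average of the contractions 1 and 1 - 2p. *)
Lemma proj_compl_norm p a : is_proj p -> `|a - amul p a| <= `|a|.
Proof.
move=> pp; have -> : a - amul p a = 2^-1 *: (a + (a - 2 *: amul p a)).
  rewrite addrA -mulr2n -[a *+ 2]scaler_nat.
  rewrite -scalerBr scalerA mulVf ?scale1r// pnatr_eq0.
rewrite normrZ normfV ger0_norm// ler_pdivrMl ?ltr0n//.
by rewrite (le_trans (ler_normD _ _))// proj_reflection_norm// mulr_natl mulr2n.
Qed.

End CstarArithmetic.

(** * Coefficient estimates for vector-valued polynomials on the unit circle *)

Section UnitVertex.
Variables (R : realType) (V : normedModType R[i]).

Lemma sum_double (W : zmodType) (F : nat -> W) N :
  \sum_(m < N.*2) F m = \sum_(m < N) (F m.*2 + F m.*2.+1).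
Proof.
by elim: N => [|N IH]; rewrite ?big_ord0// doubleS 3!big_ord_recr /= IH addrA.
Qed.

Lemma sqrtC_unit (z : R[i]) : `|z| = 1 -> `|sqrtC z| = 1.
Proof.
move=> z1; apply/eqP; rewrite -(@eqrXn2 _ 2)// expr1n -normrX sqrtCK z1 //.
Qed.

(* Averaging over z and -z keeps the even coefficients and replaces z by z^2. *)
Lemma const_coef_bound r (w : nat -> V) (B : R[i]) :
  (forall z : R[i], `|z| = 1 -> `|\sum_(m < 2 ^ r) z ^+ m *: w m| <= B) ->
  `|w 0%N| <= B.
Proof.
elim: r w => [|r IH] w H.
  by have := H 1 (normr1 _); rewrite expn0 big_ord1 expr0 scale1r.
apply: (IH (fun m => w m.*2)) => z z1.
have s1 := sqrtC_unit z1; set s := sqrtC z in s1.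
have -> : \sum_(m < 2 ^ r) z ^+ m *: w m.*2 = 2^-1 *:
    (\sum_(m < 2 ^ r.+1) s ^+ m *: w m + \sum_(m < 2 ^ r.+1) (- s) ^+ m *: w m).
  rewrite expnS mul2n !(sum_double (fun m => _ ^+ m *: w m)) -big_split scaler_sumr.
  apply: eq_bigr => m _ /=; rewrite !exprS -!mul2n !exprM sqrrN sqrtCK mulNr scaleNr.
  rewrite addrACA subrr addr0 -mulr2n -[X in _ = _ *: X]scaler_nat scalerA mulVf ?scale1r//.
rewrite normrZ normfV ger0_norm// ler_pdivrMl ?ltr0n//.
rewrite (le_trans (ler_normD _ _))// mulr_natl mulr2n lerD// H// normrN.
by [].
Qed.

(** Half the difference of the values at s and -s keeps the odd coefficients. Dividing by s leaves a
    polynomial in s^2 with constant coefficient [w 1], so [const_coef_bound] applies: Cauchy's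
    estimate without an integral. *)
Lemma linear_coef_bound r (w : nat -> V) (B : R[i]) :
  (forall z : R[i], `|z| = 1 -> `|\sum_(m < 2 ^ r.+1) z ^+ m *: w m| <= B) ->
  `|w 1%N| <= B.
Proof.
move=> H; apply: (@const_coef_bound r (fun m => w m.*2.+1)) => z z1.
have s1 := sqrtC_unit z1; set s := sqrtC z in s1.
have -> : \sum_(m < 2 ^ r) z ^+ m *: w m.*2.+1 = (s^-1 / 2) *:
    (\sum_(m < 2 ^ r.+1) s ^+ m *: w m - \sum_(m < 2 ^ r.+1) (- s) ^+ m *: w m).
  rewrite expnS mul2n !(sum_double (fun m => _ ^+ m *: w m)) -sumrB scaler_sumr.
  apply: eq_bigr => m _ /=; rewrite !exprS -!mul2n !exprM sqrrN sqrtCK mulNr scaleNr.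
  rewrite opprD opprK addrACA subrr add0r -mulr2n -[X in _ = _ *: X]scaler_nat !scalerA.
  congr (_ *: _).
  have s0 : s != 0 by rewrite -normr_eq0 s1 oner_eq0.
  by field.
rewrite normrZ normrM !normfV s1 invr1 mul1r ger0_norm// ler_pdivrMl ?ltr0n//.
rewrite (le_trans (ler_normB _ _))// mulr_natl mulr2n lerD// H// normrN.
by [].
Qed.

Lemma norm_natmul_bounded_eq0 (w v : V) :
  (forall n : nat, `|n%:R *: w| <= `|v|) -> w = 0.
Proof.
move=> H; apply/eqP; rewrite -normr_le0; apply/negP => /negP w0.
have reE (x : V) : `|x| = (complex.Re `|x|)%:C.
  by have := ger0_Im (normr_ge0 x); case: `|x| => a b /= ->.
have wr : 0 < complex.Re `|w|.
  have : 0 < `|w| by rewrite normr_gt0; apply: contraNneq w0 => ->; rewrite normr0.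
  by rewrite reE ltcR.
have := H (Num.bound (complex.Re `|v| / complex.Re `|w|)).
set n := Num.bound _; rewrite normrZ normr_nat [`|w|]reE [`|v|]reE.
rewrite -(rmorph_nat (real_complex R)) -rmorphM lecR -ler_pdivlMr// leNgt.
suff -> : complex.Re `|v| / complex.Re `|w| < n%:R by [].
apply: archi_boundP; apply: divr_ge0 (ltW wr).
by have := normr_ge0 v; rewrite {1}reE lecR.
Qed.


(* The identity is a vertex of the unit ball: the linear coefficient of the
   contraction (1 + z Y)^n, which is n Y, has norm at most 1. *)
Lemma unit_vertex (H : V -> Prop) (Y : V -> V) :
  (forall (z : R[i]) u v, Y (z *: u + v) = z *: Y u + Y v) ->
  (forall (z : R[i]) u, H u -> H (u + z *: Y u)) ->
  (forall (z : R[i]) u, `|z| = 1 -> H u -> `|u + z *: Y u| <= `|u|) ->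
  forall v, H v -> Y v = 0.
Proof.
move=> YL HS YC v Hv.
have Y0 : Y 0 = 0.
  have := YL 1 0 0; rewrite !scale1r addr0 => /eqP.
  by rewrite -subr_eq0 opprD addrA subrr sub0r oppr_eq0 => /eqP.
have YD a b : Y (a + b) = Y a + Y b by rewrite -[a]scale1r YL !scale1r.
have YZ z a : Y (z *: a) = z *: Y a by rewrite -[_ *: a]addr0 YL Y0 addr0.
have Ysum N (F : nat -> V) : Y (\sum_(m < N) F m) = \sum_(m < N) Y (F m).
  by elim: N => [|N IH]; rewrite ?big_ord0// 2!big_ord_recr /= YD IH.
pose T z u := u + z *: Y u.
(* Binomial expansion of (1 + zY)^n v. The coefficients depend neither on z nor on the number N of
   terms, and only the first two need to be known. *)
have expand n : exists w : nat -> V, [/\ w 0%N = v, w 1%N = n%:R *: Y v &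
    forall z N, (n < N)%N -> iter n (T z) v = \sum_(m < N) z ^+ m *: w m].
  elim: n => [|n [w [w0 w1 wE]]].
    exists (fun m => if m is 0 then v else 0); split=> //; first by rewrite scale0r.
    move=> z [//|N] _; rewrite big_ord_recl /= expr0 scale1r big1 ?addr0// => i _.
    by rewrite scaler0.
  exists (fun m => w m + if m is m'.+1 then Y (w m') else 0); split.
  - by rewrite addr0.
  - by rewrite w1 w0 -[in RHS]addn1 natrD scalerDl scale1r.
  move=> z [//|N] nN; rewrite iterS /T (wE z N.+1 (ltnW nN)).
  under [RHS]eq_bigr do rewrite scalerDr; rewrite big_split /=; congr (_ + _).
  rewrite -(wE z N.+1 (ltnW nN)) (wE z N nN)
    (Ysum N (fun m => z ^+ m *: w m)) scaler_sumr big_ord_recl /=.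
  by rewrite scaler0 add0r; apply: eq_bigr => m _; rewrite YZ scalerA -exprS.
have bound n z : `|z| = 1 -> H (iter n (T z) v) /\ `|iter n (T z) v| <= `|v|.
  move=> z1; elim: n => [|n [Hn IH]] /=; first by [].
  by split; [apply: HS | apply: le_trans (YC _ _ z1 Hn) IH].
apply: (@norm_natmul_bounded_eq0 _ v) => n.
have [w [_ <- wE]] := expand n; apply: (@linear_coef_bound n) => z z1.
rewrite -wE; first by have [] := bound n z z1.
by rewrite (leq_trans (ltn_expl n (ltnSn 1)))// leq_exp2l.
Qed.

End UnitVertex.

(* In B(H) one would say: x >= 0 and x^*x + y^*y = 0 forces x = 0.  To avoid
   positivity, note that on {a | q a = 0} the contractions (1 - q)(1 - 2 p_i)
   average to the identity, which is an extreme point of the unit ball. *)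
Lemma sum_proj_absorb (R : realType) (A : cstar_algebra R) (I : eqType)
    (s : seq I) (p : I -> A) i :
  {in s, forall j, is_proj (p j)} -> is_proj (\sum_(j <- s) p j) -> i \in s ->
  amul (\sum_(j <- s) p j) (p i) = p i.
Proof.
move=> pP; set q := \sum_(j <- s) p j => qP is_.
have [qs qq] := qP.
(* [x j] is (1 - q) p_j; on the kernel of q, (1 - q)(1 - 2 p_j) acts as 1 - 2 x_j. *)
pose x j a := amul (p j) a - amul q (amul (p j) a).
have xC j a : j \in s -> amul q a = 0 -> `|a - 2 *: x j a| <= `|a|.
  move=> js qa; rewrite -(proj_reflection_norm a (pP _ js)).
  have -> : a - 2 *: x j a = a - 2 *: amul (p j) a - amul q (a - 2 *: amul (p j) a).
    by rewrite amulBr qa amulZr sub0r opprK /x scalerBr opprB addrA addrAC.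
  exact: proj_compl_norm.
have qx j a : amul q (x j a) = 0.
  by rewrite amulBr !amulA qq subrr.
have xL j z u v : x j (z *: u + v) = z *: x j u + x j v.
  by rewrite /x !amulDr !amulZr opprD addrACA scalerBr.
pose s' := rem i s; pose N := (size s').+1.
(* On the kernel of q all the x_j together sum to (1 - q) q = 0. *)
have sumx a : amul q a = 0 -> \sum_(j <- s') x j a = - x i a.
  move=> qa; apply/eqP; rewrite -addr_eq0 addrC.
  have <- := big_cons 0 +%R i s' xpredT (x^~ a).
  rewrite -(perm_big _ (perm_to_rem is_)) /= sumrB -amul_sumr -amul_suml -/q qa.
  by rewrite amul0r subrr.
have N0 : 0 < N%:R :> R[i] by rewrite ltr0n.
have NE : N%:R = (size s')%:R + 1 :> R[i] by rewrite -natr1.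
(* N + 2 x_i and N - 2 x_i are sums of N contractions: 1 and the 1 - 2 x_j over [s'] in the first
   case, 1 - 2 x_i and N - 1 copies of 1 in the second. So 1 + y and 1 - y, with y = (2/N) x_i, are
   contractions on the kernel of q. *)
have xP a : amul q a = 0 -> `|N%:R *: a + 2 *: x i a| <= N%:R * `|a|.
  move=> qa; have -> : N%:R *: a + 2 *: x i a = \sum_(j <- s') (a - 2 *: x j a) + a.
    rewrite sumrB -scaler_sumr sumx// scalerN opprK big_const_seq count_predT.
    by rewrite iter_addr_0 NE scalerDl -[a *+ _]scaler_nat scale1r addrAC.
  rewrite (le_trans (ler_normD _ _))// NE mulrDl mul1r lerD2r.
  rewrite (le_trans (ler_norm_sum _ _ _))// big_seq.
  rewrite (le_trans (y := \sum_(j <- s' | j \in s') `|a|))//.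
    by apply: ler_sum => j /mem_rem js; apply: xC.
  by rewrite -big_seq big_const_seq count_predT iter_addr_0 mulr_natl.
have xN a : amul q a = 0 -> `|N%:R *: a - 2 *: x i a| <= N%:R * `|a|.
  move=> qa; have -> : N%:R *: a - 2 *: x i a = (size s')%:R *: a + (a - 2 *: x i a).
    by rewrite NE scalerDl scale1r addrA.
  rewrite (le_trans (ler_normD _ _))// NE mulrDl mul1r lerD// ?xC//.
  by rewrite normrZ normr_nat.
pose y a := (2 / N%:R) *: x i a.
have yE a : a + y a = N%:R^-1 *: (N%:R *: a + 2 *: x i a).
  rewrite scalerDr !scalerA mulVf ?gt_eqF// scale1r; congr (_ + _ *: _); exact: mulrC.
have yEN a : a - y a = N%:R^-1 *: (N%:R *: a - 2 *: x i a).
  rewrite scalerBr !scalerA mulVf ?gt_eqF// scale1r; congr (_ - _ *: _); exact: mulrC.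
have yP a : amul q a = 0 -> `|a + y a| <= `|a|.
  by move=> qa; rewrite yE normrZ normfV normr_nat ler_pdivrMl// xP.
have yN a : amul q a = 0 -> `|a - y a| <= `|a|.
  by move=> qa; rewrite yEN normrZ normfV normr_nat ler_pdivrMl// xN.
(* On the kernel of q, y is a multiple of (1 - q) p_i (1 - q), hence self-adjoint. *)
have y_sa a : amul q a = 0 -> amul (astar (y a)) a = amul (astar a) (y a).
  move=> qa; have aq : amul (astar a) q = 0 by rewrite -qs -astarM qa astar0.
  have [ps _] := pP _ is_.
  rewrite astarZ astarB !astarM qs ps rmorphM fmorphV !rmorph_nat amulZl amulZr; congr (_ *: _).
  rewrite amulBl amulBr -!amulA qa !amul0r subr0.
  by rewrite [amul _ (amul q _)]amulA aq amul0l subr0.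
have sqD (a u : A) (z : R[i]) : amul (astar u) a = amul (astar a) u ->
    amul (astar (a + z *: u)) (a + z *: u) =
    amul (astar a) a + (z + z^*%C) *: amul (astar a) u + (z * z^*%C) *: amul (astar u) u.
  move=> ua; rewrite astarD astarZ amulDl !amulDr !amulZl !amulZr ua scalerA.
  by rewrite [z^*%C * z]mulrC scalerDl !addrA.
have half (t : R[i]) (u a : A) : `|a + u| <= `|a| -> `|a - u| <= `|a| ->
    -1 <= t <= 1 -> `|a + t *: u| <= `|a|.
  move=> aD aB /andP[t1 t2].
  have -> : a + t *: u = ((1 + t) / 2) *: (a + u) + ((1 - t) / 2) *: (a - u).
    rewrite scalerDr scalerBr addrACA -scalerDl -scalerBl.
    by congr (_ + _ *: _); [rewrite -[LHS]scale1r; congr (_ *: _)|]; field.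
  have p1 : 0 <= (1 + t) / 2 by rewrite divr_ge0// -lerBlDl sub0r.
  have p2 : 0 <= (1 - t) / 2 by rewrite divr_ge0// subr_ge0.
  rewrite (le_trans (ler_normD _ _))// normrZ (ger0_norm p1) normrZ (ger0_norm p2).
  rewrite (le_trans (lerD (ler_wpM2l p1 aD) (ler_wpM2l p2 aB)))// -mulrDl.
  by rewrite (_ : (1 + t) / 2 + (1 - t) / 2 = 1) ?mul1r//; field.
(* The conditions on z say that z is i or -i. The cross terms then cancel, and what is left, 1 +
   y^2, is the average of (1 + y)^2 and (1 - y)^2. *)
have yi a (z : R[i]) : amul q a = 0 -> z + z^*%C = 0 -> z * z^*%C = 1 -> `|a + z *: y a| <= `|a|.
  move=> qa z0 z1; rewrite -(@ler_pXn2r _ 2)// ?nnegrE// -!norm_cstar sqD ?y_sa//.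
  rewrite z0 z1 scale0r addr0 scale1r.
  have -> : amul (astar a) a + amul (astar (y a)) (y a) = 2^-1 *:
      (amul (astar (a + y a)) (a + y a) + amul (astar (a - y a)) (a - y a)).
    have e1 := sqD a (y a) 1 (y_sa a qa); have e2 := sqD a (y a) (-1) (y_sa a qa).
    move: e1 e2; rewrite rmorphN1 rmorph1 mulrNN mulr1 scale1r scaleN1r => -> ->.
    rewrite !scale1r addrACA.
    rewrite [X in _ = _ *: (X + _)]addrACA -scalerDl
      (_ : 1 + 1 + (-1 - 1) = 0) ?scale0r ?addr0; last by ring.
    rewrite addrACA -[X in _ = _ *: X]mulr2n -[X in _ = _ *: X]scaler_nat scalerA.
    by rewrite mulVf ?scale1r ?pnatr_eq0.
  rewrite normrZ normfV normr_nat ler_pdivrMl ?ltr0n// (le_trans (ler_normD _ _))//.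
  rewrite !norm_cstar mulr_natl mulr2n lerD// lerXn2r ?nnegrE//; [exact: yP|exact: yN].
have yL (z : R[i]) u v : y (z *: u + v) = z *: y u + y v.
  by rewrite /y xL !scalerDr !scalerA [z * _]mulrC.
have qy a : amul q (y a) = 0 by rewrite amulZr qx scaler0.
have yx a : y a = 0 -> x i a = 0.
  move/(congr1 ( *:%R (N%:R / 2))); rewrite scalerA scaler0.
  by rewrite mulrA divfK ?pnatr_eq0// divff ?gt_eqF// scale1r.
clearbody y.
have yi0 a : amul q a = 0 -> y a = 0.
  move=> qa; have : 2^-1 *: y a = 0; last first.
    by move/(congr1 ( *:%R 2)); rewrite scalerA mulfV ?pnatr_eq0// scale1r scaler0.
  (* For z = s + it, 1 + zy/2 is the average of 1 + sy and 1 + t(iy), each a convex combination of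
     contractions. This is why y is halved. *)
  apply: (@unit_vertex _ A (fun a => amul q a = 0) (fun a => 2^-1 *: y a)) => //.
  - by move=> z u v; rewrite yL scalerDr !scalerA mulrC.
  - by move=> z u qu; rewrite amulDr qu !amulZr qy !scaler0 addr0.
  move=> z u z1 qu.
  have -> : u + z *: (2^-1 *: y u) = 2^-1 *: ((u + (complex.Re z)%:C *: y u) +
      (u + (complex.Im z)%:C *: ('i%C *: y u))).
    rewrite addrACA -mulr2n [(complex.Im z)%:C *: _]scalerA [_ * 'i%C]mulrC -scalerDl -complexE.
    by rewrite scalerDr -[u *+ 2]scaler_nat !scalerA mulVf ?pnatr_eq0// scale1r mulrC.
  have ci : ('i^*)%C = - 'i%C :> R[i] by apply/eqP; rewrite eq_complex /= oppr0 !eqxx.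
  have cni : ((- 'i)^*)%C = 'i%C :> R[i] by apply/eqP; rewrite eq_complex /= oppr0 opprK !eqxx.
  have rb (t : R) : `|t|%:C <= `|z| -> -1 <= t%:C <= 1.
    by rewrite z1 -(rmorph1 (real_complex R)) -rmorphN !lecR ler_norml.
  rewrite normrZ normfV normr_nat ler_pdivrMl ?ltr0n// (le_trans (ler_normD _ _))//.
  rewrite mulr_natl mulr2n lerD//; apply: half; rewrite ?yP ?yN//.
  - exact/rb/normc_ge_Re.
  - by apply: yi => //; rewrite ci ?subrr// mulrN -expr2 sqr_i opprK.
  - rewrite -scaleNr; apply: yi => //; rewrite cni ?addNr//.
    by rewrite mulNr -expr2 sqr_i opprK.
  - by apply: rb; rewrite normc_def lecR -sqrtr_sqr ler_wsqrtr// lerDr sqr_ge0.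
(* b = (1 - q) p_i lies in the kernel of q, so x_i b = 0, which reads b b = 0. As b^*b = p_i b and b
   p_i = b, using the C*-identity twice gives b = 0. *)
pose b := p i - amul q (p i).
have [ps pp] := pP _ is_.
have qb : amul q b = 0 by rewrite amulBr amulA qq subrr.
have xb : amul b b = 0.
  have <- := yx b (yi0 b qb).
  by rewrite /x amulBl !amulA.
have bsb : amul (astar b) b = amul (p i) b.
  by rewrite astarB astarM ps qs amulBl -amulA qb amul0r subr0.
have : amul (astar b) b = 0.
  apply: cstar_eq0; rewrite astarM astarK bsb -amulA [amul b (amul _ _)]amulA.
  have -> : amul b (p i) = b by rewrite amulBl -amulA pp.
  by rewrite xb amul0r.
by move/cstar_eq0/eqP; rewrite subr_eq0 => /eqP <-.
Qed.

(** * Cuntz-Krieger families *)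

Section StarHomTheory.
Variable R : realType.
Implicit Types A B E : cstar_algebra R.

Lemma star_hom0 A B (f : A -> B) : star_hom f -> f 0 = 0.
Proof.
move=> [fl _ _]; have := fl 1 0 0; rewrite !scale1r addr0 => /eqP.
by rewrite -[X in X == _]addr0 (inj_eq (addrI _)) eq_sym => /eqP.
Qed.

Lemma star_homD A B (f : A -> B) : star_hom f -> {morph f : a b / a + b}.
Proof. by move=> [fl _ _] a b; rewrite -[a]scale1r fl !scale1r. Qed.

Lemma star_hom_sum A B (f : A -> B) (I : Type) (r : seq I) (P : pred I) (F : I -> A) :
  star_hom f -> f (\sum_(i <- r | P i) F i) = \sum_(i <- r | P i) f (F i).
Proof. by move=> fh; apply: big_morph; [exact: star_homD | exact: star_hom0]. Qed.

Lemma star_hom_id A : star_hom (@id A).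
Proof. by []. Qed.

Lemma star_hom_comp A B E (f : A -> B) (g : B -> E) :
  star_hom f -> star_hom g -> star_hom (g \o f).
Proof.
move=> [fl fm fs] [gl gm gs]; split=> [z a b|a b|a] /=; first by rewrite fl gl.
  by rewrite fm gm.
by rewrite fs gs.
Qed.

Lemma star_iso_inv A B (f : A -> B) (g : B -> A) :
  star_hom f -> cancel f g -> cancel g f -> star_hom g.
Proof.
move=> [fl fm fs] fK gK; split=> [z a b|a b|a]; apply: (can_inj fK).
- by rewrite gK fl !gK.
- by rewrite gK fm !gK.
- by rewrite gK fs !gK.
Qed.

Lemma inv_funK A B (f : A -> B) : bijective f -> cancel f (inv_fun f).
Proof.
move=> fb a; rewrite /inv_fun; case: xgetP => [b _ /= fE|/(_ a) []//].
exact: bij_inj fE.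
Qed.

Lemma inv_funKV A B (f : A -> B) : bijective f -> cancel (inv_fun f) f.
Proof. by move=> fb b; have [g _ gK] := fb; rewrite -(gK b) inv_funK. Qed.

Lemma inv_fun_iso A B (f : A -> B) : star_iso f -> star_iso (inv_fun f).
Proof.
move=> [fh fb]; have [fK gK] := (inv_funK fb, inv_funKV fb).
by split; [exact: star_iso_inv fh fK gK | exists f].
Qed.

End StarHomTheory.

Lemma rowN_addIl k : left_injective (+%R : 'rV[nat]_k -> _ -> _).
Proof.
move=> m a b /matrixP ab; apply/matrixP => i j; have := ab i j; rewrite !mxE.
exact: addIn.
Qed.

Lemma rowN_addIr k : right_injective (+%R : 'rV[nat]_k -> _ -> _).
Proof. by move=> m a b; rewrite ![m + _]addrC; exact: rowN_addIl. Qed.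

Section KGraphTheory.
Variables (k : nat) (L : kgraph k).

Lemma kcomp_inj (a b a' b' : L) : ksrc a = krng b -> ksrc a' = krng b' ->
  kcomp a b = kcomp a' b' -> kdeg a = kdeg a' -> a = a' /\ b = b'.
Proof.
move=> ab ab' e d.
have d' : kdeg b = kdeg b'.
  by have := kdeg_comp ab; rewrite e kdeg_comp// d => /rowN_addIr.
have [p [_ pu]] := kfactor (kdeg_comp ab).
have p1 : p = (a, b) by apply: pu.
have : p = (a', b') by apply: pu; rewrite /= e d d'.
by rewrite p1 => -[].
Qed.

Lemma kcomp_injr (a b a' b' : L) : ksrc a = krng b -> ksrc a' = krng b' ->
  kcomp a b = kcomp a' b' -> kdeg b = kdeg b' -> a = a' /\ b = b'.
Proof.
move=> ab ab' e d; apply: kcomp_inj => //.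
by have := kdeg_comp ab; rewrite e kdeg_comp// d => /rowN_addIl.
Qed.

Lemma is_vertexP (v : L) : is_vertex v <-> ksrc v = v.
Proof.
by split=> [/eqP/deg0_id[]//|<-]; exact: is_vertex_src.
Qed.

Lemma is_vertex_rngP (v : L) : is_vertex v <-> krng v = v.
Proof.
by split=> [/eqP/deg0_id[]//|<-]; exact: is_vertex_rng.
Qed.

Lemma is_edgeP (e : L) : reflect (exists i, kdeg e = delta_mx 0 i) (is_edge e).
Proof. by apply: (iffP existsP) => -[i /eqP]; exists i => //; apply/eqP. Qed.

Lemma deg_is_edge (e : L) i : kdeg e = delta_mx 0 i -> is_edge e.
Proof. by move=> ei; apply/is_edgeP; exists i. Qed.

Lemma is_generator_vertex (x : L) : is_vertex x -> is_generator x.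
Proof. by rewrite /is_generator => ->. Qed.

Lemma is_generator_edge (x : L) : is_edge x -> is_generator x.
Proof. by rewrite /is_generator => ->; rewrite orbT. Qed.

End KGraphTheory.

Lemma kgraph_iso_inv k (L M : kgraph k) (f : L -> M) (g : M -> L) :
  is_kgraph_iso f -> cancel f g -> cancel g f -> is_kgraph_iso g.
Proof.
move=> [[fs fr fc] fb fd] fK gK; split; [split|by exists f|].
- by move=> x; apply: (can_inj fK); rewrite gK fs gK.
- by move=> x; apply: (can_inj fK); rewrite gK fr gK.
- move=> x y xy; apply: (can_inj fK); rewrite gK fc ?gK//.
  by apply: (can_inj fK); rewrite fs fr !gK.
- by move=> x; rewrite -fd gK.
Qed.

Lemma kgraph_iso_comp k (L M N : kgraph k) (f : L -> M) (g : M -> N) :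
  is_kgraph_iso f -> is_kgraph_iso g -> is_kgraph_iso (g \o f).
Proof.
move=> [[fs fr fc] fb fd] [[gs gr gc] gb gd]; split; [split|exact: bij_comp|].
- by move=> x /=; rewrite fs gs.
- by move=> x /=; rewrite fr gr.
- by move=> x y xy /=; rewrite fc// gc// -fs -fr xy.
- by move=> x /=; rewrite gd fd.
Qed.

Lemma kgraph_iso_generator k (L M : kgraph k) (f : L -> M) x :
  is_kgraph_iso f -> is_generator (f x) = is_generator x.
Proof. by move=> [_ _ fd]; rewrite /is_generator /is_vertex /is_edge !fd. Qed.

Section CKTheory.
Variables (R : realType) (k : nat) (L : kgraph k) (A : cstar_algebra R) (S : L -> A).
Hypothesis SCK : ck_family S.

Lemma ck_vertex_proj v : is_vertex v -> is_proj (S v).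
Proof. by move=> /(ck1_proj SCK)[]. Qed.

Lemma ck_mul_src e : is_generator e -> amul (S e) (S (ksrc e)) = S e.
Proof.
move=> /orP[v|ee]; first by have /is_vertexP -> := v; have [] := ck_vertex_proj v.
by rewrite -(ck3 SCK)// amulA (ck_pisometry SCK)// is_generator_edge.
Qed.

Lemma ck_star_src e : is_generator e -> amul (S (ksrc e)) (astar (S e)) = astar (S e).
Proof.
move=> eg; have [<- _] := ck_vertex_proj (is_vertex_src e).
by rewrite -astarM ck_mul_src.
Qed.

Hypothesis rf : row_finite L.

(** Row-finiteness turns the set-indexed sum of CK4 into a sum over a list, the shape that
    [sum_proj_absorb] takes. *)
Lemma ck_range_sum v i : is_vertex v -> exists2 s : seq L,
  (forall e, e \in s <-> krng e = v /\ kdeg e = delta_mx 0 i) &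
  S v = \sum_(e <- s) amul (S e) (astar (S e)).
Proof.
move=> vv; have /finite_seqP[s sE] := rf (delta_mx 0 i) vv.
have sP e : e \in s <-> krng e = v /\ kdeg e = delta_mx 0 i.
  have -> : (e \in s) = [set` s] e :> Prop by [].
  by rewrite -sE.
exists (undup s) => [e|]; first by rewrite mem_undup.
rewrite (ck4 SCK i vv) [RHS]fsbig_seq ?undup_uniq//; apply: eq_fsbigl.
by rewrite sE; apply/seteqP; split=> e /=; rewrite mem_undup.
Qed.

(** S_e S_e^* is one of the terms of CK4 at r(e), so S_{r(e)} absorbs it; then use S_e = S_e S_e^*
    S_e. *)
Lemma ck_mul_rng e : is_generator e -> amul (S (krng e)) (S e) = S e.
Proof.
move=> /orP[v|ee].
  by have /is_vertex_rngP -> := v; have [] := ck_vertex_proj v.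
have /is_edgeP[i ei] := ee.
have [s sP SE] := ck_range_sum i (is_vertex_rng e).
have eg := is_generator_edge ee.
rewrite -(ck_pisometry SCK eg) amulA; congr amul.
rewrite {1}SE; apply: (@sum_proj_absorb _ _ _ s (fun e => amul (S e) (astar (S e)))).
- move=> f /sP[_ /deg_is_edge/is_generator_edge fg]; split.
    by rewrite astarM astarK.
  by rewrite amulA (ck_pisometry SCK fg).
- by rewrite -SE; exact: ck_vertex_proj (is_vertex_rng e).
- exact/sP.
Qed.

End CKTheory.

Section CKTransfer.
Variables (R : realType) (k : nat) (L : kgraph k).

Lemma ck_family_hom (A B : cstar_algebra R) (S : L -> A) (f : A -> B) :
  row_finite L -> ck_family S -> star_hom f -> ck_family (f \o S).
Proof.
move=> rf SCK fh; have [_ fm fs] := fh; split=> /=.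
- by move=> x xg; rewrite -fs -!fm (ck_pisometry SCK xg).
- by move=> v /(ck1_proj SCK)[sv vv]; rewrite -fs -fm sv vv.
- by move=> v w vv ww vw; rewrite -fm (ck1_orth SCK)// star_hom0.
- by move=> e g g' e' ee gg gg' ee' eg ge cE; rewrite -!fm (ck2 SCK ee gg gg' ee').
- by move=> e ee; rewrite -fs -fm (ck3 SCK).
move=> v i vv; rewrite (ck4 SCK i vv) !fsbig_finite; [|exact: rf..].
by rewrite star_hom_sum//; apply: eq_bigr => e _; rewrite -fs -fm.
Qed.

(** Surjectivity onto the edges of colour [iota i] into [h v] gives both CK4 sums the same terms.
    Stated with [iota] so as to cover isomorphisms and also the inclusions of slices, which see only
    some of the colours. *)
Lemma ck_family_pullback l (M : kgraph l) (B : cstar_algebra R) (T : M -> B)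
    (h : L -> M) (iota : 'I_k -> 'I_l) :
  is_functor h -> injective h ->
  (forall e i, kdeg e = delta_mx 0 i -> kdeg (h e) = delta_mx 0 (iota i)) ->
  (forall v i, is_vertex v -> set_surj (out_set v (delta_mx 0 i))
     (out_set (h v) (delta_mx 0 (iota i))) h) ->
  ck_family T -> ck_family (T \o h).
Proof.
move=> [hs hr hc] hi hd hsurj TCK.
have hv v : is_vertex v -> is_vertex (h v).
  by move=> /is_vertexP vE; apply/is_vertexP; rewrite -hs vE.
have he e : is_edge e -> is_edge (h e).
  by move=> /is_edgeP[i /hd ei]; apply: deg_is_edge ei.
split=> /=.
- move=> x /orP[/hv|/he] xg; apply: (ck_pisometry TCK).
    exact: is_generator_vertex.
  exact: is_generator_edge.
- by move=> v /hv; exact: ck1_proj.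
- by move=> v w /hv vv /hv ww vw; apply: (ck1_orth TCK) => // /hi.
- move=> e f f' e' /he ee /he ff /he ff' /he ee' ef fe cE.
  by apply: (ck2 TCK) => //; rewrite -?hs -?hr -?hc ?ef ?fe ?cE.
- by move=> e /he ee; rewrite (ck3 TCK)// hs.
move=> v i vv; rewrite (ck4 TCK (iota i) (hv _ vv)).
apply: reindex_fsbig; split; [|by move=> x y _ _ /hi|exact: hsurj].
by move=> e /= [<- ei]; split; [rewrite hr|exact: hd].
Qed.

Lemma ck_family_iso (M : kgraph k) (B : cstar_algebra R) (T : M -> B) (h : L -> M) :
  is_kgraph_iso h -> ck_family T -> ck_family (T \o h).
Proof.
move=> [hf hb hd]; apply: (@ck_family_pullback _ _ _ _ _ id) => //.
- exact: bij_inj.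
- by move=> e i; rewrite hd.
have [g hK gK] := hb; have [_ gr _] : is_functor g.
  by have [] : is_kgraph_iso g by apply: kgraph_iso_inv hK gK; split.
move=> v i vv x /= [xv xi]; exists (g x) => //=; split; last by rewrite -hd gK.
by rewrite -gr xv hK.
Qed.

End CKTransfer.

Section GraphAlgebraTheory.
Variables (R : realType) (k : nat) (L : kgraph k) (A : cstar_algebra R) (S : L -> A).
Hypothesis SA : is_graph_algebra S.

Lemma graph_algebra_ext (B : cstar_algebra R) (T : L -> B) (f g : A -> B) :
  ck_family T -> star_hom f -> star_hom g ->
  (forall x, is_generator x -> f (S x) = T x) ->
  (forall x, is_generator x -> g (S x) = T x) -> f =1 g.
Proof.
move=> TCK fh gh fT gT a; have [_ _ /(_ _ _ TCK)[h [_ hu]]] := SA.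
by rewrite -(hu f)// -(hu g).
Qed.

Lemma graph_algebra_map (B : cstar_algebra R) (T : L -> B) : ck_family T ->
  exists2 f : A -> B, star_hom f & forall x, is_generator x -> f (S x) = T x.
Proof. by move=> TCK; have [_ _ /(_ _ _ TCK)[f [[fh fT] _]]] := SA; exists f. Qed.

(** [h] and its inverse both induce homomorphisms by universality; their composites are identities
    on generators, hence everywhere by uniqueness. *)
Lemma graph_algebra_iso (M : kgraph k) (B : cstar_algebra R) (T : M -> B) (h : L -> M) :
  is_kgraph_iso h -> is_graph_algebra T -> exists f, induced_by_kgraph_iso S T h f.
Proof.
move=> hI TB; have [_ [g hK gK] _] := hI; have gI := kgraph_iso_inv hI hK gK.
have [SCK _ Su] := SA; have [TCK _ Tu] := TB.
have [f fh fE] := graph_algebra_map (ck_family_iso hI TCK).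
have [f' [[f'h f'E] _]] := Tu _ _ (ck_family_iso gI SCK).
exists f; split=> //; split=> //; exists f'.
  apply: (@graph_algebra_ext _ S (f' \o f) id) => //; first exact: star_hom_comp.
  by move=> x xg /=; rewrite fE//= f'E ?(kgraph_iso_generator _ hI)//= hK.
have [u [_ uu]] := Tu _ _ TCK; move=> b.
suff uE : u = f \o f' by rewrite -[LHS]/((f \o f') b) -uE (uu id).
apply: uu; split; first exact: star_hom_comp.
by move=> x xg /=; rewrite f'E// fE ?(kgraph_iso_generator _ gI)//= gK.
Qed.

End GraphAlgebraTheory.

(** * Identity elements of algebras given by generators *)

Section Unit.
Variables (R : realType) (A : cstar_algebra R).

(** An intersection of the kernels of two additive maps, a -> ca - a and a -> ac - a, both bounded
    by |c| + 1. *)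
Lemma closed_identity (c : A) : closed [set a | amul c a = a /\ amul a c = a].
Proof.
have cl (f : A -> A) M : 0 <= M -> (forall a b, f a - f b = f (a - b)) ->
    (forall a, `|f a| <= M * `|a|) -> closed [set a | f a = 0].
  move=> M0 fB fM a clA; apply/eqP; rewrite -normr_le0; apply/ler_addgt0Pl => e e0.
  rewrite addr0.
  (* M + 1 rather than M keeps the radius meaningful when M = 0. *)
  have M1 : 0 < M + 1 by rewrite ltr_wpDl.
  have [|b [/= fb ab]] := clA (ball a (e / (M + 1))).
    by apply: nbhsx_ballx; rewrite divr_gt0.
  rewrite -[f a]subr0 -fb fB (le_trans (fM _))//.
  move: ab; rewrite -ball_normE /= => /ltW.
  rewrite ler_pdivlMr// => /(le_trans _); apply.
  by rewrite mulrC ler_wpM2l// lerDl.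
have E : [set a | amul c a = a /\ amul a c = a] =
    [set a | amul c a - a = 0] `&` [set a | amul a c - a = 0].
  apply/seteqP; split=> a /= [ca ac]; first by rewrite ca ac subrr.
  by split; apply/eqP; rewrite -subr_eq0 ?ca ?ac.
rewrite E; apply: closedI; apply: (cl _ (`|c| + 1)).
- by rewrite addr_ge0.
- by move=> a b; rewrite opprD addrACA -opprD amulBr.
- by move=> a; rewrite mulrDl mul1r (le_trans (ler_normB _ _))// lerD2r norm_amul.
- by rewrite addr_ge0.
- by move=> a b; rewrite opprD addrACA -opprD amulBl.
- by move=> a; rewrite mulrDl mul1r (le_trans (ler_normB _ _))// lerD2r mulrC norm_amul.
Qed.

Definition is_identity (c : A) : Prop := forall a, amul c a = a /\ amul a c = a.

(** The elements on which c acts as an identity from both sides form a closed star-subalgebra;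
    self-adjointness of c gives stability under the star. *)
Lemma generates_identity (X : set A) (c : A) : generates X -> astar c = c ->
  (forall a, X a -> amul c a = a /\ amul a c = a) -> is_identity c.
Proof.
move=> /(_ [set a | amul c a = a /\ amul a c = a]) gX cs XU a.
suff : [set a | amul c a = a /\ amul a c = a] a by [].
rewrite gX//; last exact: closed_identity.
split=> /=.
- by rewrite amul0l amul0r.
- by move=> z b d [cb bc] [cd dc]; rewrite amulDr amulDl amulZr amulZl cb bc cd dc.
- by move=> b d [cb bc] [cd dc]; rewrite amulA cb -amulA dc.
- by move=> b [cb bc]; split; rewrite -{1}cs -astarM ?bc ?cb.
Qed.

Variables (k : nat) (L : kgraph k) (S : L -> A) (vs : seq L).
Hypotheses (SA : is_graph_algebra S) (rf : row_finite L).
Hypotheses (vsu : uniq vs) (vsP : forall x, (x \in vs) = is_vertex x).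

Definition ck_one : A := \sum_(v <- vs) S v.

Lemma ck_one_mul v x : is_vertex v -> amul (S v) x = x -> amul ck_one x = x.
Proof.
have [SCK _ _] := SA.
move=> vv vx; rewrite amul_suml -{1}vx (bigD1_seq v) ?vsP//= amulA.
rewrite big_seq_cond big1 ?addr0; first by have [_ ->] := ck_vertex_proj SCK vv.
move=> w; rewrite vsP => /andP[ww /eqP wv]; rewrite amulA (ck1_orth SCK)// amul0l.
by [].
Qed.

Lemma ck_one_star : astar ck_one = ck_one.
Proof.
have [SCK _ _] := SA; rewrite astar_sum [RHS]big_seq big_seq; apply: eq_bigr => v.
by rewrite vsP => /(ck_vertex_proj SCK)[].
Qed.

Lemma ck_one_identity : is_identity ck_one.
Proof.
have [SCK gen _] := SA; apply: generates_identity gen ck_one_star _ => _ [x /= xg <-].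
split.
  by apply: (ck_one_mul (is_vertex_rng x)); exact: ck_mul_rng.
rewrite -{1}ck_one_star -[S x in LHS]astarK -astarM.
rewrite (@ck_one_mul (ksrc x)) ?astarK ?is_vertex_src//.
exact: ck_star_src.
Qed.

End Unit.

(** * Slices of a quasi-product *)

Lemma bij_of_inj_surj (T U : Type) (f : T -> U) :
  injective f -> (forall y, exists x, f x = y) -> bijective f.
Proof.
move=> fi fs; exists (fun y => projT1 (cid (fs y))) => [x|y].
  by case: (cid _) => x' /= /fi.
by case: (cid _).
Qed.

Lemma dependent_choice (I : Type) (T : I -> Type) (P : forall i, T i -> Prop) :
  (forall i, exists y, P i y) -> exists f : forall i, T i, forall i, P i (f i).
Proof. by move=> H; exists (fun i => projT1 (cid (H i))) => i; case: (cid _). Qed.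

Section Slices.
Variables (k1 k2 : nat) (L : kgraph k1) (M : kgraph k2) (O : kgraph (k1 + k2)).
Variable Phi : cdigraph_iso (skeleton (prod_kgraph L M)) (skeleton O).

(** The type [slice1 v] depends on v. A predicate on [O] lets elements move between slices, and
    their indices be compared, without casts. *)
Definition in_slice (v : vertex M) (x : O) : Prop :=
  represented (G := skeleton L) (qvert Phi ^~ v) (qedge1 Phi ^~ v) x.

Lemma in_slice_val v (x : slice1 Phi v) : in_slice v (val x).
Proof. by case: x => x /= /asboolP. Qed.

Lemma in_sliceP v x : in_slice v x -> exists y : slice1 Phi v, val y = x.
Proof. by move=> xv; exists (exist _ x (asboolT xv)). Qed.

Lemma in_slice_deg v x : in_slice v x -> rsubmx (kdeg x) = 0.
Proof.
move=> /(represented_deg (G := skeleton L) (qedge1_src Phi ^~ v) (qedge1_rng Phi ^~ v)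
  (qedge1_deg Phi ^~ v) (@inj1D k1 k2) (@inj1_0 k1 k2) (@inj1K k1 k2)) ->.
by rewrite /inj1 row_mxKr.
Qed.

(** Edges with a colour of the first factor stay inside one copy of G(Lambda), so one endpoint and
    the degree decide membership. *)
Lemma in_slice_srcP v x : in_slice v x <->
  rsubmx (kdeg x) = 0 /\ exists u, ksrc x = val (qvert Phi u v).
Proof.
split=> [xv|[x0 [u xu]]].
  split; first exact: in_slice_deg xv.
  exact: (represented_src (G := skeleton L) (qedge1_src Phi ^~ v) (qedge1_rng Phi ^~ v) xv).
apply: (represented_by_src (G := skeleton L) (@qvert_inj1 _ _ _ _ _ Phi v) (qedge1_src Phi ^~ v)
  (qedge1_rng Phi ^~ v) (@inj1D k1 k2) (@inj1_0 k1 k2) (@delta_lshift k1 k2)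
  (@qedge1_lift _ _ _ _ _ Phi v) _ xu (m := lsubmx (kdeg x))).
by rewrite /inj1 -[LHS]hsubmxK x0.
Qed.

Lemma in_slice_rngP v x : in_slice v x <->
  rsubmx (kdeg x) = 0 /\ exists u, krng x = val (qvert Phi u v).
Proof.
split=> [xv|[x0 [u xu]]].
  split; first exact: in_slice_deg xv.
  exact: (represented_rng (G := skeleton L) (qedge1_src Phi ^~ v) (qedge1_rng Phi ^~ v) xv).
apply: (represented_by_rng (G := skeleton L) (@qvert_inj1 _ _ _ _ _ Phi v) (qedge1_src Phi ^~ v)
  (qedge1_rng Phi ^~ v) (@inj1D k1 k2) (@inj1_0 k1 k2) (@delta_lshift k1 k2)
  (@qedge1_lift _ _ _ _ _ Phi v) _ xu (m := lsubmx (kdeg x))).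
by rewrite /inj1 -[LHS]hsubmxK x0.
Qed.

Lemma in_slice_vertexP v x : is_vertex x ->
  in_slice v x <-> exists u, x = val (qvert Phi u v).
Proof.
move=> xv; rewrite in_slice_srcP; have /is_vertexP -> := xv.
by split=> [[]//|?]; split=> //; rewrite (eqP xv); apply/matrixP => i j; rewrite !mxE.
Qed.

Lemma rsubmx_nat0 : rsubmx (0 : 'rV[nat]_(k1 + k2)) = 0.
Proof. by apply/matrixP => i j; rewrite !mxE. Qed.

Lemma in_slice_src v x : rsubmx (kdeg x) = 0 -> in_slice v (ksrc x) <-> in_slice v x.
Proof.
move=> x0; rewrite (propext (in_slice_srcP v x)) in_slice_srcP ksrc_src.
by rewrite kdeg_src x0 rsubmx_nat0.
Qed.

Lemma in_slice_rng v x : rsubmx (kdeg x) = 0 -> in_slice v (krng x) <-> in_slice v x.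
Proof.
move=> x0; rewrite (propext (in_slice_rngP v x)) in_slice_rngP krng_rng.
by rewrite kdeg_rng x0 rsubmx_nat0.
Qed.

Lemma in_slice_inj v v' x : in_slice v x -> in_slice v' x -> v = v'.
Proof.
move=> /in_slice_srcP[_ [u xu]] /in_slice_srcP[_ [u']].
by rewrite xu => /val_inj/qvert_inj[].
Qed.

Lemma slice1_srcE v (x : slice1 Phi v) : val (ksrc x) = ksrc (val x).
Proof. by []. Qed.

Lemma slice1_rngE v (x : slice1 Phi v) : val (krng x) = krng (val x).
Proof. by []. Qed.

Lemma slice1_degE v (x : slice1 Phi v) : kdeg (val x) = row_mx (kdeg x) 0.
Proof. by rewrite -[LHS]hsubmxK (in_slice_deg (in_slice_val x)). Qed.

Lemma slice1_compE v (x y : slice1 Phi v) :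
  ksrc x = krng y -> val (kcomp x y) = kcomp (val x) (val y).
Proof.
move=> /(congr1 val) /= xy; rewrite val_insubd ifT //; apply/asboolP.
apply/in_slice_srcP; have /in_slice_srcP[y0 [u yu]] := in_slice_val y.
split; last by exists u; rewrite ksrc_comp.
by rewrite kdeg_comp// rsubmxND y0 (in_slice_deg (in_slice_val x)) addr0.
Qed.

Lemma slice1_is_vertex v (x : slice1 Phi v) : is_vertex (val x) = is_vertex x.
Proof.
apply/idP/idP => [/is_vertexP xx|/is_vertexP xx]; apply/is_vertexP; last by rewrite -slice1_srcE xx.
exact: val_inj.
Qed.

Lemma slice1_edge_deg v (x : slice1 Phi v) i :
  kdeg x = delta_mx 0 i -> kdeg (val x) = delta_mx 0 (lshift k2 i).
Proof. by move=> xi; rewrite slice1_degE xi delta_lshift. Qed.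

Lemma slice1_val_functor v : is_functor (fun x : slice1 Phi v => val x).
Proof. by split=> // x y xy; rewrite slice1_compE. Qed.

Lemma slice1_out_surj v (u : slice1 Phi v) i :
  set_surj (out_set u (delta_mx 0 i)) (out_set (val u) (delta_mx 0 (lshift k2 i)))
    (fun x : slice1 Phi v => val x).
Proof.
move=> x [xu xi].
have xv : in_slice v x.
  apply/in_slice_rng; first by rewrite xi -delta_lshift row_mxKr.
  by rewrite xu; exact: in_slice_val.
have [y yx] := in_sliceP xv; exists y => //; split.
  by apply: val_inj; rewrite slice1_rngE yx.
by have := slice1_degE y; rewrite yx xi -delta_lshift => /eq_row_mx[].
Qed.

Lemma slice1_row_finite v : row_finite O -> row_finite (slice1 Phi v).
Proof.
move=> rf u m uv.
have fin := rf (val u) (row_mx m 0); rewrite slice1_is_vertex in fin.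
apply: (@sub_finite_set _ _ ((fun x : slice1 Phi v => val x) @^-1` out_set (val u) (row_mx m 0))).
  by move=> x [xu xm]; split; [rewrite -xu|rewrite slice1_degE xm].
by apply: finite_preimage; [move=> x y _ _; exact: val_inj|exact: fin].
Qed.

Lemma ck_family_slice (R : realType) (B : cstar_algebra R) (T : O -> B) v :
  ck_family T -> ck_family (fun x : slice1 Phi v => T (val x)).
Proof.
move=> TCK; apply: (@ck_family_pullback _ _ (slice1 Phi v) _ O _ T
   (fun x : slice1 Phi v => val x) (lshift k2)) TCK.
- exact: slice1_val_functor.
- exact: val_inj.
- exact: slice1_edge_deg.
- by move=> u i _; exact: slice1_out_surj.
Qed.

Variables (n : nat) (C : cdigraph_iso (cycle_cdigraph n k2) (skeleton M)).

Local Notation sl i := (in_slice (cyc_vert C i)).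
Local Notation col2 j := (delta_mx 0 (rshift k1 j)).

Lemma cyc_vert_inj : injective (cyc_vert C).
Proof. exact: bij_inj (isoV_bij C). Qed.

Lemma cyc_slice_inj i i' x : sl i x -> sl i' x -> i = i'.
Proof. by move=> xi /(in_slice_inj xi)/cyc_vert_inj. Qed.

Lemma cyc_slice_ex x : rsubmx (kdeg x) = 0 -> exists i, sl i x.
Proof.
move=> x0; have [u [v uv]] := qvertP Phi (exist _ (ksrc x) (is_vertex_src x)).
have [g _ gK] := isoV_bij C; exists (g v); apply/in_slice_srcP; split=> //; exists u.
by rewrite /cyc_vert gK -uv.
Qed.

Lemma col2E j (f : O) : kdeg f = col2 j ->
  exists u i, f = val (qedge2 Phi u (cyc_edge C i j)).
Proof.
move=> fj; have [|u [e fE]] := @qedge2P _ _ _ _ _ Phi (exist _ f (deg_is_edge fj)) j.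
  by rewrite /= fj -delta_rshift.
have [g _ gK] := isoE_bij C; exists u, (g e).1.
have -> : cyc_edge C (g e).1 j = e; last by rewrite -fE.
rewrite -[RHS]gK /cyc_edge; case E : (g e) => [i l] /=; congr (isoE C (_, _)).
have := qedge2_deg Phi u e; rewrite -fE /= fj -[val e]/(val e) -delta_rshift.
move=> /eq_row_mx[_ je]; have := iso_col C (g e); rewrite gK E /= -je => jl.
apply/eqP; have /matrixP/(_ 0 j) := jl; rewrite !mxE !eqxx /=.
by case: (j == l).
Qed.

Lemma cyc_edge_src u i j :
  ksrc (val (qedge2 Phi u (cyc_edge C i j))) = val (qvert Phi u (cyc_vert C i)).
Proof. by rewrite qedge2_src; congr (val (qvert _ _ _)); exact: (iso_src C (i, j)). Qed.

Lemma cyc_edge_rng u i j :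
  krng (val (qedge2 Phi u (cyc_edge C i j))) = val (qvert Phi u (cyc_vert C (ordS i))).
Proof. by rewrite qedge2_rng; congr (val (qvert _ _ _)); exact: (iso_rng C (i, j)). Qed.

Lemma cyc_edge_deg u i j : kdeg (val (qedge2 Phi u (cyc_edge C i j))) = col2 j.
Proof.
rewrite qedge2_deg /inj2 -delta_rshift; congr row_mx; exact: (iso_col C (i, j)).
Qed.

Lemma ordS_inj m : injective (@ordS m).
Proof. exact: can_inj (@ordSK m). Qed.

Lemma col2_slice j (f : O) i : kdeg f = col2 j -> sl i (ksrc f) <-> sl (ordS i) (krng f).
Proof.
move=> /col2E[u [i' ->]]; rewrite cyc_edge_src cyc_edge_rng.
rewrite !in_slice_vertexP ?(valP (qvert _ _ _))//.
by split=> -[u' /val_inj/qvert_inj[_ /cyc_vert_inj]]; [move->|move/ordS_inj->]; exists u.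
Qed.

Lemma col2_src_inj j (f g : O) : kdeg f = col2 j -> kdeg g = col2 j ->
  ksrc f = ksrc g -> f = g.
Proof.
move=> /col2E[u [i ->]] /col2E[u' [i' ->]]; rewrite !cyc_edge_src.
by move=> /val_inj/qvert_inj[-> /cyc_vert_inj->].
Qed.

Lemma col2_rng_inj j (f g : O) : kdeg f = col2 j -> kdeg g = col2 j ->
  krng f = krng g -> f = g.
Proof.
move=> /col2E[u [i ->]] /col2E[u' [i' ->]]; rewrite !cyc_edge_rng.
by move=> /val_inj/qvert_inj[-> /cyc_vert_inj/ordS_inj->].
Qed.

Lemma col2_src_ex j (u : O) : is_vertex u -> exists2 f : O, kdeg f = col2 j & ksrc f = u.
Proof.
move=> uv; have [|i /in_slice_vertexP[//|x ->]] := @cyc_slice_ex u.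
  by rewrite (eqP uv) rsubmx_nat0.
by exists (val (qedge2 Phi x (cyc_edge C i j))); rewrite ?cyc_edge_deg ?cyc_edge_src.
Qed.

Lemma col2_rng_ex j (u : O) : is_vertex u -> exists2 f : O, kdeg f = col2 j & krng f = u.
Proof.
move=> uv; have [|i /in_slice_vertexP[//|x ->]] := @cyc_slice_ex u.
  by rewrite (eqP uv) rsubmx_nat0.
exists (val (qedge2 Phi x (cyc_edge C (ord_pred i) j))); first by rewrite cyc_edge_deg.
by rewrite cyc_edge_rng ord_predK.
Qed.

Local Notation hat_ i j := (hat Phi (cyc_path C i j)).

(** [hat_spec] chooses its vertex and its beta existentially. As only one edge of colour j enters a
    given vertex, its path is the given f', and comparing degrees shows that beta is again an edge
    of colour j. Later facts on [hat] rest on this commuting square rather than on the choice. *)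
Lemma hatP i j (x : slice1 Phi (cyc_vert C (ordS i))) (f' : O) :
  kdeg f' = col2 j -> ksrc (val x) = krng f' ->
  kdeg (hat_ i j x) = kdeg x /\
  exists f, [/\ kdeg f = col2 j, ksrc f = krng (val (hat_ i j x)) &
    kcomp (val x) f' = kcomp f (val (hat_ i j x))].
Proof.
move=> f'j xf; rewrite /hat; case: cid => y /= [u [f [xu [m fm] fy e]]].
have {}e : kcomp (val x) f' = kcomp f (val y).
  rewrite -e /path2 /= -(cyc_edge_src u i j) kcomp_idr; congr kcomp.
  apply: (col2_rng_inj f'j); first exact: cyc_edge_deg.
  by rewrite cyc_edge_rng -xf.
have := kdeg_comp xf; rewrite e kdeg_comp// fm f'j !slice1_degE -delta_rshift.
have row_mxD (a b : 'rV[nat]_k1) (c d : 'rV[nat]_k2) :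
    row_mx a c + row_mx b d = row_mx (a + b) (c + d).
  by apply/matrixP => p q; rewrite !mxE; case: splitP => q' _; rewrite !mxE.
rewrite !row_mxD !add0r !addr0 => /eq_row_mx[yx mj]; split; first by rewrite !row_mxKl.
by exists f; split=> //; rewrite fm mj.
Qed.

(** Unique factorization: the square of [hatP] and the given one have the same composite and left
    factors of the same degree. *)
Lemma hat_eq i j (x : slice1 Phi (cyc_vert C (ordS i))) (y : slice1 Phi (cyc_vert C i)) (f f' : O) :
  kdeg f' = col2 j -> ksrc (val x) = krng f' -> kdeg f = col2 j ->
  ksrc f = krng (val y) -> kcomp (val x) f' = kcomp f (val y) -> hat_ i j x = y.
Proof.
move=> f'j xf fj fy e; have [yx [g [gj gy e']]] := hatP f'j xf.
apply: val_inj.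
have [||_ ->//] := @kcomp_inj _ O g (val (hat_ i j x)) f (val y) gy fy.
  by rewrite -e' e.
by rewrite gj fj.
Qed.

Lemma hat_edge_ex i j (x : slice1 Phi (cyc_vert C (ordS i))) :
  exists2 f' : O, kdeg f' = col2 j & ksrc (val x) = krng f'.
Proof.
by have [f' f'j f'x] := col2_rng_ex j (is_vertex_src (val x)); exists f'.
Qed.

Lemma hat_deg i j x : kdeg (hat_ i j x) = kdeg x.
Proof. by have [f' f'j xf] := hat_edge_ex j x; have [] := hatP f'j xf. Qed.

(** A vertex gives a degenerate square with the same edge on both sides: f' here, f in [hat_rng].
    For [hat_comp] two squares are pasted. *)
Lemma hat_src i j x : hat_ i j (ksrc x) = ksrc (hat_ i j x).
Proof.
have [f' f'j xf] := hat_edge_ex j x; have [yx [f [fj fy e]]] := hatP f'j xf.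
have yf : ksrc (val (hat_ i j x)) = ksrc f'.
  by rewrite -(ksrc_comp fy) -e ksrc_comp.
apply: (hat_eq f'j _ f'j); rewrite ?slice1_srcE ?ksrc_src ?krng_src//.
by rewrite xf kcomp_idl yf kcomp_idr.
Qed.

Lemma hat_rng i j x : hat_ i j (krng x) = krng (hat_ i j x).
Proof.
have [f' f'j xf] := hat_edge_ex j x; have [yx [f [fj fy e]]] := hatP f'j xf.
have rx : krng (val x) = krng f by rewrite -(krng_comp fy) -e krng_comp.
apply: (hat_eq fj _ fj); rewrite ?slice1_rngE ?ksrc_rng ?krng_rng//.
by rewrite rx kcomp_idl -fy kcomp_idr.
Qed.

Lemma hat_comp i j x y : ksrc x = krng y ->
  hat_ i j (kcomp x y) = kcomp (hat_ i j x) (hat_ i j y).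
Proof.
move=> xy; have [g' g'j yg] := hat_edge_ex j y; have [_ [f' [f'j f'y e]]] := hatP g'j yg.
have vxy := congr1 val xy; rewrite slice1_srcE slice1_rngE in vxy.
have xf : ksrc (val x) = krng f' by rewrite vxy -(krng_comp yg) e krng_comp.
have [_ [f [fj fx e']]] := hatP f'j xf.
have hxy : ksrc (hat_ i j x) = krng (hat_ i j y) by rewrite -hat_src -hat_rng xy.
have vhxy := congr1 val hxy; rewrite slice1_srcE slice1_rngE in vhxy.
apply: (hat_eq g'j _ fj); rewrite ?slice1_compE ?ksrc_comp ?krng_comp//.
by rewrite -kcompA// e kcompA// e' -kcompA.
Qed.

(** The range of the image determines f, hence the composite of the square; factoring it with the
    degree of x first returns x. *)
Lemma hat_inj i j : injective (hat_ i j).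
Proof.
move=> x y xy; have [f' f'j xf] := hat_edge_ex j x; have [g' g'j yg] := hat_edge_ex j y.
have dxy : kdeg (val x) = kdeg (val y) by rewrite !slice1_degE -(hat_deg j) xy hat_deg.
have [_ [f [fj fx e]]] := hatP f'j xf; have [_ [g [gj gy e']]] := hatP g'j yg.
have fg : f = g by apply: (col2_src_inj fj gj); rewrite fx gy xy.
apply: val_inj; have [//|//] := @kcomp_inj _ O _ _ _ _ xf yg _ dxy.
by rewrite e e' fg xy.
Qed.

Lemma hat_surj i j y : exists x, hat_ i j x = y.
Proof.
have [f fj fy] := col2_src_ex j (is_vertex_rng (val y)).
have d : kdeg (kcomp f (val y)) = kdeg (val y) + col2 j by rewrite kdeg_comp// fj addrC.
have [[x f'] [/= [xf e dx df] _]] := kfactor d.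
have sx : sl (ordS i) x.
  apply/in_slice_rng; first by rewrite dx; exact: in_slice_deg (in_slice_val y).
  rewrite -(krng_comp xf) e krng_comp//; apply/(col2_slice _ fj).
  rewrite fy; apply/in_slice_rng; last exact: in_slice_val.
  exact: in_slice_deg (in_slice_val y).
have [x' x'E] := in_sliceP sx; exists x'.
by apply: (hat_eq df _ fj fy); rewrite x'E.
Qed.

Lemma hat_iso i j : is_kgraph_iso (hat_ i j).
Proof.
split; [split; [exact: hat_src|exact: hat_rng|exact: hat_comp]| |exact: hat_deg].
by apply: bij_of_inj_surj; [exact: hat_inj|exact: hat_surj].
Qed.

Lemma hat_comm i j l x : hat_ i j (hat_ (ordS i) l x) = hat_ i l (hat_ (ordS i) j x).
Proof.
have [g gl xg] := hat_edge_ex l x; have [_ [g1 [g1l g1x e1]]] := hatP gl xg.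
have sg : ksrc (val (hat_ (ordS i) l x)) = ksrc g by rewrite -(ksrc_comp g1x) -e1 ksrc_comp.
have [f fj fr] := col2_rng_ex j (is_vertex_src g).
have xf : ksrc (val (hat_ (ordS i) l x)) = krng f by rewrite sg fr.
have [_ [f1 [f1j f1x e2]]] := hatP fj xf.
have dgf : kdeg (kcomp g f) = col2 j + col2 l by rewrite kdeg_comp// gl fj addrC.
have [[f2 g2] [/= [fg2 fgE f2j g2l] _]] := kfactor dgf.
have xf2 : ksrc (val x) = krng f2 by rewrite -(krng_comp fg2) fgE krng_comp.
have [_ [f3 [f3j f3x e3]]] := hatP f2j xf2.
have sf : ksrc (val (hat_ (ordS i) j x)) = krng g2.
  by rewrite -(ksrc_comp f3x) -e3 ksrc_comp.
have [_ [g4 [g4l g4x e4]]] := hatP g2l sf.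
have c1 : ksrc g1 = krng f1 by rewrite g1x -(krng_comp xf) e2 krng_comp.
have c2 : ksrc f3 = krng g4 by rewrite f3x -(krng_comp sf) e4 krng_comp.
set y1 := hat_ i j _ in f1x e2 *; set y2 := hat_ i l _ in g4x e4 *.
have s1 : ksrc (kcomp g1 f1) = krng (val y1) by rewrite ksrc_comp// f1x.
have s2 : ksrc (kcomp f3 g4) = krng (val y2) by rewrite ksrc_comp// g4x.
have e : kcomp (kcomp g1 f1) (val y1) = kcomp (kcomp f3 g4) (val y2).
  rewrite -!kcompA// -e2 -e4 !kcompA// -e1 -e3 -!kcompA// ?fgE//.
have d : kdeg (val y1) = kdeg (val y2) by rewrite !slice1_degE !hat_deg.
by have [_ /val_inj] := kcomp_injr s1 s2 e d.
Qed.

End Slices.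

(** * Crossed products by Z^k *)

Lemma rowZ_ind k (P : 'rV[int]_k -> Prop) : P 0 ->
  (forall j x, P x -> P (delta_mx 0 j + x)) ->
  (forall j x, P x -> P (- delta_mx 0 j + x)) -> forall x, P x.
Proof.
move=> P0 PD PB x; rewrite (row_sum_delta x).
elim/big_rec: _ => // j y _ Py; elim/int_rec: (x 0 j) => [|m IH|m IH].
- by rewrite scale0r add0r.
- by rewrite intS scalerDl scale1r -addrA; exact: PD.
- by rewrite intS opprD scalerDl scaleN1r -addrA; exact: PB.
Qed.

Section CommutingPowers.
Variables (R : realType) (k : nat) (A : cstar_algebra R) (f : 'I_k -> A -> A).

(** The pattern of [rho_action] for an arbitrary family of maps. Applied to left multiplications it
    also yields the powers of commuting unitaries. *)
Definition multi_iter (x : 'rV[int]_k) : A -> A :=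
  \big[(fun f g => f \o g)/id]_(j < k) iterz (f j) (x 0 j).

Hypothesis f_bij : forall j, bijective (f j).
Hypothesis f_comm : forall i j a, f i (f j a) = f j (f i a).

Lemma iterzS j (m : int) a : iterz (f j) (1 + m) a = f j (iterz (f j) m a).
Proof.
case: m => [m|[|m]]; first by rewrite -intS.
  by rewrite /= inv_funKV.
have -> : 1 + Negz m.+1 = Negz m by rewrite !NegzE intS opprD addrA subrr add0r.
by rewrite /= inv_funKV.
Qed.

Lemma iterz_comm i j (m : int) a : iterz (f i) m (f j a) = f j (iterz (f i) m a).
Proof.
case: m => m /=; first by elim: m => //= m ->.
have H b : inv_fun (f i) (f j b) = f j (inv_fun (f i) b).
  by apply: (bij_inj (f_bij i)); rewrite f_comm !inv_funKV.
by elim: m => [|m IH] /=; rewrite ?H// -/(iter m.+1 _ _) -H -IH.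
Qed.

Lemma multi_iter0 a : multi_iter 0 a = a.
Proof. by rewrite /multi_iter; elim/big_rec: _ => //= j g _ /= ->; rewrite mxE. Qed.

(** The composite is ordered by the indices, so f_j must travel past the factors before its own;
    there it raises the exponent by one. Induction runs over the index list, whose lack of
    duplicates leaves the later factors unchanged. *)
Lemma multi_iterS j x a : multi_iter (delta_mx 0 j + x) a = f j (multi_iter x a).
Proof.
rewrite /multi_iter; have := mem_index_enum j; have := index_enum_uniq 'I_k.
elim: (index_enum _) a => //= i r IH a /andP[ir ur]; rewrite !big_cons inE /= !mxE eqxx /=.
have [ji|ji] := eqVneq j i => [_|/=].
  have -> : f j = f i by rewrite ji.
  rewrite mulr1n iterzS; congr (f i (iterz _ _ _)).
  apply: (congr1 (@^~ a)); apply: eq_big_seq => l lr; rewrite !mxE eqxx /=.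
  have -> : (l == j) = false by apply/negbTE/eqP => lj; rewrite -ji -lj lr in ir.
  by rewrite add0r.
by move=> jr; rewrite mulr0n add0r IH// iterz_comm.
Qed.

Lemma multi_iterN j x a : f j (multi_iter (- delta_mx 0 j + x) a) = multi_iter x a.
Proof. by rewrite -multi_iterS addNKr. Qed.

Lemma multi_iter_delta j a : multi_iter (delta_mx 0 j) a = f j a.
Proof. by rewrite -[delta_mx 0 j]addr0 multi_iterS multi_iter0. Qed.

Lemma multi_iterD x y a : multi_iter (x + y) a = multi_iter x (multi_iter y a).
Proof.
elim/rowZ_ind: x => [|j x IH|j x IH]; first by rewrite add0r multi_iter0.
  by rewrite -addrA !multi_iterS IH.
by apply: (bij_inj (f_bij j)); rewrite -addrA !multi_iterN.
Qed.

Lemma multi_iter_action : (forall j, star_iso (f j)) -> is_action multi_iter.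
Proof.
move=> fI; split; [|exact: multi_iter0|exact: multi_iterD].
move=> x; split; last first.
  by exists (multi_iter (- x)) => a; rewrite -multi_iterD ?addNr ?addrN multi_iter0.
elim/rowZ_ind: x => [|j x IH|j x IH].
- by rewrite (_ : multi_iter 0 = id)//; apply/funext => a; exact: multi_iter0.
- rewrite (_ : multi_iter _ = f j \o multi_iter x).
    by apply: star_hom_comp => //; have [] := fI j.
  by apply/funext => a; exact: multi_iterS.
rewrite (_ : multi_iter _ = inv_fun (f j) \o multi_iter x).
  by apply: star_hom_comp => //; have [] := inv_fun_iso (fI j).
by apply/funext => a; rewrite /= -(multi_iterN j x a) inv_funK.
Qed.

End CommutingPowers.

(** * Powers of commuting unitaries and covariant pairs *)

Section UnitaryPowers.
Variables (R : realType) (k : nat) (B : cstar_algebra R) (c : B) (U : 'I_k -> B).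
Hypothesis c_unit : is_identity c.
Hypothesis UV : forall j, amul (U j) (astar (U j)) = c.
Hypothesis VU : forall j, amul (astar (U j)) (U j) = c.
Hypothesis U_comm : forall i j, amul (U i) (U j) = amul (U j) (U i).

Definition unitary_pow (x : 'rV[int]_k) : B := multi_iter (fun j => amul (U j)) x c.

Let mulc a : amul c a = a. Proof. by have [] := c_unit a. Qed.
Let cmul a : amul a c = a. Proof. by have [] := c_unit a. Qed.

Let U_bij j : bijective (amul (U j)).
Proof. by exists (amul (astar (U j))) => a; rewrite amulA ?VU ?UV mulc. Qed.

Let UL_comm i j a : amul (U i) (amul (U j) a) = amul (U j) (amul (U i) a).
Proof. by rewrite !amulA U_comm. Qed.

Lemma unitary_pow0 : unitary_pow 0 = c.
Proof. exact: multi_iter0. Qed.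

Lemma unitary_powS j x : unitary_pow (delta_mx 0 j + x) = amul (U j) (unitary_pow x).
Proof. exact: multi_iterS. Qed.

Lemma unitary_powN j x : unitary_pow (- delta_mx 0 j + x) = amul (astar (U j)) (unitary_pow x).
Proof.
apply: (bij_inj (U_bij j)); rewrite [LHS](multi_iterN U_bij UL_comm j x c).
by rewrite amulA UV mulc.
Qed.

Lemma unitary_powD x y : unitary_pow (x + y) = amul (unitary_pow x) (unitary_pow y).
Proof.
elim/rowZ_ind: x => [|j x IH|j x IH]; first by rewrite add0r unitary_pow0 mulc.
  by rewrite -addrA !unitary_powS IH amulA.
by rewrite -addrA !unitary_powN IH amulA.
Qed.

Lemma unitary_pow_delta j : unitary_pow (delta_mx 0 j) = U j.
Proof. by rewrite -[delta_mx 0 j]addr0 unitary_powS unitary_pow0. Qed.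

Lemma unitary_powNdelta j : unitary_pow (- delta_mx 0 j) = astar (U j).
Proof. by rewrite -[- _]addr0 unitary_powN unitary_pow0. Qed.

Lemma unitary_pow_star x : astar (unitary_pow x) = unitary_pow (- x).
Proof.
elim/rowZ_ind: x => [|j x IH|j x IH].
- by rewrite oppr0 unitary_pow0 -[LHS]mulc -{1}[c]astarK -astarM mulc astarK.
- by rewrite opprD [- _ - x]addrC (unitary_powD (- x)) -IH unitary_powNdelta unitary_powS astarM.
by rewrite opprD opprK [delta_mx 0 j - x]addrC (unitary_powD (- x)) -IH
  unitary_pow_delta unitary_powN astarM astarK.
Qed.

Variables (D : cstar_algebra R) (f : 'I_k -> D -> D) (phi : D -> B).
Hypothesis f_bij : forall j, bijective (f j).
Hypothesis f_comm : forall i j a, f i (f j a) = f j (f i a).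
Hypothesis phi_hom : star_hom phi.
Hypothesis covariant : forall j a, amul (U j) (phi a) = amul (phi (f j a)) (U j).

Lemma unitary_pow_covariant x a :
  amul (unitary_pow x) (phi a) = amul (phi (multi_iter f x a)) (unitary_pow x).
Proof.
elim/rowZ_ind: x a => [|j x IH|j x IH] a.
- by rewrite unitary_pow0 multi_iter0 mulc cmul.
- by rewrite unitary_powS multi_iterS// -amulA IH !amulA covariant.
apply: (bij_inj (U_bij j)); rewrite unitary_powN !amulA UV mulc IH covariant multi_iterN//.
by rewrite -!amulA [amul (U j) _]amulA UV mulc.
Qed.

(** The integrated form of a covariant pair: in a product of two terms, moving U^g past phi(b) costs
    one application of the action. *)
Lemma covariant_convolution_family :
  convolution_family (multi_iter f) (fun g a => amul (phi a) (unitary_pow g)).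
Proof.
have [pl pm ps] := phi_hom; split=> [g z a b|g h a b|g a].
- by rewrite pl amulDl amulZl.
- by rewrite pm unitary_powD !amulA -[amul (amul _ _) (phi b)]amulA unitary_pow_covariant !amulA.
- by rewrite astarM unitary_pow_star -ps unitary_pow_covariant.
Qed.

End UnitaryPowers.

Section CrossedProductTheory.
Variables (R : realType) (G : zmodType).

Lemma convolution_star_hom (D B : cstar_algebra R) (alpha : G -> D -> D) (T : G -> D -> B) :
  (forall a, alpha 0 a = a) -> convolution_family alpha T -> star_hom (T 0).
Proof.
move=> a0 [Tl Tm Ts]; split=> [||a]; first exact: Tl.
  by move=> a b; rewrite Tm addr0 a0.
by rewrite Ts oppr0 a0.
Qed.

Lemma crossed_product_ext (D P B : cstar_algebra R) (alpha : G -> D -> D)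
    (iota : G -> D -> P) (T : G -> D -> B) (f g : P -> B) :
  is_crossed_product alpha iota -> convolution_family alpha T ->
  star_hom f -> star_hom g ->
  (forall x a, f (iota x a) = T x a) -> (forall x a, g (iota x a) = T x a) -> f =1 g.
Proof.
move=> [_ _ Pu] TC fh gh fT gT a; have [h [_ hu]] := Pu _ _ TC.
by rewrite -(hu f)// -(hu g).
Qed.

(** The map a delta_g -> f(a) delta_g respects convolution and star for the two actions, so each
    crossed product carries a family for the other; the induced maps are mutually inverse on the
    canonical elements. *)
Lemma crossed_product_transport (D E P Q : cstar_algebra R) (f : D -> E)
    (alpha : G -> D -> D) (iota : G -> D -> P) (kappa : G -> E -> Q) :
  star_iso f -> is_crossed_product alpha iota ->
  is_crossed_product (transport f alpha) kappa -> star_isomorphic P Q.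
Proof.
move=> fI PX QX; have [fh fb] := fI; have [gh _] := inv_fun_iso fI.
have [[fl fm fs] [gl gm gs]] := (fh, gh).
have [fK gK] := (inv_funK fb, inv_funKV fb).
have [Pc _ Pu] := PX; have [Qc _ Qu] := QX.
have c1 : convolution_family alpha (fun g a => kappa g (f a)).
  split=> [g z a b|g h a b|g a].
  - by rewrite fl (conv_linear Qc).
  - by rewrite (conv_mul Qc) /transport fm fK.
  - by rewrite (conv_star Qc) /transport -fs fK.
have c2 : convolution_family (transport f alpha) (fun g b => iota g (inv_fun f b)).
  split=> [g z a b|g h a b|g a].
  - by rewrite gl (conv_linear Pc).
  - by rewrite (conv_mul Pc) /transport gm fK.
  - by rewrite (conv_star Pc) /transport fK gs.
have [u [[uh uE] _]] := Pu _ _ c1; have [v [[vh vE] _]] := Qu _ _ c2.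
exists u; split=> //; exists v.
  apply: (crossed_product_ext PX Pc (star_hom_comp uh vh) (star_hom_id P)) => //= x a.
  by rewrite uE vE fK.
apply: (crossed_product_ext QX Qc (star_hom_comp vh uh) (star_hom_id Q)) => //= x a.
by rewrite vE uE gK.
Qed.

End CrossedProductTheory.

(** * Homomorphisms from finite direct sums *)

Section DirectSumTheory.
Variables (R : realType) (I : finType) (A : I -> cstar_algebra R).

Definition dsum_in (i : I) (a : A i) : dsum A := dfwith (fun i => 0 : A i) i a.

Lemma dsum_addE (a b : dsum A) i : (a + b) i = a i + b i. Proof. by []. Qed.
Lemma dsum_scaleE (z : R[i]) (a : dsum A) i : (z *: a) i = z *: a i. Proof. by []. Qed.
Lemma dsum_mulE (a b : dsum A) i : amul a b i = amul (a i) (b i). Proof. by []. Qed.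
Lemma dsum_starE (a : dsum A) i : astar a i = astar (a i). Proof. by []. Qed.

Lemma dsum_ext (a b : dsum A) : (forall i, a i = b i) -> a = b.
Proof. by move=> ab; apply: functional_extensionality_dep. Qed.

Lemma dsum_sumE (J : Type) (r : seq J) (F : J -> dsum A) i :
  (\sum_(j <- r) F j) i = \sum_(j <- r) F j i.
Proof. by elim: r => [|j r IH]; rewrite ?big_nil// !big_cons dsum_addE IH. Qed.

Lemma dsum_inE i (a : A i) : dsum_in a i = a.
Proof. exact: dfwithin. Qed.

Lemma dsum_in0 i i' (a : A i) : i != i' -> dsum_in a i' = 0.
Proof. exact: dfwithout. Qed.

Lemma dsum_in_hom i : star_hom (@dsum_in i).
Proof.
split=> [z a b|a b|a]; apply: dsum_ext => i';
  rewrite ?dsum_addE ?dsum_scaleE ?dsum_mulE ?dsum_starE.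
- by have [<-|ii'] := eqVneq i i'; rewrite ?dsum_inE ?dsum_in0// scaler0 addr0.
- by have [<-|ii'] := eqVneq i i'; rewrite ?dsum_inE ?dsum_in0// amul0l.
- by have [<-|ii'] := eqVneq i i'; rewrite ?dsum_inE ?dsum_in0// astar0.
Qed.

Lemma dsum_in_orth i i' (a : A i) (b : A i') : i != i' ->
  amul (dsum_in a) (dsum_in b) = 0.
Proof.
move=> ii'; apply: dsum_ext => l; rewrite dsum_mulE.
have [il|il] := eqVneq i l; last by rewrite dsum_in0// amul0l.
by rewrite (dsum_in0 b) ?amul0r// -il eq_sym.
Qed.

Lemma dsum_sum_in (a : dsum A) : a = \sum_i dsum_in (a i).
Proof.
apply: dsum_ext => i; rewrite dsum_sumE (bigD1 i)//= dsum_inE big1 ?addr0// => l li.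
by rewrite dsum_in0.
Qed.

Lemma dsum_ext_hom (B : cstar_algebra R) (f g : dsum A -> B) :
  star_hom f -> star_hom g ->
  (forall i (a : A i), f (dsum_in a) = g (dsum_in a)) -> f =1 g.
Proof.
move=> fh gh fg a; rewrite (dsum_sum_in a) !star_hom_sum//.
by apply: eq_bigr => i _; exact: fg.
Qed.

Lemma dsum_hom (B : cstar_algebra R) (f : forall i, A i -> B) :
  (forall i, star_hom (@f i)) ->
  (forall i i' (a : A i) (b : A i'), i != i' -> amul (f i a) (f i' b) = 0) ->
  star_hom (fun a : dsum A => \sum_i f i (a i)).
Proof.
move=> fh fo; split=> [z a b|a b|a].
- rewrite scaler_sumr -big_split; apply: eq_bigr => i _ /=.
  by rewrite dsum_addE dsum_scaleE; have [-> _ _] := fh i.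
- rewrite amul_suml; apply: eq_bigr => i _; rewrite amul_sumr (bigD1 i)//= big1 ?addr0.
    by have [_ -> _] := fh i.
  by move=> l li; rewrite fo// eq_sym.
- by rewrite astar_sum; apply: eq_bigr => i _; rewrite dsum_starE; have [_ _ ->] := fh i.
Qed.

Lemma dsum_in_hom_sum (B : cstar_algebra R) (f : forall i, A i -> B) i (a : A i) :
  (forall i, star_hom (@f i)) -> \sum_l f l (dsum_in a l) = f i a.
Proof.
move=> fh; rewrite (bigD1 i)//= dsum_inE big1 ?addr0// => l li.
by rewrite dsum_in0 ?star_hom0// eq_sym.
Qed.

End DirectSumTheory.

Lemma dsum_map_iso (R : realType) n (A B : 'I_n -> cstar_algebra R)
    (f : forall i, A i -> B i) : (forall i, star_iso (f i)) -> star_iso (dsum_map f).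
Proof.
move=> fI; split; first split=> [z a b|a b|a].
- by apply: dsum_ext => i; rewrite /dsum_map !dsum_addE !dsum_scaleE; have [[-> _ _] _] := fI i.
- by apply: dsum_ext => i; rewrite /dsum_map !dsum_mulE; have [[_ -> _] _] := fI i.
- by apply: dsum_ext => i; rewrite /dsum_map !dsum_starE; have [[_ _ ->] _] := fI i.
exists (fun b i => inv_fun (f i) (b i)) => a; apply: dsum_ext => i; rewrite /dsum_map.
  by rewrite inv_funK//; have [] := fI i.
by rewrite inv_funKV//; have [] := fI i.
Qed.

(** * Gluing Cuntz-Krieger families on the slices *)

Lemma delta_rowN_inj k : injective (fun p : 'I_k => delta_mx 0 p : 'rV[nat]_k).
Proof.
by move=> p q /matrixP/(_ 0 p); rewrite !mxE !eqxx /=; have [->|] := eqVneq p q.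
Qed.

(** Used for CK2: the two sides of a square ef = f'e' have their colours in the same order, and then
    coincide, or in swapped order. *)
Lemma delta_rowN_add k (p q p' q' : 'I_k) :
  delta_mx 0 p + delta_mx 0 q = delta_mx 0 p' + delta_mx 0 q' :> 'rV[nat]_k ->
  p = p' /\ q = q' \/ p = q' /\ q = p'.
Proof.
move=> e; have [pp'|pp'] := eqVneq p p'.
  by left; split=> //; rewrite pp' in e; move/rowN_addIr/delta_rowN_inj: e.
have [pq'|pq'] := eqVneq p q'.
  by right; split=> //; rewrite [RHS]addrC pq' in e; move/rowN_addIr/delta_rowN_inj: e.
by have /matrixP/(_ 0 p) := e; rewrite !mxE !eqxx /= (negbTE pp') (negbTE pq').
Qed.

Section Glue.
Variables (R : realType) (k1 k2 n : nat).
Variables (L : kgraph k1) (M : kgraph k2) (O : kgraph (k1 + k2)).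
Variable Phi : cdigraph_iso (skeleton (prod_kgraph L M)) (skeleton O).
Variable C : cdigraph_iso (cycle_cdigraph n k2) (skeleton M).

Local Notation sl i := (slice1 Phi (cyc_vert C i)).
Local Notation col1 a := (delta_mx 0 (lshift k2 a)).
Local Notation col2 j := (delta_mx 0 (rshift k1 j)).

Lemma slice_lift (x : O) : rsubmx (kdeg x) = 0 -> exists i (y : sl i), val y = x.
Proof. by move=> /(cyc_slice_ex Phi C)[i /in_sliceP[y yx]]; exists i, y. Qed.

Lemma slice_lift_vertex (x : O) : is_vertex x ->
  exists i (y : sl i), val y = x /\ is_vertex y.
Proof.
move=> xv; have [|i [y yx]] := @slice_lift x; first by rewrite (eqP xv) rsubmx_nat0.
by exists i, y; split=> //; rewrite -slice1_is_vertex yx.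
Qed.

Lemma slice_lift_edge (x : O) a : kdeg x = col1 a ->
  exists i (y : sl i), val y = x /\ kdeg y = delta_mx 0 a.
Proof.
move=> xa; have [|i [y yx]] := @slice_lift x; first by rewrite xa -delta_lshift row_mxKr.
exists i, y; split=> //; have := slice1_degE y.
by rewrite yx xa -delta_lshift => /eq_row_mx[].
Qed.

Lemma slice_same i (y : sl i) l (z : sl l) : ksrc (val y) = krng (val z) ->
  exists z' : sl i, val z' = val z.
Proof.
move=> yz; apply: in_sliceP; apply/in_slice_rng; first exact: in_slice_deg (in_slice_val z).
rewrite -yz; apply/in_slice_src; last exact: in_slice_val.
exact: in_slice_deg (in_slice_val y).
Qed.

Variables (B : cstar_algebra R) (T : O -> B).
Hypothesis T_slice : forall i, ck_family (fun x : sl i => T (val x)).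
Hypothesis T_orth : forall i l (u : sl i) (v : sl l), is_vertex u -> is_vertex v ->
  i <> l -> amul (T (val u)) (T (val v)) = 0.
Hypothesis T_final : forall j (f : O), kdeg f = col2 j ->
  amul (T f) (astar (T f)) = T (krng f).
Hypothesis T_initial : forall j (f : O), kdeg f = col2 j ->
  amul (astar (T f)) (T f) = T (ksrc f).
Hypothesis T_rng : forall j (f : O), kdeg f = col2 j -> amul (T (krng f)) (T f) = T f.
Hypothesis T_comm12 : forall a j (e f f' e' : O),
  kdeg e = col1 a -> kdeg f = col2 j -> kdeg f' = col2 j -> kdeg e' = col1 a ->
  ksrc e = krng f -> ksrc f' = krng e' -> kcomp e f = kcomp f' e' ->
  amul (T e) (T f) = amul (T f') (T e').
Hypothesis T_comm22 : forall j l (e f f' e' : O),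
  kdeg e = col2 j -> kdeg f = col2 l -> kdeg f' = col2 l -> kdeg e' = col2 j ->
  ksrc e = krng f -> ksrc f' = krng e' -> kcomp e f = kcomp f' e' ->
  amul (T e) (T f) = amul (T f') (T e').

Lemma edge_cases (e : O) : is_edge e ->
  (exists a, kdeg e = col1 a) \/ (exists j, kdeg e = col2 j).
Proof.
move=> /is_edgeP[q ->]; case: (split_ordP q) => [a ->|j ->]; first by left; exists a.
by right; exists j.
Qed.

(** Relations among colours of the first factor take place inside a slice. For a cycle colour the
    sum in CK4 has a single term, so [T_final] is that relation, and with [T_rng] it makes T f a
    partial isometry. What remains is CK2 for squares involving a cycle colour. *)
Lemma ck_family_glue : ck_family T.
Proof.
split.
- move=> x /orP[xv|/edge_cases[[a xa]|[j xj]]].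
  + have [i [y [<- yv]]] := slice_lift_vertex xv.
    exact: (ck_pisometry (T_slice i) (is_generator_vertex yv)).
  + have [i [y [<- /deg_is_edge ya]]] := slice_lift_edge xa.
    exact: (ck_pisometry (T_slice i) (is_generator_edge ya)).
  + by rewrite (T_final xj) (T_rng xj).
- by move=> v vv; have [i [y [<- yv]]] := slice_lift_vertex vv; exact: (ck1_proj (T_slice i)).
- move=> v w vv ww vw; have [i [y [yE yv]]] := slice_lift_vertex vv.
  have [l [z [zE zw]]] := slice_lift_vertex ww; rewrite -yE -zE in vw *.
  have [il|/eqP il] := eqVneq i l; last exact: T_orth.
  by case: l / il z zE zw vw => z _ zw vw; apply: (ck1_orth (T_slice i)) => // yz; rewrite yz in vw.
- move=> e f f' e' /is_edgeP[p ep] /is_edgeP[q fq] /is_edgeP[p' fp'] /is_edgeP[q' eq'] ef fe cE.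
  have := kdeg_comp ef; rewrite cE kdeg_comp// ep fq fp' eq' => /delta_rowN_add[[pp qq]|[pp qq]].
    by have [|-> ->] := kcomp_inj ef fe cE _ => //; rewrite ep fp' pp.
  subst p' q'; case: (split_ordP p) ep eq' => [a ->|j ->] ep eq';
    case: (split_ordP q) fq fp' => [b ->|l ->] fq fp'.
  (* Both colours belong to the first factor: composable edges of such colours share a slice, so all
     four edges are lifted to the slice of e. *)
  + have [i [ye [yeE /deg_is_edge yea]]] := slice_lift_edge ep.
    have lift_edge (l : 'I_n) (z : sl i) c : kdeg (val z) = col1 c -> is_edge z.
      by rewrite slice1_degE -delta_lshift => /eq_row_mx[/deg_is_edge].
    have [i1 [yf0 [yf0E _]]] := slice_lift_edge fq.
    have [yf yfE] : exists y : sl i, val y = f.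
      by rewrite -yf0E; apply: (@slice_same _ ye); rewrite yeE yf0E.
    have [yf' yf'E] : exists y : sl i, val y = f'.
      apply: in_sliceP; apply/in_slice_rng; first by rewrite fp' -delta_lshift row_mxKr.
      rewrite -(krng_comp fe) -cE krng_comp// -yeE; apply/in_slice_rng; last exact: in_slice_val.
      exact: in_slice_deg (in_slice_val ye).
    have [i2 [ye0 [ye0E _]]] := slice_lift_edge eq'.
    have [ye' ye'E] : exists y : sl i, val y = e'.
      by rewrite -ye0E; apply: (@slice_same _ yf'); rewrite yf'E ye0E.
    have yfe : is_edge yf by apply: (lift_edge i _ b); rewrite yfE.
    have yfe' : is_edge yf' by apply: (lift_edge i _ b); rewrite yf'E.
    have yee' : is_edge ye' by apply: (lift_edge i _ a); rewrite ye'E.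
    have s1 : ksrc ye = krng yf.
      by apply: val_inj; rewrite slice1_srcE slice1_rngE yeE yfE ef.
    have s2 : ksrc yf' = krng ye'.
      by apply: val_inj; rewrite slice1_srcE slice1_rngE yf'E ye'E fe.
    have s3 : kcomp ye yf = kcomp yf' ye'.
      by apply: val_inj; rewrite (slice1_compE s1) (slice1_compE s2) yeE yfE yf'E ye'E cE.
    have := ck2 (T_slice i) yea yfe yfe' yee' s1 s2 s3.
    by rewrite yeE yfE yf'E ye'E.
  + exact: T_comm12 ep fq fp' eq' ef fe cE.
  + by apply/esym; apply: T_comm12 fp' eq' ep fq fe ef (esym cE).
  + exact: T_comm22 ep fq fp' eq' ef fe cE.
- move=> e /edge_cases[[a ea]|[j ej]]; last exact: T_initial ej.
  have [i [y [<- /deg_is_edge ya]]] := slice_lift_edge ea.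
  by rewrite (ck3 (T_slice i) ya).
move=> v q vv; case: (split_ordP q) => [a ->|j ->].
  have [i [y [<- yv]]] := slice_lift_vertex vv; rewrite (ck4 (T_slice i) a yv).
  apply/esym; apply: reindex_fsbig; split; last exact: slice1_out_surj.
    move=> x [xy xa]; split; first by rewrite -slice1_rngE xy.
    by rewrite slice1_degE xa delta_lshift.
  by move=> x z _ _; exact: val_inj.
have [f fj fv] := col2_rng_ex Phi C j vv.
have -> : out_set v (col2 j) = [set f].
  apply/seteqP; split=> [g [gv gj]|g ->] /=; last by split.
  by apply: (col2_rng_inj Phi C gj fj); rewrite gv fv.
by rewrite fsbig_set1 (T_final fj) fv.
Qed.

End Glue.

(** * The action rho *)

Section Rho.
Variables (R : realType) (k1 k2 n : nat).
Variables (L : kgraph k1) (M : kgraph k2) (O : kgraph (k1 + k2)).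
Variable Phi : cdigraph_iso (skeleton (prod_kgraph L M)) (skeleton O).
Variable C : cdigraph_iso (cycle_cdigraph n k2) (skeleton M).

Local Notation sl i := (slice1 Phi (cyc_vert C i)).
Local Notation hat_ i j := (hat Phi (cyc_path C i j)).

Variables (A : 'I_n -> cstar_algebra R) (S : forall i, sl i -> A i).
Arguments S : clear implicits.
Hypothesis SA : forall i, is_graph_algebra (S i).

Lemma rho_exists : exists rho : forall (i : 'I_n) (j : 'I_k2), A (ordS i) -> A i,
  forall i j, induced_by_kgraph_iso (S (ordS i)) (S i) (hat_ i j) (rho i j).
Proof.
apply: (@dependent_choice _ (fun i => 'I_k2 -> A (ordS i) -> A i)
  (fun i r => forall j, induced_by_kgraph_iso (S (ordS i)) (S i) (hat_ i j) (r j))) => i.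
apply: (@dependent_choice _ (fun j => A (ordS i) -> A i)
  (fun j r => induced_by_kgraph_iso (S (ordS i)) (S i) (hat_ i j) r)) => j.
exact: graph_algebra_iso (hat_iso Phi C i j) (SA i).
Qed.

Variable rho : forall (i : 'I_n) (j : 'I_k2), A (ordS i) -> A i.
Arguments rho : clear implicits.
Hypothesis rhoP : forall i j, induced_by_kgraph_iso (S (ordS i)) (S i) (hat_ i j) (rho i j).

Lemma rho_iso i j : star_iso (rho i j).
Proof. by have [] := rhoP i j. Qed.

Lemma rho_hom i j : star_hom (rho i j).
Proof. by have [] := rho_iso i j. Qed.

Lemma rho_genE i j x : is_generator x -> rho i j (S (ordS i) x) = S i (hat_ i j x).
Proof. by have [_ _ H] := rhoP i j; exact: H. Qed.

Lemma rho_gen_in j i (a : A (ordS i)) :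
  rho_gen rho j (dsum_in a) = dsum_in (rho i j a).
Proof.
apply: dsum_ext => l; rewrite /rho_gen; have [il|il] := eqVneq i l.
  by case: l / il; rewrite !dsum_inE.
rewrite !dsum_in0 ?star_hom0//; first exact: rho_hom.
by apply: contra_neq il => /ordS_inj.
Qed.

Lemma rho_gen_hom j : star_hom (rho_gen rho j).
Proof.
split=> [z a b|a b|a]; apply: dsum_ext => i; rewrite /rho_gen.
- by rewrite !dsum_addE !dsum_scaleE; have [-> _ _] := rho_hom i j.
- by rewrite !dsum_mulE; have [_ -> _] := rho_hom i j.
- by rewrite !dsum_starE; have [_ _ ->] := rho_hom i j.
Qed.

Lemma rho_gen_iso j : star_iso (rho_gen rho j).
Proof.
split; first exact: rho_gen_hom.
apply: bij_of_inj_surj => [a b ab|b].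
  apply: dsum_ext => i; rewrite -(ord_predK i); set l := ord_pred i.
  have [_ /bij_inj] := rho_iso l j; apply; exact: (congr1 (fun c : dsum A => c l) ab).
(* The preimage is assembled with [dsum_in] at the indices [ordS i]; a componentwise formula would
   need a cast along [ord_predK]. *)
exists (\sum_i dsum_in (inv_fun (rho i j) (b i))).
rewrite star_hom_sum; last exact: rho_gen_hom.
rewrite [RHS]dsum_sum_in; apply: eq_bigr => i _.
by rewrite rho_gen_in inv_funKV//; have [] := rho_iso i j.
Qed.

(** By uniqueness for the algebra of the slice two steps ahead it suffices to look at generators,
    where this is [hat_comm]. *)
Lemma rho_gen_comm j l a : rho_gen rho j (rho_gen rho l a) = rho_gen rho l (rho_gen rho j a).
Proof.
apply: dsum_ext => i; rewrite /rho_gen.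
have hI p q : is_kgraph_iso (fun x => hat_ i p (hat_ (ordS i) q x)).
  exact: kgraph_iso_comp (hat_iso Phi C (ordS i) q) (hat_iso Phi C i p).
have SCK : ck_family (S i) by have [] := SA i.
have hg p q x : is_generator x -> is_generator (hat_ p q x).
  by rewrite (kgraph_iso_generator _ (hat_iso Phi C p q)).
apply: (graph_algebra_ext (SA (ordS (ordS i))) (ck_family_iso (hI j l) SCK)
  (f := fun a => rho i j (rho (ordS i) l a)) (g := fun a => rho i l (rho (ordS i) j a))).
- exact: star_hom_comp (rho_hom (ordS i) l) (rho_hom i j).
- exact: star_hom_comp (rho_hom (ordS i) j) (rho_hom i l).
- by move=> x xg; rewrite (rho_genE _ xg) (rho_genE _ (hg (ordS i) l x xg)).
move=> x xg; rewrite (rho_genE _ xg) (rho_genE _ (hg (ordS i) j x xg)).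
by rewrite hat_comm.
Qed.

Lemma rho_actionE : rho_action rho = multi_iter (rho_gen rho).
Proof. by []. Qed.

Lemma rho_action_is_action : is_action (rho_action rho).
Proof.
rewrite rho_actionE; apply: multi_iter_action.
- by move=> j; have [] := rho_gen_iso j.
- exact: rho_gen_comm.
- exact: rho_gen_iso.
Qed.

Lemma rho_action_delta j a : rho_action rho (delta_mx 0 j) a = rho_gen rho j a.
Proof.
apply: multi_iter_delta; last exact: rho_gen_comm.
by move=> l; have [] := rho_gen_iso l.
Qed.

Hypothesis qp : quasi_product Phi.
Hypothesis k2_gt0 : (0 < k2)%N.

(** [quasi_product] provides one slice isomorphic to [L]. Composing with the isomorphisms [hat] of
    any one colour carries this around the cycle. *)
Lemma slice_iso_factor i : exists theta : sl i -> L, is_kgraph_iso theta.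
Proof.
have [_ _ [v [theta0 thI]] _] := qp; have [g _ gK] := isoV_bij C.
have : exists theta : sl (g v) -> L, is_kgraph_iso theta.
  by rewrite /cyc_vert gK; exists theta0.
move: (g v) => i0 {v theta0 thI g gK} th0.
have step l : (exists theta : sl l -> L, is_kgraph_iso theta) ->
    exists theta : sl (ordS l) -> L, is_kgraph_iso theta.
  case=> th thI; exists (th \o hat_ l (Ordinal k2_gt0)).
  exact: kgraph_iso_comp (hat_iso _ _ _ _) thI.
have it m : exists theta : sl (iter m (@ordS n) i0) -> L, is_kgraph_iso theta.
  by elim: m => [|m IH] //=; exact: step.
suff [m ->] : exists m, i = iter m (@ordS n) i0 by exact: it.
(* The number of forward steps from i0 to i, up to a full turn; adding n keeps the subtraction from
   truncating. *)
exists (i + n - i0)%N; apply: val_inj.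
have itE m : val (iter m (@ordS n) i0) = ((i0 + m) %% n)%N.
  elim: m => [|m IH]; first by rewrite addn0 modn_small.
  by rewrite iterS /= IH -addn1 modnDml addn1 addnS.
rewrite itE subnKC ?modnDr ?modn_small//.
by rewrite (leq_trans (ltnW (ltn_ord i0)))// leq_addl.
Qed.

End Rho.

(** * From the graph algebra to the crossed product *)

Section GraphToCrossed.
Variables (R : realType) (k1 k2 n : nat).
Variables (L : kgraph k1) (M : kgraph k2) (O : kgraph (k1 + k2)).
Variable Phi : cdigraph_iso (skeleton (prod_kgraph L M)) (skeleton O).
Variable C : cdigraph_iso (cycle_cdigraph n k2) (skeleton M).

Local Notation sl i := (slice1 Phi (cyc_vert C i)).
Local Notation col1 a := (delta_mx 0 (lshift k2 a)).
Local Notation col2 j := (delta_mx 0 (rshift k1 j)).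
Local Notation hat_ i j := (hat Phi (cyc_path C i j)).
Local Notation del j := (delta_mx 0 j).

Variables (A : 'I_n -> cstar_algebra R) (S : forall i, sl i -> A i).
Arguments S : clear implicits.
Hypothesis SA : forall i, is_graph_algebra (S i).
Hypothesis rfO : row_finite O.

(** Extended by zero off the slice, so that formulas on [O] need not name the slice of an
    element. *)
Definition slice_emb i (x : O) : A i :=
  if pselect (in_slice Phi (cyc_vert C i) x) is left xi
  then S i (exist _ x (asboolT xi)) else 0.

Lemma slice_embE i (y : sl i) : slice_emb i (val y) = S i y.
Proof.
rewrite /slice_emb; case: pselect => [yi|/(_ (in_slice_val y))//].
by congr (S i _); apply: val_inj.
Qed.

Lemma slice_emb0 i l (y : sl l) : l != i -> slice_emb i (val y) = 0.
Proof.
move=> li; rewrite /slice_emb; case: pselect => // yi; case/eqP: li.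
exact: cyc_slice_inj (in_slice_val y) yi.
Qed.

Definition emb (x : O) : dsum A := fun i => slice_emb i x.

Lemma embE i (y : sl i) : emb (val y) = dsum_in (S i y).
Proof.
apply: dsum_ext => l; rewrite /emb; have [il|il] := eqVneq i l.
  by case: l / il; rewrite dsum_inE slice_embE.
by rewrite dsum_in0// slice_emb0.
Qed.

Lemma emb_proj v : is_vertex v -> is_proj (emb v).
Proof.
move=> /(slice_lift_vertex Phi C)[i [y [<- yv]]]; rewrite embE.
have [_ dm ds] := dsum_in_hom A i; have [SCK _ _] := SA i.
by have [s p] := ck_vertex_proj SCK yv; split; rewrite -?ds -?dm ?s ?p.
Qed.

Variable rho : forall (i : 'I_n) (j : 'I_k2), A (ordS i) -> A i.
Arguments rho : clear implicits.
Hypothesis rhoP : forall i j, induced_by_kgraph_iso (S (ordS i)) (S i) (hat_ i j) (rho i j).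

(** A form of [rho_genE] without slice indices, since the squares of CK2 consist of elements of [O].
    The slice of x is found from that of y, one step along the cycle. *)
Lemma rho_emb j (x y f f' : O) : is_generator x -> rsubmx (kdeg x) = 0 ->
  rsubmx (kdeg y) = 0 -> kdeg f = col2 j -> kdeg f' = col2 j ->
  ksrc x = krng f' -> ksrc f = krng y -> kcomp x f' = kcomp f y ->
  rho_gen rho j (emb x) = emb y.
Proof.
move=> xg x0 y0 fj f'j xf fy e; have [i [y' y'E]] := slice_lift Phi C y0.
have [x' x'E] : exists x' : sl (ordS i), val x' = x.
  apply: in_sliceP; apply/in_slice_rng => //.
  rewrite -(krng_comp xf) e krng_comp//; apply/(col2_slice _ _ _ fj).
  by rewrite fy; apply/in_slice_rng => //; rewrite -y'E; exact: in_slice_val.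
have x'g : is_generator x'.
  rewrite -x'E in xg; move: xg; rewrite /is_generator slice1_is_vertex.
  case/orP => [->//|/edge_cases[[a xa]|[l xl]]].
    apply/orP; right; apply: (@deg_is_edge _ _ _ a).
    by move: xa; rewrite slice1_degE -delta_lshift => /eq_row_mx[].
  have := slice1_degE x'; rewrite xl -delta_rshift => /eq_row_mx[_] /matrixP/(_ 0 l).
  by rewrite !mxE !eqxx.
have hx : hat_ i j x' = y'.
  by apply: (hat_eq f'j _ fj); rewrite ?x'E ?y'E.
by rewrite -x'E -y'E !embE (rho_gen_in rhoP) (rho_genE rhoP)// hx.
Qed.

Lemma rho_emb_src j (f : O) : kdeg f = col2 j ->
  rho_gen rho j (emb (krng f)) = emb (ksrc f).
Proof.
move=> fj; apply: (rho_emb _ _ _ fj fj); rewrite ?ksrc_rng ?krng_src ?kcomp_idl ?kcomp_idr//.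
- exact/is_generator_vertex/is_vertex_rng.
- by rewrite kdeg_rng rsubmx_nat0.
- by rewrite kdeg_src rsubmx_nat0.
Qed.

Local Notation alpha := (rho_action rho).

Lemma alphaK j a : alpha (- del j) (alpha (del j) a) = a.
Proof.
have [_ a0 aD] := rho_action_is_action SA rhoP.
by rewrite -aD addNr a0.
Qed.

Lemma alpha_emb_src j (f : O) : kdeg f = col2 j ->
  alpha (- del j) (emb (ksrc f)) = emb (krng f).
Proof. by move=> fj; rewrite -(rho_emb_src fj) -(rho_action_delta SA rhoP) alphaK. Qed.

Variables (P : cstar_algebra R) (iota : 'rV[int]_k2 -> dsum A -> P).
Hypothesis PC : convolution_family alpha iota.

Lemma iota0_in_hom i : star_hom (fun a : A i => iota 0 (dsum_in a)).
Proof.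
have [_ a0 _] := rho_action_is_action SA rhoP.
exact: star_hom_comp (dsum_in_hom A i) (convolution_star_hom a0 PC).
Qed.

(* Only meaningful on vertices and edges; the second branch is the value at an
   edge whose colour belongs to the cycle factor. *)
Definition crossed_family (x : O) : P :=
  if rsubmx (kdeg x) == 0 then iota 0 (emb x)
  else iota (- map_mx Posz (rsubmx (kdeg x))) (emb (krng x)).

Lemma crossed_family1 x : rsubmx (kdeg x) = 0 -> crossed_family x = iota 0 (emb x).
Proof. by move=> x0; rewrite /crossed_family x0 eqxx. Qed.

Lemma crossed_family2 j (f : O) : kdeg f = col2 j ->
  crossed_family f = iota (- del j) (emb (krng f)).
Proof.
move=> fj; rewrite /crossed_family fj -delta_rshift row_mxKr ifF; last first.
  by apply/negP => /eqP/matrixP/(_ 0 j); rewrite !mxE !eqxx.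
by congr (iota (- _) _); apply/matrixP => a b; rewrite !mxE; case: (_ && _).
Qed.

Lemma crossed_family_slice i (y : sl i) :
  crossed_family (val y) = iota 0 (dsum_in (S i y)).
Proof. by rewrite crossed_family1 ?embE//; exact: in_slice_deg (in_slice_val y). Qed.

(** For f of colour j, alpha_{-e_j} sends S_{s(f)} to S_{r(f)}. With this rule the convolution
    formulas turn the hypotheses of [ck_family_glue] into identities in the direct sum. *)
Lemma crossed_family_ck : ck_family crossed_family.
Proof.
have [aI a0 aD] := rho_action_is_action SA rhoP.
apply: (@ck_family_glue _ _ _ _ _ _ _ Phi C).
- move=> i; have [SCK _ _] := SA i.
  have := ck_family_hom (slice1_row_finite rfO) SCK (iota0_in_hom i).
  by congr ck_family; apply/funext => y; rewrite crossed_family_slice.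
- move=> i l u v uv vv /eqP il; rewrite !crossed_family_slice (conv_mul PC) a0.
  by rewrite dsum_in_orth// star_hom0// addr0; exact: convolution_star_hom a0 PC.
- move=> j f fj; rewrite (crossed_family2 fj) (crossed_family1 (x := krng f)).
    have [es ep] := emb_proj (is_vertex_rng f).
    by rewrite (conv_star PC) opprK (conv_mul PC) -aD addNr a0 es ep.
  by rewrite kdeg_rng rsubmx_nat0.
(* The adjoint of iota(-e_j)(S_{r(f)}) is iota(e_j)(rho_j(S_{r(f)})), which is why the initial
   projection sits at s(f). *)
- move=> j f fj; rewrite (crossed_family2 fj) (crossed_family1 (x := ksrc f)).
    have [es ep] := emb_proj (is_vertex_rng f); have [[_ am _] _] := aI (del j).
    rewrite (conv_star PC) opprK (conv_mul PC) -am es ep subrr.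
    by rewrite (rho_action_delta SA rhoP) rho_emb_src.
  by rewrite kdeg_src rsubmx_nat0.
- move=> j f fj; rewrite (crossed_family2 fj) (crossed_family1 (x := krng f)).
    by have [_ ep] := emb_proj (is_vertex_rng f); rewrite (conv_mul PC) a0 add0r ep.
  by rewrite kdeg_rng rsubmx_nat0.
- move=> a j e f f' e' ea fj f'j e'a ef fe cE.
  have e0 : rsubmx (kdeg e) = 0 by rewrite ea -delta_lshift row_mxKr.
  have e'0 : rsubmx (kdeg e') = 0 by rewrite e'a -delta_lshift row_mxKr.
  have eg : is_generator e := is_generator_edge (deg_is_edge ea).
  (* By rho_j(S_e) = S_{e'}, one side becomes S_{r(e)} S_e and the other S_e S_{s(e)}; both are
     S_e. *)
  have ee' := rho_emb eg e0 e'0 f'j fj ef fe cE.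
  rewrite (crossed_family1 e0) (crossed_family1 e'0) (crossed_family2 fj) (crossed_family2 f'j).
  rewrite !(conv_mul PC) a0 add0r addr0 -ee' -(rho_action_delta SA rhoP) alphaK.
  rewrite -ef -(krng_comp fe) -cE krng_comp//; congr (iota _ _).
  have [i [y [yE ya]]] := slice_lift_edge Phi C ea.
  have yg : is_generator y := is_generator_edge (deg_is_edge ya).
  have [_ dm _] := dsum_in_hom A i; have [SCK _ _] := SA i.
  rewrite -yE -slice1_srcE -slice1_rngE !embE -!dm ck_mul_src// ck_mul_rng//.
  exact: slice1_row_finite.
(* A product of two cycle edges depends only on its range and on the unordered pair of colours. *)
have mul22 j l (e f : O) : kdeg e = col2 j -> kdeg f = col2 l -> ksrc e = krng f ->
    amul (crossed_family e) (crossed_family f) = iota (- del j - del l) (emb (krng e)).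
  move=> ej fl ef; rewrite (crossed_family2 ej) (crossed_family2 fl) (conv_mul PC).
  rewrite -ef (alpha_emb_src ej); congr (iota _ _).
  by have [_ ep] := emb_proj (is_vertex_rng e).
move=> j l e f f' e' ej fl f'l e'j ef fe cE.
rewrite (mul22 j l)// (mul22 l j)// addrC; congr (iota _ (emb _)).
by rewrite -(krng_comp ef) cE krng_comp.
Qed.

End GraphToCrossed.

(** * From the crossed product to the graph algebra *)

Section ConjugateHom.
Variables (R : realType) (A B : cstar_algebra R) (c u : B).
Hypothesis uu : amul (astar u) u = c.

Lemma conj_star_hom (f : A -> B) : star_hom f -> (forall a, amul c (f a) = f a) ->
  star_hom (fun a => amul (amul u (f a)) (astar u)).
Proof.
move=> [fl fm fs] cf; split=> [z a b|a b|a].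
- by rewrite fl amulDr amulDl amulZr amulZl.
- by rewrite fm -!amulA [amul (astar u) (amul u _)]amulA uu [amul c _]amulA cf.
- by rewrite fs !astarM astarK amulA.
Qed.

End ConjugateHom.

Section CrossedToGraph.
Variables (R : realType) (k1 k2 n : nat).
Variables (L : kgraph k1) (M : kgraph k2) (O : kgraph (k1 + k2)).
Variable Phi : cdigraph_iso (skeleton (prod_kgraph L M)) (skeleton O).
Variable C : cdigraph_iso (cycle_cdigraph n k2) (skeleton M).

Local Notation sl i := (slice1 Phi (cyc_vert C i)).
Local Notation col2 j := (delta_mx 0 (rshift k1 j)).
Local Notation hat_ i j := (hat Phi (cyc_path C i j)).
Local Notation del j := (delta_mx 0 j).

Lemma finite_vertices : finite_set [set v : L | is_vertex v] ->
  finite_set [set x : O | is_vertex x].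
Proof.
move=> finL.
have finV : finite_set [set: vertex L].
  have -> : [set: vertex L] = val @^-1` [set v : L | is_vertex v].
    by apply/seteqP; split=> v // _; exact: valP.
  by apply: finite_preimage finL => v w _ _; exact: val_inj.
have finI : finite_set [set: 'I_n] by exact: finite_finset.
apply: (@sub_finite_set _ _ ((fun p : vertex L * 'I_n =>
  val (qvert Phi p.1 (cyc_vert C p.2))) @` ([set: vertex L] `*` [set: 'I_n]))).
  move=> x xv; have [|i /in_slice_vertexP[//|u ->]] := @cyc_slice_ex _ _ _ _ _ Phi _ C x.
    by rewrite (eqP xv) rsubmx_nat0.
  by exists (u, i).
by apply: finite_image; exact: finite_setX.
Qed.

Variables (A : 'I_n -> cstar_algebra R) (S : forall i, sl i -> A i).
Arguments S : clear implicits.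
Hypothesis SA : forall i, is_graph_algebra (S i).
Hypothesis rfO : row_finite O.
Variable rho : forall (i : 'I_n) (j : 'I_k2), A (ordS i) -> A i.
Arguments rho : clear implicits.
Hypothesis rhoP : forall i j, induced_by_kgraph_iso (S (ordS i)) (S i) (hat_ i j) (rho i j).
Variables (vs : seq O).
Hypothesis vs_uniq : uniq vs.
Hypothesis vsP : forall x, (x \in vs) = is_vertex x.

(** The identity of the direct sum, indexed by the same list as [ck_one] and [cycle_unitary] so that
    these sums compare term by term. *)
Definition dsum_one : dsum A := \sum_(v <- vs) emb S v.

Lemma dsum_one_star : astar dsum_one = dsum_one.
Proof.
rewrite astar_sum [LHS]big_seq [RHS]big_seq; apply: eq_bigr => v.
by rewrite vsP => /(emb_proj SA)[].
Qed.

Lemma dsum_one_mul i x : is_generator x -> amul (dsum_one i) (S i x) = S i x.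
Proof.
move=> xg; have [SCK _ _] := SA i.
rewrite /dsum_one dsum_sumE amul_suml
  (bigD1_seq (val (krng x))) ?vsP ?slice1_is_vertex ?is_vertex_rng//.
rewrite /emb slice_embE ck_mul_rng//; last exact: slice1_row_finite.
rewrite big_seq_cond big1 /= ?addr0// => v; rewrite vsP => /andP[vv /eqP vx].
have [l [y [yE yv]]] := slice_lift_vertex Phi C vv.
rewrite -yE in vx *; have [li|li] := eqVneq l i; last by rewrite slice_emb0// amul0l.
case: i / li x xg SCK vx => x xg SCK vx; rewrite slice_embE.
rewrite -(ck_mul_rng SCK (slice1_row_finite rfO) xg) amulA (ck1_orth SCK) ?amul0l//.
  exact: is_vertex_rng.
by move=> yx; apply: vx; rewrite yx.
Qed.

Lemma dsum_one_identity : is_identity dsum_one.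
Proof.
suff H i : is_identity (dsum_one i).
  by move=> a; split; apply: dsum_ext => i; rewrite dsum_mulE; have [] := H i (a i).
have [SCK gen _] := SA i.
have os : astar (dsum_one i) = dsum_one i by rewrite -dsum_starE dsum_one_star.
apply: (generates_identity gen os) => _ [x /= xg <-]; split; first exact: dsum_one_mul.
rewrite -(ck_mul_src SCK xg) -amulA; congr amul.
have [ss _] := ck_vertex_proj SCK (is_vertex_src x).
rewrite -os -[S i _]ss -astarM dsum_one_mul//.
exact/is_generator_vertex/is_vertex_src.
Qed.

Variables (B : cstar_algebra R) (SO : O -> B).
Hypothesis OB : is_graph_algebra SO.

Let SOCK : ck_family SO. Proof. by have [] := OB. Qed.

Local Notation one := (ck_one SO vs).

Let one_unit : is_identity one. Proof. exact: ck_one_identity OB rfO vs_uniq vsP. Qed.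
Let onel a : amul one a = a. Proof. by have [] := one_unit a. Qed.
Let oner a : amul a one = a. Proof. by have [] := one_unit a. Qed.

Lemma graph_algebra_extl (a b : B) :
  (forall v, is_vertex v -> amul (SO v) a = amul (SO v) b) -> a = b.
Proof.
move=> ab; rewrite -[a]onel -[b]onel !amul_suml [LHS]big_seq [RHS]big_seq.
by apply: eq_bigr => v; rewrite vsP; exact: ab.
Qed.

Lemma graph_algebra_extr (a b : B) :
  (forall v, is_vertex v -> amul a (SO v) = amul b (SO v)) -> a = b.
Proof.
move=> ab; rewrite -[a]oner -[b]oner !amul_sumr [LHS]big_seq [RHS]big_seq.
by apply: eq_bigr => v; rewrite vsP; exact: ab.
Qed.

(** Indexes the edges of colour j by their ranges, so that U_j is a sum over [vs]. The default v is
    never taken at a vertex. *)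
Definition edge_into j (v : O) : O := xget v [set f | kdeg f = col2 j /\ krng f = v].

Lemma edge_intoP j v : is_vertex v ->
  kdeg (edge_into j v) = col2 j /\ krng (edge_into j v) = v.
Proof.
move=> vv; rewrite /edge_into; case: xgetP => [f _ //|H].
by have [f fj fv] := col2_rng_ex Phi C j vv; have := H f; case.
Qed.

Lemma edge_intoE j (f : O) : kdeg f = col2 j -> edge_into j (krng f) = f.
Proof.
move=> fj; have [gj gr] := edge_intoP j (is_vertex_rng f).
exact: (col2_rng_inj Phi C gj fj gr).
Qed.

Definition cycle_unitary j : B := \sum_(v <- vs) SO (edge_into j v).
Local Notation U := cycle_unitary.

Let col2_gen j (f : O) : kdeg f = col2 j -> is_generator f.
Proof. by move=> /deg_is_edge/is_generator_edge. Qed.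

(** Orthogonality of the vertex projections leaves only the edge with range r(f). This and its
    mirror image at sources reduce identities for U_j to relations between single edges. *)
Lemma rng_cycle_unitary j (f : O) : kdeg f = col2 j -> amul (SO (krng f)) (U j) = SO f.
Proof.
move=> fj; rewrite amul_sumr (bigD1_seq (krng f)) ?vsP ?is_vertex_rng//=.
rewrite edge_intoE// (ck_mul_rng SOCK rfO) ?(col2_gen fj)//.
rewrite big_seq_cond big1 ?addr0// => v; rewrite vsP => /andP[vv /eqP vf].
have [gj gr] := edge_intoP j vv.
rewrite -(ck_mul_rng SOCK rfO (col2_gen gj)) gr amulA (ck1_orth SOCK) ?amul0l//.
  exact: is_vertex_rng.
by move=> fv; apply: vf.
Qed.

Lemma cycle_unitary_src j (f : O) : kdeg f = col2 j -> amul (U j) (SO (ksrc f)) = SO f.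
Proof.
move=> fj; rewrite amul_suml (bigD1_seq (krng f)) ?vsP ?is_vertex_rng//=.
rewrite edge_intoE// (ck_mul_src SOCK) ?(col2_gen fj)//.
rewrite big_seq_cond big1 ?addr0// => v; rewrite vsP => /andP[vv /eqP vf].
have [gj gr] := edge_intoP j vv.
rewrite -(ck_mul_src SOCK (col2_gen gj)) -amulA (ck1_orth SOCK) ?amul0r ?is_vertex_src//.
move=> gf; apply: vf; rewrite -gr; congr krng.
exact: (col2_src_inj Phi C gj fj gf).
Qed.

(** Tested at each vertex s(f): U^*U S_{s(f)} = U^* S_{r(f)} S_f = S_f^* S_f = S_{s(f)}. *)
Lemma cycle_unitary_VU j : amul (astar (U j)) (U j) = one.
Proof.
apply: graph_algebra_extr => v vv; rewrite onel -amulA.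
have [f fj fv] := col2_src_ex Phi C j vv; rewrite -fv (cycle_unitary_src fj).
rewrite -{1}(ck_mul_rng SOCK rfO (col2_gen fj)) amulA.
have [rs _] := ck_vertex_proj SOCK (is_vertex_rng f).
rewrite -{1}rs -astarM (rng_cycle_unitary fj) (ck3 SOCK)//.
exact: deg_is_edge fj.
Qed.

Lemma ck_col2_final j (f : O) : kdeg f = col2 j -> amul (SO f) (astar (SO f)) = SO (krng f).
Proof.
move=> fj; rewrite (ck4 SOCK (rshift k1 j) (is_vertex_rng f)).
have -> : out_set (krng f) (col2 j) = [set f]; last by rewrite fsbig_set1.
apply/seteqP; split=> [g [gv gj]|g ->] /=; last by split.
exact: (col2_rng_inj Phi C gj fj).
Qed.

Lemma cycle_unitary_UV j : amul (U j) (astar (U j)) = one.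
Proof.
apply: graph_algebra_extl => v vv; rewrite oner amulA.
have [f fj fv] := col2_rng_ex Phi C j vv; rewrite -fv (rng_cycle_unitary fj).
rewrite -[LHS]astarK astarM astarK -(ck_star_src SOCK (col2_gen fj)) amulA.
rewrite (cycle_unitary_src fj) (ck_col2_final fj).
by have [] := ck_vertex_proj SOCK (is_vertex_rng f).
Qed.

Lemma cycle_unitary_comm j l : amul (U j) (U l) = amul (U l) (U j).
Proof.
have key p q (f g : O) : kdeg f = col2 p -> kdeg g = col2 q -> ksrc f = krng g ->
    amul (SO (krng f)) (amul (U p) (U q)) = amul (SO f) (SO g).
  move=> fp gq fg; rewrite amulA (rng_cycle_unitary fp).
  by rewrite -{1}(ck_mul_src SOCK (col2_gen fp)) -amulA fg (rng_cycle_unitary gq).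
apply: graph_algebra_extl => v vv.
have [f fj fv] := col2_rng_ex Phi C j vv.
have [g gl gf] := col2_rng_ex Phi C l (is_vertex_src f).
have d : kdeg (kcomp f g) = col2 l + col2 j by rewrite kdeg_comp// fj gl addrC.
have [[g' f'] [/= [gf' e g'l f'j] _]] := kfactor d.
have rg' : krng g' = v by rewrite -(krng_comp gf') e krng_comp.
rewrite -{1}fv (key j l f g)// -rg' (key l j g' f')//.
exact: (ck2 SOCK (deg_is_edge fj) (deg_is_edge gl) (deg_is_edge g'l)
  (deg_is_edge f'j) (esym gf) gf' (esym e)).
Qed.

Variable phi_ : forall i, A i -> B.
Arguments phi_ : clear implicits.
Hypothesis phi_hom : forall i, star_hom (phi_ i).
Hypothesis phi_E : forall i x, is_generator x -> phi_ i (S i x) = SO (val x).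

(** The identities of two summands are sent to sums of vertex projections over disjoint sets of
    vertices. *)
Lemma slice_hom_orth i l (a : A i) (b : A l) : i != l -> amul (phi_ i a) (phi_ l b) = 0.
Proof.
move=> il; have [_ im _] := phi_hom i; have [_ lm _] := phi_hom l.
have au : amul a (dsum_one i) = a.
  have [_ /(congr1 (fun c : dsum A => c i))] := dsum_one_identity (dsum_in a).
  by rewrite dsum_mulE dsum_inE.
have bu : amul (dsum_one l) b = b.
  have [/(congr1 (fun c : dsum A => c l)) + _] := dsum_one_identity (dsum_in b).
  by rewrite dsum_mulE dsum_inE.
rewrite -au -bu im lm -amulA [amul (phi_ i _) (amul (phi_ l _) _)]amulA.
suff -> : amul (phi_ i (dsum_one i)) (phi_ l (dsum_one l)) = 0 by rewrite amul0l amul0r.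
rewrite /dsum_one !dsum_sumE [phi_ i _]star_hom_sum// [phi_ l _]star_hom_sum//.
rewrite amul_suml big1_seq// => v /=; rewrite vsP => vv.
rewrite amul_sumr big1_seq// => w /=; rewrite vsP => ww.
have [p [y [<- yv]]] := slice_lift_vertex Phi C vv.
have [q [z [<- zv]]] := slice_lift_vertex Phi C ww; rewrite /emb.
have [pi|pi] := eqVneq p i; last by rewrite slice_emb0// star_hom0// amul0l.
have [ql|ql] := eqVneq q l; last by rewrite (slice_emb0 _ _ ql) (star_hom0 (phi_hom l)) amul0r.
case: i / pi il {a au im} => il; case: l / ql il {b bu lm} => il.
rewrite !slice_embE !phi_E; [|exact: is_generator_vertex..].
apply: (ck1_orth SOCK); rewrite ?slice1_is_vertex// => yz.
case/eqP: il; apply: (cyc_slice_inj (in_slice_val y)).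
by rewrite yz; exact: in_slice_val.
Qed.

Definition phi (a : dsum A) : B := \sum_i phi_ i (a i).

Lemma phi_star_hom : star_hom phi.
Proof. exact: dsum_hom phi_hom slice_hom_orth. Qed.

Lemma phi_in i (a : A i) : phi (dsum_in a) = phi_ i a.
Proof. exact: dsum_in_hom_sum. Qed.

(** Conjugation by U_j makes this an equality of star-homomorphisms on the algebra of slice i + 1,
    so generators suffice. For the square x f' = f hat(x), the claim reduces to S_x S_{f'} = S_f
    S_{hat(x)}. *)
Lemma cycle_unitary_rho j i (a : A (ordS i)) :
  amul (U j) (phi_ i (rho i j a)) = amul (phi_ (ordS i) a) (U j).
Proof.
suff H : amul (amul (U j) (phi_ i (rho i j a))) (astar (U j)) = phi_ (ordS i) a.
  by rewrite -H -amulA cycle_unitary_VU oner.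
have SCKi := ck_family_slice Phi (cyc_vert C (ordS i)) SOCK.
suff : (fun a => amul (amul (U j) (phi_ i (rho i j a))) (astar (U j))) =1 phi_ (ordS i).
  exact.
apply: (graph_algebra_ext (SA (ordS i)) SCKi); [|exact: phi_hom| |exact: phi_E].
- apply: (conj_star_hom (cycle_unitary_VU j)) => //.
  exact: star_hom_comp (rho_hom rhoP i j) (phi_hom i).
- move=> x xg.
  have hg : is_generator (hat_ i j x).
    by rewrite (kgraph_iso_generator _ (hat_iso Phi C i j)).
  rewrite (rho_genE rhoP j xg) (phi_E hg).
  suff -> : amul (U j) (SO (val (hat_ i j x))) = amul (SO (val x)) (U j).
    by rewrite -amulA cycle_unitary_UV oner.
  have vg l (z : sl l) : is_generator z -> is_generator (val z).
    case/orP => [zv|/is_edgeP[q /slice1_edge_deg/deg_is_edge/is_generator_edge//]].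
    by apply: is_generator_vertex; rewrite slice1_is_vertex.
  have [f' f'j xf] := hat_edge_ex j x.
  have [_ [f [fj fy e]]] := hatP f'j xf.
  rewrite -(ck_mul_rng SOCK rfO (vg _ _ hg)) amulA -fy (cycle_unitary_src fj).
  rewrite -(ck_mul_src SOCK (vg _ _ xg)) -[RHS]amulA xf (rng_cycle_unitary f'j).
  (* CK2 covers edges only; for a vertex x the square degenerates to f' = f. *)
  case/orP: (xg) => [xv|xe].
    have xv' : is_vertex (val x) by rewrite slice1_is_vertex.
    have yv : val (hat_ i j x) = ksrc f.
      rewrite fy; apply/esym/is_vertex_rngP.
      by rewrite slice1_is_vertex /is_vertex hat_deg.
    have xr : val x = krng f' by rewrite -xf; apply/esym/is_vertexP.
    have ff' : f' = f by have := e; rewrite yv xr kcomp_idl kcomp_idr.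
    rewrite yv (ck_mul_src SOCK (col2_gen fj)) xr.
    by rewrite (ck_mul_rng SOCK rfO (col2_gen f'j)) ff'.
  have ve l (z : sl l) : is_edge z -> is_edge (val z).
    by case/is_edgeP => q /slice1_edge_deg/deg_is_edge.
  apply/esym/(ck2 SOCK) => //.
  + exact: ve.
  + exact: deg_is_edge f'j.
  + exact: deg_is_edge fj.
  apply: ve; have /is_edgeP[q xq] := xe; apply: (@deg_is_edge _ _ _ q).
  by rewrite hat_deg.
Qed.

Lemma phi_covariant j a :
  amul (astar (U j)) (phi a) = amul (phi (rho_gen rho j a)) (astar (U j)).
Proof.
have H : amul (U j) (phi (rho_gen rho j a)) = amul (phi a) (U j).
  rewrite amul_sumr amul_suml [RHS](reindex (@ordS n)) /=; last first.
    by apply: onW_bij; exists (@ord_pred n); [exact: ordSK|exact: ord_predK].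
  by apply: eq_bigr => i _; rewrite /rho_gen cycle_unitary_rho.
by rewrite -[phi a in LHS]oner -(cycle_unitary_UV j) [amul (phi a) _]amulA -H !amulA
  cycle_unitary_VU onel.
Qed.

Definition crossed_unitary : 'rV[int]_k2 -> B := unitary_pow one (fun j => astar (U j)).
Local Notation W := crossed_unitary.

Lemma graph_convolution_family :
  convolution_family (rho_action rho) (fun g a => amul (phi a) (W g)).
Proof.
apply: (@covariant_convolution_family _ _ _ _ (fun j => astar (U j)) one_unit).
- by move=> j; rewrite astarK cycle_unitary_VU.
- by move=> j; rewrite astarK cycle_unitary_UV.
- by move=> i j; rewrite -!astarM cycle_unitary_comm.
- by move=> j; have [] := rho_gen_iso rhoP j.
- exact: (rho_gen_comm SA rhoP).
- exact: phi_star_hom.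
- exact: phi_covariant.
Qed.

Let VUV j : amul (astar (U j)) (astar (astar (U j))) = one.
Proof. by rewrite astarK cycle_unitary_VU. Qed.
Let VVU j : amul (astar (astar (U j))) (astar (U j)) = one.
Proof. by rewrite astarK cycle_unitary_UV. Qed.
Let V_comm i j : amul (astar (U i)) (astar (U j)) = amul (astar (U j)) (astar (U i)).
Proof. by rewrite -!astarM cycle_unitary_comm. Qed.

Variables (P : cstar_algebra R) (iota : 'rV[int]_k2 -> dsum A -> P).
Hypothesis PX : is_crossed_product (rho_action rho) iota.

(** Both composites are compared with identities by uniqueness. On B, vertices and edges are
    checked. On P, Psi(phi a) = iota 0 a and Psi(U_j) = iota(-e_j)(1) determine Psi on every phi(a)
    W(x) by induction on x. *)
Lemma graph_crossed_iso : star_isomorphic B P.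
Proof.
have [PC _ Pu] := PX; have [aI a0 aD] := rho_action_is_action SA rhoP.
have TCK := crossed_family_ck SA rfO rhoP PC.
have [Psi Psih PsiE] := graph_algebra_map OB TCK.
have [Th [[Thh ThE] _]] := Pu _ _ graph_convolution_family.
have [_ Pm Ps] := Psih.
exists Psi; split=> //; exists Th.
  apply: (graph_algebra_ext OB SOCK (star_hom_comp Psih Thh) (star_hom_id B)) => //= x xg.
  rewrite PsiE//; case/orP: xg => [xv|/edge_cases[[a xa]|[j xj]]].
  - have [i [y [<- yv]]] := slice_lift_vertex Phi C xv.
    rewrite crossed_family_slice ThE phi_in phi_E; last exact: is_generator_vertex.
    by rewrite [W 0]unitary_pow0// oner.
  - have [i [y [<- /deg_is_edge ye]]] := slice_lift_edge Phi C xa.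
    rewrite crossed_family_slice ThE phi_in phi_E; last exact: is_generator_edge.
    by rewrite [W 0]unitary_pow0// oner.
  - rewrite (crossed_family2 S iota xj) ThE.
    rewrite [W _](unitary_powNdelta one_unit VUV VVU V_comm) astarK.
    have [i [y [yE yv]]] := slice_lift_vertex Phi C (is_vertex_rng x).
    rewrite -yE embE phi_in phi_E; last exact: is_generator_vertex.
    by rewrite yE rng_cycle_unitary.
have [al am as_] := phi_star_hom.
have Psi_phi : forall a, Psi (phi a) = iota 0 a.
  apply: (dsum_ext_hom (star_hom_comp phi_star_hom Psih) (convolution_star_hom a0 PC)).
  move=> i b /=; rewrite phi_in; move: b.
  have SCK : ck_family (S i) by have [] := SA i.
  have hK := ck_family_hom (slice1_row_finite rfO) SCK (iota0_in_hom SA rhoP PC i).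
  apply: (graph_algebra_ext (SA i) hK (star_hom_comp (phi_hom i) Psih)
    (iota0_in_hom SA rhoP PC i)) => // x xg /=.
  rewrite phi_E// PsiE ?crossed_family_slice//.
  case/orP: xg => [xv|/is_edgeP[q /slice1_edge_deg/deg_is_edge/is_generator_edge//]].
  by apply: is_generator_vertex; rewrite slice1_is_vertex.
have PsiU j : Psi (U j) = iota (- del j) dsum_one.
  rewrite star_hom_sum// [LHS]big_seq /dsum_one.
  have il : {morph iota (- del j) : a b / a + b} /\ iota (- del j) 0 = 0.
    split=> [a b|]; first by rewrite -[a]scale1r (conv_linear PC) !scale1r.
    have := conv_linear PC (- del j) 1 0 0; rewrite !scale1r addr0 => /eqP.
    by rewrite -[X in X == _]addr0 (inj_eq (addrI _)) eq_sym => /eqP.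
  rewrite (big_morph _ il.1 il.2) [RHS]big_seq; apply: eq_bigr => v.
  rewrite vsP => /(edge_intoP j)[gj gv]; rewrite PsiE ?(col2_gen gj)//.
  by rewrite (crossed_family2 S iota gj) gv.
(* An automorphism fixes the identity: use multiplicativity at a preimage of [dsum_one]. *)
have alpha1 x : rho_action rho x dsum_one = dsum_one.
  have [[_ axm _] [g gK aK]] := aI x.
  have := axm (g dsum_one) dsum_one; have [_ ->] := dsum_one_identity (g dsum_one).
  by rewrite aK => e; rewrite [RHS]e (dsum_one_identity _).1.
have iotaU x a j : amul (iota x a) (Psi (U j)) = iota (- del j + x) a.
  rewrite PsiU (conv_mul PC) alpha1 addrC.
  by have [_ ->] := dsum_one_identity a.
have iotaV x a j : amul (iota x a) (Psi (astar (U j))) = iota (del j + x) a.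
  rewrite Ps PsiU (conv_star PC) opprK dsum_one_star (conv_mul PC) !alpha1 addrC.
  by have [_ ->] := dsum_one_identity a.
(* Commutation lets each new factor of W stand on the right, where [iotaU] and [iotaV] apply. *)
have W_comm x y : amul (W x) (W y) = amul (W y) (W x).
  by rewrite -!(unitary_powD one_unit VUV VVU V_comm) addrC.
apply: (crossed_product_ext PX PC (star_hom_comp Thh Psih) (star_hom_id P)) => //= x a.
rewrite ThE Pm Psi_phi; elim/rowZ_ind: x => [|j x IH|j x IH].
- by rewrite [W 0]unitary_pow0// -Psi_phi -Pm oner.
- rewrite [W _](unitary_powD one_unit VUV VVU V_comm) [amul (unitary_pow _ _ _) _]W_comm.
  by rewrite Pm amulA IH [W _](unitary_pow_delta one_unit VUV VVU V_comm) iotaV.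
rewrite [W _](unitary_powD one_unit VUV VVU V_comm) [amul (unitary_pow _ _ _) _]W_comm.
by rewrite Pm amulA IH [W _](unitary_powNdelta one_unit VUV VVU V_comm) astarK iotaU.
Qed.

End CrossedToGraph.

Theorem theorem4p5 (R : realType) (k1 k2 n : nat)
  (n_gt0 : (0 < n)%N) (k2_gt0 : (0 < k2)%N)
  (Lambda : kgraph k1) (Gamma : kgraph k2) (Omega : kgraph (k1 + k2))
  (C : cdigraph_iso (cycle_cdigraph n k2) (skeleton Gamma))
  (Phi : cdigraph_iso (skeleton (prod_kgraph Lambda Gamma)) (skeleton Omega))
  (qpOmega : quasi_product Phi)
  (rfLambda : row_finite Lambda) (sfLambda : source_free Lambda)
  (rfOmega : row_finite Omega) (sfOmega : source_free Omega)
  (finLambda : finite_set [set v : Lambda | is_vertex v])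
  (COmega : cstar_algebra R) (SOmega : Omega -> COmega) (hCOmega : is_graph_algebra SOmega)
  (A : 'I_n -> cstar_algebra R)
  (S : forall i, slice1 Phi (cyc_vert C i) -> A i)
  (hA : forall i, is_graph_algebra (S i))
  (CLambda : cstar_algebra R) (SLambda : Lambda -> CLambda) (hCLambda : is_graph_algebra SLambda) :
  exists rho : forall (i : 'I_n) (j : 'I_k2), A (ordS i) -> A i,
    [/\ forall i j, induced_by_kgraph_iso (S (ordS i)) (S i)
          (hat Phi (cyc_path C i j)) (rho i j),
        is_action (rho_action rho),
        exists (theta : forall i, slice1 Phi (cyc_vert C i) -> Lambda)
               (Theta : forall i, A i -> CLambda),
          forall i, induced_by_kgraph_iso (S i) SLambda (theta i) (Theta i) &
        forall (P : cstar_algebra R) (iota : 'rV[int]_k2 -> dsum A -> P),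
          is_crossed_product (rho_action rho) iota ->
          star_isomorphic COmega P /\
          forall (theta : forall i, slice1 Phi (cyc_vert C i) -> Lambda)
                 (Theta : forall i, A i -> CLambda),
            (forall i, induced_by_kgraph_iso (S i) SLambda (theta i) (Theta i)) ->
            forall (Q : cstar_algebra R)
                   (kappa : 'rV[int]_k2 -> dsum (fun _ : 'I_n => CLambda) -> Q),
              is_crossed_product
                (transport (dsum_map Theta) (rho_action rho)) kappa ->
              star_isomorphic P Q].
Proof.
have [rho rhoP] := rho_exists hA.
exists rho; split=> //.
- exact: (rho_action_is_action hA rhoP).
- have [theta thetaI] : exists theta : forall i, slice1 Phi (cyc_vert C i) -> Lambda,
      forall i, is_kgraph_iso (theta i).
    apply: (@dependent_choice _ (fun i => slice1 Phi (cyc_vert C i) -> Lambda)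
      (fun i t => is_kgraph_iso t)) => i.
    exact: (slice_iso_factor C qpOmega k2_gt0).
  have [Th ThP] : exists Theta : forall i, A i -> CLambda,
      forall i, induced_by_kgraph_iso (S i) SLambda (theta i) (Theta i).
    apply: (@dependent_choice _ (fun i => A i -> CLambda)
      (fun i f => induced_by_kgraph_iso (S i) SLambda (theta i) f)) => i.
    exact: (graph_algebra_iso (hA i) (thetaI i) hCLambda).
  by exists theta, Th.
move=> P iota PX; split.
  (* Finiteness of the vertex set of Lambda enters here, giving the list over which the identities
     and the U_j are summed. *)
  have /finite_seqP[s sE] := finite_vertices Phi C finLambda.
  have vsP x : (x \in undup s) = is_vertex x.
    by rewrite mem_undup; apply/idP/idP => xs;
      [have : [set` s] x by []|have : [set x : Omega | is_vertex x] x by []];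
      rewrite ?sE // -sE.
  have [SCK _ _] := hCOmega.
  have [phi_ phiP] : exists phi_ : forall i, A i -> COmega, forall i,
      star_hom (phi_ i) /\ forall x, is_generator x -> phi_ i (S i x) = SOmega (val x).
    apply: (@dependent_choice _ (fun i => A i -> COmega) (fun i f =>
      star_hom f /\ forall x, is_generator x -> f (S i x) = SOmega (val x))) => i.
    have [f fh fE] := graph_algebra_map (hA i) (ck_family_slice Phi (cyc_vert C i) SCK).
    by exists f.
  apply: (graph_crossed_iso hA rfOmega rhoP (undup_uniq s) vsP hCOmega
    (fun i => (phiP i).1) (fun i => (phiP i).2) PX).
move=> theta Theta ThetaP Q kappa QX.
apply: crossed_product_transport PX QX.
by apply: dsum_map_iso => i; have [] := ThetaP i.
Qed.
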